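(* Let $n\ge2$. There exists a divergence-free vector field $u\in C^{1/2}(\mathbb R^n)\cap L^2(\mathbb R^n)$, $u:\mathbb R^n\to\mathbb R^n$, for which the associated pressure $p=\sum_{l,k=1}^n(-\Delta)^{-1}\partial_l\partial_k(u_lu_k)$ satisfies $p\notin C^1(\mathbb R^n)$.
   Context: Divergence-free means $\sum_k\partial_ku_k=0$ (in the sense of distributions). $(-\Delta)^{-1}\partial_l\partial_k$ is the Riesz-type Fourier multiplier operator with symbol $-\xi_l\xi_k/|\xi|^2$ (for a divergence-free vector field $u\in C^{1/2}(\mathbb R^n)\cap L^2(\mathbb R^n)$, $u:\mathbb R^n\to\mathbb R^n$, one has $u_lu_k\in L^1\cap L^\infty$, so it is well defined on $u_lu_k$, e.g. in $L^q$, $1<q<\infty$). $C^{1/2}$ is the Hölder space with norm $\|f\|_\infty+\sup_{x\ne y}|f(x)-f(y)|/|x-y|^{1/2}$. $C^1(\mathbb R^n)$ is the space of continuously differentiable functions with finite norm $\|f\|_\infty+\|\nabla f\|_\infty$. *)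

(* Defs.v *)
From HB Require Import structures.
From mathcomp Require Import all_boot all_order all_algebra.
From mathcomp Require Import all_classical all_reals all_analysis.
From mathcomp Require Import complex.

Set Implicit Arguments.
Unset Strict Implicit.
Unset Printing Implicit Defensive.

Import Order.TTheory GRing.Theory Num.Theory.
Import numFieldNormedType.Exports.

Local Open Scope classical_set_scope.
Local Open Scope ring_scope.

(* Points of R^n are the row vectors 'rV[R]_n, with the product (= Borel)
   sigma-algebra generated by the coordinates. *)
Section rV_measurable.
Context (R : realType) (n : nat).

Definition rV_coord (i : 'I_n) (x : 'rV[R]_n) : measurableTypeR R := x 0 i.

Let rV_set0 : g_sigma_preimage rV_coord set0.
Proof. exact: sigma_algebra0. Qed.

Let rV_setC A : g_sigma_preimage rV_coord A -> g_sigma_preimage rV_coord (~` A).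
Proof. exact: sigma_algebraC. Qed.

Let rV_bigcup (F : _^nat) : (forall i, g_sigma_preimage rV_coord (F i)) ->
  g_sigma_preimage rV_coord (\bigcup_i (F i)).
Proof. exact: sigma_algebra_bigcup. Qed.

HB.instance Definition _ := @isMeasurable.Build default_measure_display
  'rV[R]_n (g_sigma_preimage rV_coord) rV_set0 rV_setC rV_bigcup.

Lemma measurable_rV_coord i : measurable_fun setT (rV_coord i).
Proof.
move=> _ Y mY; rewrite setTI; apply: sub_sigma_algebra => /=.
rewrite -bigcup_seq/=; exists i => /=; first by rewrite mem_index_enum.
by exists Y => //; rewrite setTI.
Qed.

Lemma measurable_fun_rVP d (T : measurableType d) (f : T -> 'rV[R]_n) :
  (forall i, measurable_fun setT (rV_coord i \o f)) -> measurable_fun setT f.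
Proof.
move=> mf.
have : g_sigma_preimage (fun i => rV_coord i \o f) `<=` measurable.
  apply: smallest_sub; first exact: sigma_algebra_measurable.
  rewrite -bigcup_seq; apply: bigcup_sub => i _ A [B mB <-].
  exact: mf.
rewrite (@g_sigma_preimage_comp _ _ _ 'rV[R]_n) => prefS _ A mA.
by apply: prefS; exists A.
Qed.

End rV_measurable.

Section lebesgue_rV.
Context (R : realType).

Definition cons_rV n (z : measurableTypeR R * 'rV[R]_n) : 'rV[R]_n.+1 :=
  \row_i oapp (fun j => z.2 0 j) (z.1 : R) (unlift ord0 i).

Definition uncons_rV n (x : 'rV[R]_n.+1) : measurableTypeR R * 'rV[R]_n :=
  (x 0 ord0, \row_j x 0 (lift ord0 j)).

Lemma cons_rVK n : cancel (@cons_rV n) (@uncons_rV n).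
Proof.
move=> [t y]; rewrite /uncons_rV /cons_rV mxE unlift_none /=; congr pair.
by apply/rowP => j; rewrite !mxE liftK.
Qed.

Lemma measurable_cons_rV n : measurable_fun setT (@cons_rV n).
Proof.
apply: measurable_fun_rVP => i; case: (unliftP ord0 i) => [j|] ->.
  rewrite (_ : _ \o _ = rV_coord j \o snd); last first.
    by apply/funext => z /=; rewrite /rV_coord mxE liftK.
  by apply: measurableT_comp => //; exact: measurable_rV_coord.
rewrite (_ : _ \o _ = fst) //.
by apply/funext => z /=; rewrite /rV_coord mxE unlift_none.
Qed.

Lemma measurable_uncons_rV n : measurable_fun setT (@uncons_rV n).
Proof.
apply/measurable_fun_pairP; split; first exact: (@measurable_rV_coord R n.+1).
apply: measurable_fun_rVP => j.
rewrite (_ : _ \o _ = rV_coord (lift ord0 j)); first exact: measurable_rV_coord.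
by apply/funext => x /=; rewrite /rV_coord mxE.
Qed.

Section step.
Variables (n : nat) (m : {sigma_finite_measure set 'rV[R]_n -> \bar R}).

Definition lebesgue_rV_step : set 'rV[R]_n.+1 -> \bar R :=
  pushforward (@lebesgue_measure R \x m)%E (@cons_rV n).

HB.instance Definition _ := Measure.copy lebesgue_rV_step
  (measure_function_pushforward__canonical__measure_function_Measure
    ((@lebesgue_measure R \x m)%E :
       {measure set (measurableTypeR R * 'rV[R]_n)%type -> \bar R})
    (@measurable_cons_rV n)).

Let lebesgue_rV_step_sigma_finite : sigma_finite setT lebesgue_rV_step.
Proof.
have /sigma_finiteP[F [TF ndF Foo]] := sigma_finiteT (@lebesgue_measure R).
have /sigma_finiteP[G [TG ndG Goo]] := sigma_finiteT m.
exists (fun k => @uncons_rV n @^-1` (F k `*` G k)).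
  rewrite -preimage_bigcup (_ : \bigcup_k _ = setT) ?preimage_setT//.
  rewrite -subTset => -[t y] _.
  have [i _ Fit] : (\bigcup_i F i) t by rewrite -TF.
  have [j _ Gjy] : (\bigcup_j G j) y by rewrite -TG.
  exists (maxn i j) => //; split => /=.
    by move: t Fit; exact/subsetPset/ndF/leq_maxl.
  by move: y Gjy; exact/subsetPset/ndG/leq_maxr.
move=> k; have [mF Fk] := Foo k; have [mG Gk] := Goo k; split.
  rewrite -[X in measurable X]setTI; apply: measurable_uncons_rV => //.
  exact: measurableX.
rewrite /lebesgue_rV_step /pushforward -comp_preimage.
rewrite (_ : _ \o _ = id) ?preimage_id//; last first.
  by apply/funext => z /=; rewrite cons_rVK.
by rewrite product_measure1E// lte_mul_pinfty// ge0_fin_numE.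
Qed.

HB.instance Definition _ := Measure_isSigmaFinite.Build _ _ _ lebesgue_rV_step
  lebesgue_rV_step_sigma_finite.

End step.

(* n-dimensional Lebesgue measure: the n-fold product of the one-dimensional
   one (see lebesgue_rV_box below). *)
Fixpoint lebesgue_rV (n : nat) : {sigma_finite_measure set 'rV[R]_n -> \bar R} :=
  match n with
  | 0 => \d_(0 : 'rV[R]_0)
  | k.+1 => lebesgue_rV_step (lebesgue_rV k)
  end.

Lemma lebesgue_rV_box n (A : 'I_n -> set R) :
  (forall i, measurable (A i)) ->
  lebesgue_rV n [set x | forall i, A i (x 0 i)] =
  (\prod_(i < n) lebesgue_measure (A i))%E.
Proof.
elim: n A => [|n IH] A mA.
  rewrite big_ord0 /= diracE mem_set//= => -[]//.
rewrite big_ord_recl -IH//.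
pose B := [set x : 'rV[R]_n | forall i : 'I_n, A (lift ord0 i) (x 0 i)].
have mB : measurable B.
  have -> : B = \bigcap_(i in [set: 'I_n]) (rV_coord i @^-1` A (lift ord0 i)).
    by apply/seteqP; split=> [x Bx i _|x Bx i]; [exact: (Bx i)|exact: (Bx i I)].
  apply: fin_bigcap_measurable => // i _.
  by rewrite -[X in measurable X]setTI; exact: (measurable_rV_coord i measurableT (mA _)).
rewrite -[X in (_ * lebesgue_rV n X)%E]/B /= /lebesgue_rV_step /pushforward.
rewrite -product_measure1E; [|exact: mA|exact: mB].
congr (_ _); apply/seteqP; split=> -[t y] /=.
  move=> Az; split=> [|i].
    by have := Az ord0; rewrite mxE unlift_none.
  by have := Az (lift ord0 i); rewrite mxE liftK.
move=> [At Ay] i; rewrite mxE.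
by case: (unliftP ord0 i) => [j|] ->.
Qed.

End lebesgue_rV.
Arguments lebesgue_rV {R n}.

Section euclidean.
Context (R : realType) (n : nat).
Implicit Types (x y : 'rV[R]_n) (f : 'rV[R]_n -> R).

Definition dotp x y : R := \sum_(i < n) x 0 i * y 0 i.

(* The library norm on 'rV[R]_n is the sup norm; this is the Euclidean one. *)
Definition enorm x : R := Num.sqrt (dotp x x).

Definition partial (i : 'I_n) f : 'rV[R]_n -> R := 'D_(delta_mx 0 i) f.

Definition gradient f x : 'rV[R]_n := \row_i partial i f x.

(* The space C^1(R^n) of continuously differentiable functions with
   sup |f| + sup |grad f| finite. *)
Definition C1b f : Prop :=
  [/\ forall x, differentiable f x,
      continuous (gradient f),
      exists M, forall x, `|f x| <= M
    & exists M, forall x, enorm (gradient f x) <= M].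

Definition iter_partial (s : seq 'I_n) f : 'rV[R]_n -> R := foldr partial f s.

Definition smooth f : Prop :=
  forall (s : seq 'I_n) x, differentiable (iter_partial s f) x.

Definition test_function f : Prop :=
  smooth f /\ exists r : R, forall x, r < enorm x -> f x = 0.

Definition schwartz f : Prop :=
  smooth f /\ forall (k : nat) (s : seq 'I_n), exists M : R,
    forall x, enorm x ^+ k * `|iter_partial s f x| <= M.

End euclidean.

Section vector_fields.
Context (R : realType) (n : nat).
Implicit Type u : 'rV[R]_n -> 'rV[R]_n.

(* The Hoelder space C^a(R^n; R^n), for the norm
   sup |u| + sup_(x != y) |u x - u y| / |x - y| ^ a. *)
Definition holder (a : R) u : Prop :=
  (exists M, forall x, enorm (u x) <= M) /\
  (exists M, forall x y, x != y ->
     enorm (u x - u y) / (enorm (x - y) `^ a) <= M).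

Definition square_integrable u : Prop :=
  forall k : 'I_n, (fun x => u x 0 k) \in Lfun (@lebesgue_rV R n) 2%:E.

(* div u = 0 in the sense of distributions. *)
Definition divergence_free u : Prop :=
  forall phi : 'rV[R]_n -> R, test_function phi ->
  \sum_(k < n) \int[@lebesgue_rV R n]_x (u x 0 k * partial k phi x) = 0.

End vector_fields.

Section fourier_multipliers.
Local Open Scope complex_scope.
Context (R : realType) (n : nat).
Implicit Types (f g : 'rV[R]_n -> R) (m : 'rV[R]_n -> R) (x xi : 'rV[R]_n).

Definition cintegral (F : 'rV[R]_n -> R[i]) : R[i] :=
  (\int[@lebesgue_rV R n]_x complex.Re (F x)) +i*
  (\int[@lebesgue_rV R n]_x complex.Im (F x)).

Definition cis (t : R) : R[i] := cos t +i* sin t.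

Definition fourier f xi : R[i] :=
  cintegral (fun x => (f x)%:C * cis (- dotp x xi)).

(* g is the image of f under the Fourier multiplier operator with (real,
   bounded) symbol m: the Fourier transform of g, as a tempered distribution,
   is m times the Fourier transform of f. Since f is integrable the latter is
   a bounded function, given pointwise by [fourier f]; the transform of g is
   defined by duality, <g^, phi> = <g, phi^>. By linearity it is enough to test
   against real-valued Schwartz functions. This determines g up to a null set.
   The symbols used below are homogeneous of degree 0, so the normalisation of
   the frequency variable is immaterial. *)
Definition fourier_multiplier m f g : Prop :=
  [/\ f \in Lfun (@lebesgue_rV R n) 1%:E,
      g \in Lfun (@lebesgue_rV R n) 2%:E
    & forall phi : 'rV[R]_n -> R, schwartz phi ->
      cintegral (fun x => (g x)%:C * fourier phi x) =
      cintegral (fun xi => (m xi)%:C * fourier f xi * (phi xi)%:C)].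

(* Symbol of (-Delta)^-1 d_l d_k; its value at the origin is irrelevant. *)
Definition riesz_symbol (l k : 'I_n) xi : R :=
  - (xi 0 l * xi 0 k) / enorm xi ^+ 2.

(* p = \sum_(l, k) (-Delta)^-1 d_l d_k (u_l u_k) almost everywhere. *)
Definition pressure (u : 'rV[R]_n -> 'rV[R]_n) (p : 'rV[R]_n -> R) : Prop :=
  exists2 P : 'I_n -> 'I_n -> 'rV[R]_n -> R,
    forall l k, fourier_multiplier (riesz_symbol l k)
                  (fun x => u x 0 l * u x 0 k) (P l k)
    & {ae @lebesgue_rV R n, forall x, p x = \sum_(l < n) \sum_(k < n) P l k x}.

(* As p is only defined up to null sets, p belongs to C^1 when it agrees almost
   everywhere with a C^1 function. *)
Definition ae_C1b (p : 'rV[R]_n -> R) : Prop :=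
  exists2 q, C1b q & {ae @lebesgue_rV R n, forall x, p x = q x}.

End fourier_multipliers.

(* Main.v *)
Require Import Defs.
From HB Require Import structures.
From mathcomp Require Import all_boot all_order all_algebra.
From mathcomp Require Import all_classical all_reals all_analysis.
From mathcomp Require Import measurable_realfun gauss_integral complex ring lra.

Set Implicit Arguments.
Unset Strict Implicit.
Unset Printing Implicit Defensive.

Import Order.TTheory GRing.Theory Num.Theory.
Import numFieldNormedType.Exports.

Local Open Scope classical_set_scope.
Local Open Scope ring_scope.

(* With (x0, x1) the first two coordinates, take the rotating vortex
   u x = (- x1, x0, 0, ..., 0) h(|x|),  h(r) = exp (- r^2 / 2) / sqrt r.
   It is tangent to spheres, hence divergence free, and of size |x|^(1/2) near
   the origin. The products u_l u_k are, up to sign,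
   x_i x_j exp (- |x|^2) / |x|, i, j in {0, 1}; writing
   1 / |x| = pi^(-1/2) \int_R exp (- v^2 |x|^2) dv turns them into superpositions
   of Hermite-Gauss functions of width (1 + v^2)^(-1/2). On the Fourier side each
   becomes a polynomial times exp (- |xi|^2 / (4 s)), s = 1 + v^2, and division by
   |xi|^2 is again a superposition of Gaussians, exp (- y^2 |xi|^2 / (4 s)) over
   y >= 1. Inverting the transforms gives the explicit pressure
   p x = pi^(-1/2) \int_R \int_(y >= 1) y^(- n - 1) / s
           ((s / y^2) (x0^2 + x1^2) - 1) exp (- (s / y^2) |x|^2) dy dv,
   and the part of the integral where |v| |x| >= 1 shows p x - p 0 >= c |x| near
   0: p has a conical minimum at the origin, and no C^1 function does. *)

(** The exponent 1/2 is the borderline. Near the origin the products u_l u_k have degree 1 to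
    leading order and the multipliers have order 0, so one expects p - p 0 to have degree 1 as well.
    It is even, so it can be C^1 at 0 only if this leading part vanishes; the cone estimate excludes
    that. The Gaussian in h provides decay and computable transforms. [fourier_multiplier] is a
    statement of duality, so the explicit p only has to be verified: the multiplication formula for
    each Gaussian and Fubini against a Schwartz function replace an inversion theorem. The delicate
    point is xi = 0, where 1 / |xi|^2 is compensated by a factor xi_0^2 or xi_1^2 in every
    numerator, but only after integration over y. [pressure] asks for each entry (l, k) separately.
    Single entries have a numerator xi_0^2 xi_1^2, which requires a potential of its own and cancels
    only in the sum; this is why the formula for p contains no fourth-order term. Everything is
    even, so sine transforms vanish and complex identities become identities between cosine
    transforms. *)

Section measurability.
Context (R : realType).

Lemma measurable_ball_rV n (c : 'rV[R]_n) (e : R) : 0 < e -> measurable (ball c e).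
Proof.
move=> e0.
have -> : ball c e = \bigcap_(i in [set: 'I_n]) (@rV_coord R n i @^-1` ball (c 0 i) e).
  apply/seteqP; split=> [x [_ bx] i _|x bx]; first exact: bx.
  by split => // i j; rewrite (ord1 i); apply: (bx j).
apply: fin_bigcap_measurable => // i _.
rewrite -[X in measurable X]setTI.
by apply: (measurable_rV_coord i measurableT); exact: open_measurable (ball_open _ _).
Qed.

(** The sigma-algebra is generated by the coordinates, so open sets need an argument: by density of
    the rationals they are countable unions of sup-norm balls, that is boxes, with rational centre
    and radius [1 / k.+1]. *)
Lemma open_measurable_rV n (U : set 'rV[R]_n) : open U -> measurable U.
Proof.
move=> oU.
pose c (p : 'rV[rat]_n * nat) : 'rV[R]_n := map_mx ratr p.1.
pose B p := ball (c p) p.2.+1%:R^-1.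
have -> : U = \bigcup_(p in [set p | B p `<=` U]) B p.
  apply/seteqP; split=> [x Ux|x [p pU]]; last exact: pU.
  have /nbhs_ballP[e /= e0 eU] : nbhs x U by move: oU; rewrite openE; apply.
  have [k ke] : exists k : nat, k.+1%:R^-1 < e / 2.
    have e20 : 0 < e / 2 by rewrite divr_gt0.
    exists (Num.bound (e / 2)^-1); rewrite -[ltRHS]invrK ltf_pV2 ?posrE ?invr_gt0//.
    rewrite (lt_trans (archi_boundP _))// ?invr_ge0 ?(ltW e20)//.
    by rewrite ltr_nat.
  have /choice[q qP] : forall i, exists q : rat, `|x 0 i - ratr q| < k.+1%:R^-1.
    move=> i; have [q] := @rat_in_itvoo R (x 0 i - k.+1%:R^-1) (x 0 i + k.+1%:R^-1)
      ltac:(by rewrite ltrD2l gtrN ?invr_gt0).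
    by rewrite in_itv/= => /andP[q1 q2]; exists q; rewrite ltr_norml; move: q1 q2; move: (_^-1) => d q1 q2; apply/andP; split; lra.
  exists (\row_i q i, k).
    move=> y [_ By]; apply: eU; split => // i j; rewrite (ord1 i).
    have := By 0 j; rewrite /ball/= /c/= !mxE => h.
    have := qP j => h'.
    rewrite (le_lt_trans (ler_distD (ratr (q j)) _ _))//.
    by rewrite [ltRHS]splitr (lt_trans (ltrD h' h))// ltrD.
  split => //; rewrite ?invr_gt0// => i j; rewrite (ord1 i) /ball/= /c/= !mxE.
  by rewrite distrC.
rewrite bigcup_mkcond; apply: countable_bigcupT_measurable => [|p]; first exact: countableP.
by case: ifPn => _ //; apply: measurable_ball_rV; rewrite invr_gt0.
Qed.

Lemma continuous_measurable_rV n (f : 'rV[R]_n -> R) :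
  continuous f -> measurable_fun setT f.
Proof.
move=> cf; apply: (measurability _ (RGenOpens.measurableE R)).
move=> _ [_ [a [b ->] <-]]; rewrite setTI; apply: open_measurable_rV.
by apply: open_comp => // x _; exact: cf.
Qed.

(** Inversion is discontinuous at 0, but x^-1 is x times a real power of x^2, and real powers are
    measurable; the factor x also reproduces the convention 0^-1 = 0. *)
Lemma measurable_funV_real d (T : measurableType d) (D : set T) (f : T -> R) :
  measurable_fun D f -> measurable_fun D (fun x => (f x)^-1).
Proof.
move=> mf; rewrite (_ : (fun x => _) = fun x => f x * (f x ^+ 2) `^ (-1)).
  apply: measurable_funM => //.
  apply: (measurableT_comp (measurable_powR _)) => //.
  exact: measurable_funX.
apply/funext => x; rewrite powR_inv1 ?sqr_ge0//.
by have [->|f0] := eqVneq (f x) 0; [rewrite invr0 mul0r|rewrite expr2 invfM mulrA divff// mul1r].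
Qed.

Lemma measurable_sqrt d (T : measurableType d) (D : set T) (f : T -> R) :
  measurable_fun D f -> measurable_fun D (fun x => Num.sqrt (f x)).
Proof.
move=> mf; apply: (measurableT_comp _ mf).
by apply: continuous_measurable_fun; exact: sqrt_continuous.
Qed.

End measurability.

(** * Measurability and integration *)

Notation integrable_fun mu f := ((mu).-integrable [set: _] (EFin \o f)).

Section Rintegral_tools.
Context d (T : measurableType d) (R : realType) (mu : {measure set T -> \bar R}).
Implicit Types f g h : T -> R.

Lemma integrable_fun_measurable f : integrable_fun mu f -> measurable_fun setT f.
Proof. by move=> /integrableP[/measurable_EFinP]. Qed.

Lemma integrable_fun_dominated g f : measurable_fun setT f ->
  (forall x, `|f x| <= g x) -> integrable_fun mu g -> integrable_fun mu f.
Proof.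
move=> mf fg; apply: le_integrable => //; first exact/measurable_EFinP.
by move=> x _; rewrite lee_fin (le_trans (fg x))// ler_norm.
Qed.

Lemma integrable_funZl c f :
  integrable_fun mu f -> integrable_fun mu (fun x => c * f x).
Proof.
by move=> If; have := integrableZl measurableT c If; apply: eq_integrable => //.
Qed.

Lemma integrable_funD f g : integrable_fun mu f -> integrable_fun mu g ->
  integrable_fun mu (fun x => f x + g x).
Proof.
by move=> If Ig; have := integrableD measurableT If Ig; apply: eq_integrable.
Qed.

Lemma integrable_funB f g : integrable_fun mu f -> integrable_fun mu g ->
  integrable_fun mu (fun x => f x - g x).
Proof.
by move=> If Ig; have := integrableB measurableT If Ig; apply: eq_integrable.
Qed.

Lemma integrable_fun_norm f :
  integrable_fun mu f -> integrable_fun mu (fun x => `|f x|).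
Proof.
by move=> If; have := integrable_abse If; apply: eq_integrable.
Qed.

Lemma integrable_fun_bounded (c : R) f h : measurable_fun setT h ->
  (forall x, `|h x| <= c) ->
  integrable_fun mu f -> integrable_fun mu (fun x => f x * h x).
Proof.
move=> mh hc If; have mf := integrable_fun_measurable If.
apply: (@integrable_fun_dominated (fun x => c * `|f x|)).
- exact: measurable_funM.
- by move=> x; rewrite normrM mulrC ler_wpM2r.
- by apply: integrable_funZl; exact: integrable_fun_norm.
Qed.

Lemma integral_ge0_lty f : measurable_fun setT f -> (forall x, 0 <= f x) ->
  (\int[mu]_x (f x)%:E < +oo)%E -> integrable_fun mu f.
Proof.
move=> mf f0 foo; apply/integrableP; split; first exact/measurable_EFinP.
by under eq_integral do rewrite /= ger0_norm//.
Qed.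

Lemma EFin_Rintegral f : integrable_fun mu f ->
  (\int[mu]_x f x)%:E = (\int[mu]_x (f x)%:E)%E.
Proof. by move=> If; rewrite /Rintegral fineK//; exact: integrable_fin_num. Qed.

Lemma eq_Rint f g : f =1 g -> \int[mu]_x f x = \int[mu]_x g x.
Proof. by move=> fg; apply: eq_Rintegral => x _. Qed.

Lemma ae_eq_integrable (f g : T -> \bar R) : measurable_fun setT f ->
  measurable_fun setT g -> ae_eq mu setT f g ->
  mu.-integrable setT f -> mu.-integrable setT g.
Proof.
move=> mf mg fg /integrableP[_ foo]; apply/integrableP; split => //.
rewrite (ae_eq_integral (abse \o f))//; [exact: measurableT_comp..|].
by apply: filterS fg => x /= /[apply] ->.
Qed.

End Rintegral_tools.

(** * Product measures and Fubini for real-valued integrals *)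

Section product_sigma_finite.
Context d1 d2 (T1 : measurableType d1) (T2 : measurableType d2) (R : realType).
Variables (m1 : {sigma_finite_measure set T1 -> \bar R})
          (m2 : {sigma_finite_measure set T2 -> \bar R}).

Let product_sigma_finite : sigma_finite setT (m1 \x m2)%E.
Proof.
have /sigma_finiteP[F [TF ndF Foo]] := sigma_finiteT m1.
have /sigma_finiteP[G [TG ndG Goo]] := sigma_finiteT m2.
exists (fun k => F k `*` G k).
  apply/esym; rewrite -subTset => -[t y] _.
  have [i _ Fit] : (\bigcup_i F i) t by rewrite -TF.
  have [j _ Gjy] : (\bigcup_j G j) y by rewrite -TG.
  exists (maxn i j) => //; split => /=.
    by move: t Fit; exact/subsetPset/ndF/leq_maxl.
  by move: y Gjy; exact/subsetPset/ndG/leq_maxr.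
move=> k; have [mF Fk] := Foo k; have [mG Gk] := Goo k; split.
  exact: measurableX.
by rewrite product_measure1E// lte_mul_pinfty// ge0_fin_numE.
Qed.

(* [m1 \x m2] itself is canonically sigma-finite only for subprobabilities. *)
Definition sfprod : set (T1 * T2) -> \bar R := (m1 \x m2)%E.

HB.instance Definition _ := Measure.copy sfprod
  ((m1 \x m2)%E : {measure set (T1 * T2)%type -> \bar R}).

HB.instance Definition _ := Measure_isSigmaFinite.Build _ _ _ sfprod
  product_sigma_finite.

End product_sigma_finite.

Section Rintegral_product.
Context d1 d2 (T1 : measurableType d1) (T2 : measurableType d2) (R : realType).
Variables (m1 : {sigma_finite_measure set T1 -> \bar R})
          (m2 : {sigma_finite_measure set T2 -> \bar R}).
Variable f : T1 * T2 -> R.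

Lemma integrable_productP : measurable_fun setT f ->
  (forall x, integrable_fun m2 (fun y => f (x, y))) ->
  integrable_fun m1 (fun x => \int[m2]_y `|f (x, y)|) ->
  integrable_fun (m1 \x m2)%E f.
Proof.
move=> mf I2 I1; apply/integrable12ltyP; first exact/measurable_EFinP.
move/integrableP : I1 => [_]; apply: le_lt_trans; rewrite le_eqVlt; apply/orP; left.
apply/eqP; apply: eq_integral => x _ /=.
rewrite ger0_norm ?Rintegral_ge0//.
by rewrite EFin_Rintegral//; apply: integrable_fun_norm.
Qed.

Hypothesis If : integrable_fun (m1 \x m2)%E f.

(** The integral in R is [fine] of the extended one, so it takes a default value on slices that are
    not integrable. Fubini makes these slices negligible, and that carries its conclusions over to
    real-valued iterated integrals. *)
Let ae1 : ae_eq m1 setT (fun x => \int[m2]_y (f (x, y))%:E)%E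
  (EFin \o fun x => \int[m2]_y f (x, y)).
Proof.
have := ae_integrable1 If; apply: filterS => x /= Ix _.
by rewrite EFin_Rintegral.
Qed.

Let ae2 : ae_eq m2 setT (fun y => \int[m1]_x (f (x, y))%:E)%E
  (EFin \o fun y => \int[m1]_x f (x, y)).
Proof.
have := ae_integrable2 If; apply: filterS => x /= Ix _.
by rewrite EFin_Rintegral.
Qed.

Lemma measurable_Rintegral1 : measurable_fun setT (fun x => \int[m2]_y f (x, y)).
Proof.
apply: (measurableT_comp (@fine_measurable R setT measurableT)).
exact: measurable_fubini_F If.
Qed.

Lemma measurable_Rintegral2 : measurable_fun setT (fun y => \int[m1]_x f (x, y)).
Proof.
apply: (measurableT_comp (@fine_measurable R setT measurableT)).
exact: measurable_fubini_G If.
Qed.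

Lemma integrable_Rintegral1 : integrable_fun m1 (fun x => \int[m2]_y f (x, y)).
Proof.
apply: ae_eq_integrable _ _ ae1 _.
- exact: measurable_fubini_F If.
- by apply/measurable_EFinP; exact: measurable_Rintegral1.
- exact: integrable_fubini_F If.
Qed.

Lemma integrable_Rintegral2 : integrable_fun m2 (fun y => \int[m1]_x f (x, y)).
Proof.
have mf := measurable_int _ If.
have Ifs : (m2 \x m1)%E.-integrable setT (fun z => (f (z.2, z.1))%:E).
  apply/integrable12ltyP; first exact: (measurableT_comp mf (@measurable_swap _ _ T2 T1)).
  by have /(integrable21ltyP _ _ mf) := If.
apply: ae_eq_integrable _ _ ae2 _.
- exact: measurable_fubini_G If.
- by apply/measurable_EFinP; exact: measurable_Rintegral2.
- exact: integrable_fubini_F Ifs.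
Qed.

Lemma Rintegral_product1 :
  \int[m1]_x \int[m2]_y f (x, y) = \int[(m1 \x m2)%E]_z f z.
Proof.
rewrite /Rintegral -(integral12_prod_meas1 If); congr fine.
apply: ae_eq_integral => //; last exact/ae_eq_sym/ae1.
- by apply/measurable_EFinP; exact: measurable_Rintegral1.
- exact: measurable_fubini_F If.
Qed.

Lemma Rintegral_product2 :
  \int[m2]_y \int[m1]_x f (x, y) = \int[(m1 \x m2)%E]_z f z.
Proof.
rewrite /Rintegral -(integral21_prod_meas1 If); congr fine.
apply: ae_eq_integral => //; last exact/ae_eq_sym/ae2.
- by apply/measurable_EFinP; exact: measurable_Rintegral2.
- exact: measurable_fubini_G If.
Qed.

Lemma Rintegral_swap :
  \int[m1]_x \int[m2]_y f (x, y) = \int[m2]_y \int[m1]_x f (x, y).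
Proof. by rewrite Rintegral_product1 Rintegral_product2. Qed.

End Rintegral_product.

Section lebesgue_rV_fubini.
Context (R : realType) (n : nat).
Local Notation lam := (@lebesgue_rV R n).
Local Notation lamS := (@lebesgue_rV R n.+1).
Local Notation leb := (@lebesgue_measure R).
Implicit Type F : 'rV[R]_n.+1 -> R.

Lemma integrable_cons_rV F : measurable_fun setT F ->
  integrable_fun lamS F <-> integrable_fun (leb \x lam)%E (F \o @cons_rV R n).
Proof.
move=> mF; split=> /integrableP[_ Foo]; apply/integrableP; split.
- by apply/measurable_EFinP/measurableT_comp => //; exact: measurable_cons_rV.
- move: Foo; rewrite ge0_integral_pushforward//.
    exact: measurable_cons_rV.
  by apply/measurable_EFinP; exact: measurableT_comp.
- exact/measurable_EFinP.
- rewrite ge0_integral_pushforward//.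
    exact: measurable_cons_rV.
  by apply/measurable_EFinP; exact: measurableT_comp.
Qed.

Lemma integral_cons_rV F : integrable_fun lamS F ->
  (\int[lamS]_x (F x)%:E = \int[(leb \x lam)%E]_z (F (cons_rV z))%:E)%E.
Proof.
move=> IF; have mF := integrable_fun_measurable IF.
rewrite integral_pushforward//; first exact: measurable_cons_rV.
- exact/measurable_EFinP.
- exact/(integrable_cons_rV mF).
Qed.

Lemma integrable_tensor F (f : R -> R) (g : 'rV[R]_n -> R) :
  measurable_fun setT F ->
  (forall t y, F (cons_rV (t, y)) = f t * g y) ->
  integrable_fun leb f -> integrable_fun lam g -> integrable_fun lamS F.
Proof.
move=> mF Ffg If Ig; apply/integrable_cons_rV => //.
apply: integrable_productP.
- by apply: measurableT_comp => //; exact: measurable_cons_rV.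
- move=> t; rewrite (_ : (fun y => _) = fun y => f t * g y).
    exact: integrable_funZl.
  by apply/funext => y; rewrite /= Ffg.
- rewrite (_ : (fun x => _) = fun t => (\int[lam]_y `|g y|) * `|f t|).
    by apply: integrable_funZl; exact: integrable_fun_norm.
  apply/funext => t; rewrite mulrC -RintegralZl//; last exact: integrable_fun_norm.
  by apply: eq_Rint => y; rewrite /= Ffg normrM.
Qed.

Lemma Rintegral_tensor F (f : R -> R) (g : 'rV[R]_n -> R) :
  measurable_fun setT F ->
  (forall t y, F (cons_rV (t, y)) = f t * g y) ->
  integrable_fun leb f -> integrable_fun lam g ->
  \int[lamS]_x F x = (\int[leb]_t f t) * \int[lam]_y g y.
Proof.
move=> mF Ffg If Ig; have IF := integrable_tensor mF Ffg If Ig.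
rewrite [LHS]/Rintegral integral_cons_rV//.
rewrite -[LHS]/(\int[(leb \x lam)%E]_z (F \o @cons_rV R n) z).
rewrite -Rintegral_product1; last exact/integrable_cons_rV.
rewrite -RintegralZr//; apply: eq_Rint => t.
by rewrite -RintegralZl//; apply: eq_Rint => y; rewrite /= Ffg.
Qed.

End lebesgue_rV_fubini.

Lemma Rintegral_dominated_cvg d (T : measurableType d) (R : realType)
  (mu : {measure set T -> \bar R}) (f_ : nat -> T -> R) (f g : T -> R) :
  (forall n, measurable_fun setT (f_ n)) -> measurable_fun setT f ->
  (forall x, f_ ^~ x @ \oo --> f x) ->
  integrable_fun mu g -> (forall n x, `|f_ n x| <= g x) ->
  (\int[mu]_x f_ n x) @[n --> \oo] --> \int[mu]_x f x.
Proof.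
move=> mf_ mf f_f Ig f_g.
have f_fE : {ae mu, forall x, [set: T] x -> (f_ n x)%:E @[n --> \oo] --> (f x)%:E}.
  by apply: aeW => x _; apply: cvg_EFin; [exact: nearW|exact: f_f].
have f_gE : {ae mu, forall x n, [set: T] x -> (`|(f_ n x)%:E| <= (g x)%:E)%E}.
  by apply: aeW => x n _; rewrite lee_fin.
have [If _] := dominated_convergence measurableT
  (fun n => proj2 (measurable_EFinP _ _) (mf_ n)) (proj2 (measurable_EFinP _ _) mf)
  f_fE Ig f_gE.
by move=> h; apply: fine_cvg; rewrite EFin_Rintegral.
Qed.

(** * Integrals of derivatives on the real line *)

Section real_line.
Context (R : realType).
Local Notation leb := (@lebesgue_measure R).
Implicit Types (f g : R -> R) (a C t x : R).

Lemma integrable_oneDsqrV : integrable_fun leb (fun t => (1 + t ^+ 2)^-1).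
Proof.
apply: integral_ge0_lty => [|x|].
- by apply: continuous_measurable_fun; exact: continuous_oneDsqrV.
- by rewrite invr_ge0 addr_ge0// sqr_ge0.
- rewrite ge0_symfun_integralT.
  + rewrite (_ : [set x | _] = `[0, +oo[%classic); last first.
      by apply/seteqP; split => x/=; rewrite in_itv/= andbT.
    by rewrite integral0y_oneDsqr// -EFinM ltry.
  + by move=> x; rewrite invr_ge0 addr_ge0// sqr_ge0.
  + exact: continuous_oneDsqrV.
  + by move=> x/=; rewrite sqrrN.
Qed.

(** Fundamental theorem on growing intervals plus dominated convergence: the bound on [g'] is the
    majorant, the same bound on [g] kills the boundary terms. *)
Lemma Rintegral_derive_eq0 g g' C :
  (forall t, is_derive t 1 g (g' t)) -> continuous g' ->
  (forall t, `|g t| <= C / (1 + t ^+ 2)) ->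
  (forall t, `|g' t| <= C / (1 + t ^+ 2)) ->
  \int[leb]_t g' t = 0.
Proof.
move=> dg cg' gC g'C.
(* [n.+1] instead of [n]: the fundamental theorem needs a nondegenerate interval, also for
   [n = 0]. *)
pose I (n : nat) : set R := `[(- (n.+1%:R)), n.+1%:R]%classic.
pose f_ n := g' \_ (I n).
have mg' : measurable_fun setT g' by exact: continuous_measurable_fun.
have mf_ n : measurable_fun setT (f_ n).
  apply/(measurable_restrictT _ _).1; first exact: measurable_itv.
  by apply: measurable_funTS; exact: mg'.
have f_cvg t : f_ ^~ t @ \oo --> g' t.
  apply: cvg_near_cst; exists (Num.bound `|t|) => // n /= tn.
  rewrite /f_ patchE mem_set// /I/= in_itv/= -ler_norml.
  rewrite (le_trans (ltW (archi_boundP _)))// ler_nat.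
  exact: leq_trans tn _.
have ICW : integrable_fun leb (fun t => C / (1 + t ^+ 2)).
  exact: integrable_funZl integrable_oneDsqrV.
have f_g n t : `|f_ n t| <= C / (1 + t ^+ 2).
  rewrite /f_ patchE; case: ifPn => _; first exact: g'C.
  by rewrite normr0 (le_trans _ (gC t)).
have lim1 := @Rintegral_dominated_cvg _ (measurableTypeR R) _ leb _ _ _ mf_ mg' f_cvg ICW f_g.
have cg : continuous g.
  by move=> t; apply/differentiable_continuous/derivable1_diffP.
have E n : \int[leb]_t f_ n t = g n.+1%:R - g (- n.+1%:R).
  rewrite -Rintegral_mkcond /Rintegral (@continuous_FTC2 _ g' g)//.
  - by rewrite ltrNl (lt_trans _ (ltr0Sn _ n))// oppr_lt0.
  - exact: continuous_subspaceT.
  - split=> [x _| |]; first by case: (dg x).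
    + by apply: cvg_at_right_filter; exact: cg.
    + by apply: cvg_at_left_filter; exact: cg.
  - by move=> x _; rewrite derive1E; case: (dg x).



have lim2 : g n.+1%:R - g (- n.+1%:R) @[n --> \oo] --> (0 : R).
  have C0 : 0 <= C.
    by have := le_trans (normr_ge0 _) (gC 0); rewrite expr0n addr0 divr1.
  apply/norm_cvg0P/(@squeeze_cvgr _ _ _ _ (cst 0) (fun n => 2 * C * n.+1%:R^-1)).
  - apply: nearW => n; rewrite normr_ge0/=.
    rewrite (le_trans (ler_normB _ _))//.
    have h x : n.+1%:R <= x ^+ 2 -> `|g x| <= C / n.+1%:R.
      move=> nx; rewrite (le_trans (gC x))// ler_wpM2l// lef_pV2 ?posrE//.
        by rewrite (le_trans nx)// lerDr.
      by rewrite ltr_pwDl// sqr_ge0.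
    rewrite -mulrA mulr_natl mulr2n lerD// h// ?sqrrN.
      by rewrite -natrX ler_nat expnS expn1 leq_pmull.
    by rewrite -natrX ler_nat expnS expn1 leq_pmull.
  - exact: cvg_cst.
  - rewrite -(mulr0 (2 * C)); apply: cvgMr => //.
    exact: cvg_harmonic.
rewrite -(cvg_lim _ lim1)//; apply/cvg_lim => //.
by rewrite (_ : (fun n => _) = (fun n => g n.+1%:R - g (- n.+1%:R)))//; apply/funext.
Qed.

End real_line.

(** * Fourier transforms of one-dimensional Gaussians *)

Section gaussian_transform.
Context (R : realType).
Local Notation leb := (@lebesgue_measure R).
Implicit Types (a t x : R).

Lemma is_derive_comp1 (f g : R -> R) x df dg : is_derive x 1 g dg ->
  is_derive (g x) 1 f df -> is_derive x 1 (fun t => f (g t)) (df * dg).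
Proof.
by move=> Dg Df; have := is_derive1_comp Df Dg.
Qed.

Lemma is_derive_gauss1 a t : is_derive t 1 (fun t => expR (- (a * t ^+ 2)))
  (- (2 * a * t) * expR (- (a * t ^+ 2))).
Proof.
rewrite mulrC; apply: is_derive_comp1.
by apply: is_derive_eq; rewrite /= /GRing.scale/=; ring.
Qed.

(** Half of the exponent pays for each factor [1 + x ^+ 2], by 1 + t <= exp t. The square matters:
    one factor bounds a polynomial in front of the Gaussian, the other survives as the integrable
    majorant 1 / (1 + x^2). *)
Lemma gauss1_bound a x : 0 < a ->
  (1 + x ^+ 2) ^+ 2 * expR (- (a * x ^+ 2)) <= (1 + 2 / a) ^+ 2.
Proof.
move=> a0.
have h : 1 + x ^+ 2 <= (1 + 2 / a) * expR (a * x ^+ 2 / 2).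
  apply: (@le_trans _ _ ((1 + 2 / a) * (1 + a * x ^+ 2 / 2))).
    rewrite mulrDl mul1r -addrA lerD2l mulrDr mulr1.
    rewrite (_ : 2 / a * (a * x ^+ 2 / 2) = x ^+ 2); last by field; rewrite gt_eqF.
    have h1 : 0 <= a * x ^+ 2 / 2 by rewrite divr_ge0// mulr_ge0 ?sqr_ge0 ?ltW.
    have h2 : 0 <= 2 / a by rewrite divr_ge0// ltW.
    by rewrite addrA lerDr addr_ge0.
  by rewrite ler_wpM2l ?expR_ge1Dx// addr_ge0// divr_ge0// ltW.
have -> : expR (- (a * x ^+ 2)) = (expR (a * x ^+ 2 / 2) ^+ 2)^-1.
  by rewrite -expRM_natl -expRN; congr expR; field.
rewrite ler_pdivrMr ?exprn_gt0 ?expR_gt0// -exprMn.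
by rewrite lerXn2r// nnegrE ?addr_ge0 ?sqr_ge0// mulr_ge0 ?expR_ge0 ?addr_ge0 ?divr_ge0 ?ltW.
Qed.

Lemma gauss1_decay a x : 0 < a ->
  (1 + x ^+ 2) * expR (- (a * x ^+ 2)) <= (1 + 2 / a) ^+ 2 / (1 + x ^+ 2).
Proof.
move=> a0; rewrite ler_pdivlMr; last by rewrite ltr_pwDl// sqr_ge0.
by rewrite mulrAC -expr2 gauss1_bound.
Qed.

Lemma gauss1_decay_le a x (h : R) : 0 < a -> `|h| <= 1 + x ^+ 2 ->
  `|h * expR (- (a * x ^+ 2))| <= (1 + 2 / a) ^+ 2 / (1 + x ^+ 2).
Proof.
move=> a0 hx; rewrite normrM [X in _ * X]ger0_norm ?expR_ge0//.
by rewrite (le_trans _ (gauss1_decay x a0))// ler_wpM2r ?expR_ge0.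
Qed.

Lemma continuous_derive1 (g g' : R -> R) :
  (forall t, is_derive t 1 g (g' t)) -> continuous g.
Proof.
by move=> dg t; apply/differentiable_continuous/derivable1_diffP; case: (dg t).
Qed.

Lemma integrable_gauss1_mul a (h : R -> R) : 0 < a -> measurable_fun setT h ->
  (forall x, `|h x| <= 1 + x ^+ 2) ->
  integrable_fun leb (fun x => h x * expR (- (a * x ^+ 2))).
Proof.
move=> a0 mh hb; apply: integrable_fun_dominated; last first.
- exact: (integrable_funZl ((1 + 2 / a) ^+ 2) (@integrable_oneDsqrV R)).
- by move=> x; exact: gauss1_decay_le.
- apply: measurable_funM => //; apply: continuous_measurable_fun.
  exact: continuous_derive1 (is_derive_gauss1 a).
Qed.

Lemma integral_gauss1 a : 0 < a ->
  \int[leb]_x expR (- (a * x ^+ 2)) = Num.sqrt (pi / a).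
Proof.
(* Up to normalisation the integrand is the centred normal density of variance 1 / (2 a). *)
move=> a0; pose s : R := (Num.sqrt (2 * a))^-1.
have s0 : s != 0 by rewrite invr_eq0 gt_eqF// sqrtr_gt0 mulr_gt0.
have s2 : s ^+ 2 = (2 * a)^-1 by rewrite exprVn sqr_sqrtr// mulr_ge0// ltW.
have := @integral_normal_pdf R 0 s.
have If : integrable_fun leb (fun x => expR (- (a * x ^+ 2))).
  have := @integrable_gauss1_mul a (cst 1) a0 (measurable_cst _).
  under eq_fun do rewrite /= mul1r.
  by apply=> x; rewrite normr1 lerDl sqr_ge0.
rewrite (_ : (fun x => (normal_pdf 0 s x)%:E) = fun x => ((normal_peak s)%:E * (expR (- (a * x ^+ 2)))%:E)%E);
  last first.
  apply/funext => x; rewrite normal_pdfE// /normal_fun subr0 EFinM; congr (_ * (expR _)%:E)%E.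
  by rewrite s2; field; rewrite gt_eqF.
rewrite integralZl// -EFin_Rintegral// -EFinM => -[].
rewrite /normal_peak s2 => h.
have -> : pi / a = (2 * a)^-1 * pi *+ 2 by field; rewrite gt_eqF.
apply: (mulfI (x := (Num.sqrt ((2 * a)^-1 * pi *+ 2))^-1)).
  rewrite invr_eq0 gt_eqF// sqrtr_gt0 mulrn_wgt0// mulr_gt0 ?pi_gt0// invr_gt0.
  by rewrite mulr_gt0.
rewrite h mulVf// gt_eqF// sqrtr_gt0 mulrn_wgt0// mulr_gt0 ?pi_gt0// invr_gt0.
by rewrite mulr_gt0.
Qed.

End gaussian_transform.

Section gaussian_fourier.
Context (R : realType).
Local Notation leb := (@lebesgue_measure R).
Variable a : R.
Hypothesis a0 : 0 < a.
Implicit Types (t x xi : R).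
Local Notation E x := (expR (- (a * x ^+ 2))).

Lemma le_norm_onePsqr x : `|x| <= 1 + x ^+ 2.
Proof.
by have := sqr_ge0 (`|x| - 1); rewrite sqrrB1 real_normK ?num_real//; have := normr_ge0 x; lra.
Qed.

(** The difference of the two sides is the integral of the derivative of [h * E]. With [h] among
    cos, sin, x cos and x sin this relates the moments of order 0, 1 and 2; [K] accounts for the
    factor [xi] that differentiating [cos (xi * x)] produces. *)
Lemma integral_gauss1_by_parts (h h' : R -> R) K :
  (forall x, is_derive x 1 h (h' x)) -> continuous h' ->
  (forall x, `|h x| <= 1 + x ^+ 2) -> (forall x, `|x * h x| <= 1 + x ^+ 2) ->
  (forall x, `|h' x| <= K * (1 + x ^+ 2)) ->
  \int[leb]_x (h' x * E x) = 2 * a * \int[leb]_x (x * h x * E x).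
Proof.
move=> dh ch' hb xhb h'b.
have K0 : 0 <= K by have := le_trans (normr_ge0 _) (h'b 0); rewrite expr0n addr0 mulr1.
have ch := continuous_derive1 dh.
have cE : continuous (fun x => E x) := continuous_derive1 (is_derive_gauss1 a).
have mh' : measurable_fun setT h' by exact: continuous_measurable_fun.
have mh : measurable_fun setT h by exact: continuous_measurable_fun.
have I1 : integrable_fun leb (fun x => h' x * E x).
  (* [integrable_gauss1_mul] takes a bound without constant; dividing by K + 1, positive also for K
     = 0, provides it. *)
  rewrite (_ : (fun x => _) = fun x => (K + 1) * ((h' x / (K + 1)) * E x)); last first.
    by apply/funext => x; rewrite mulrA [(K + 1) * _]mulrC divfK// gt_eqF// ltr_wpDl.
  apply: integrable_funZl; apply: integrable_gauss1_mul => //.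
    exact: measurable_funM.
  move=> x; rewrite normrM normfV [X in _ / X]ger0_norm ?addr_ge0//.
  rewrite ler_pdivrMr ?ltr_wpDl// (le_trans (h'b x))// mulrC ler_wpM2l// ?lerDl//.
  by rewrite addr_ge0 ?sqr_ge0.
have I2 : integrable_fun leb (fun x => x * h x * E x).
  apply: integrable_gauss1_mul => //.
  exact: measurable_funM.
rewrite -RintegralZl//; apply/eqP; rewrite -subr_eq0 -RintegralB//; last exact: integrable_funZl.
apply/eqP.
pose B := (1 + 2 / a) ^+ 2.
have B0 : 0 <= B by exact: sqr_ge0.
pose V x := B / (1 + x ^+ 2).
have V0 x : 0 <= V x by rewrite divr_ge0// addr_ge0 ?sqr_ge0.
have KV x : 0 <= K * V x by rewrite mulr_ge0.
have aV x : 0 <= a * V x by rewrite mulr_ge0// ltW.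
have VE x : B * (1 + K + 2 * a) / (1 + x ^+ 2) = V x + K * V x + 2 * (a * V x).
  by rewrite /V; ring.
have hV x : `|h x * E x| <= V x by exact: gauss1_decay_le.
have xhV x : `|x * h x * E x| <= V x by exact: gauss1_decay_le.
have h'V x : `|h' x * E x| <= K * V x.
  rewrite normrM [X in _ * X]ger0_norm ?expR_ge0//.
  rewrite (le_trans (ler_wpM2r (expR_ge0 _) (h'b x)))// -mulrA ler_wpM2l//.
  exact: gauss1_decay.
apply: (@Rintegral_derive_eq0 _ (fun x => h x * E x) _ (B * (1 + K + 2 * a))).
- move=> x; have dE := is_derive_gauss1 a x; have dhx := dh x.
  by apply: is_derive_eq; rewrite /GRing.scale/=; ring.
- move=> x; apply: cvgB; first by apply: cvgM; [exact: ch'|exact: cE].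
  apply: cvgM; first exact: cvg_cst.
  apply: cvgM; last exact: cE.
  by apply: cvgM; [exact: cvg_id|exact: ch].
- move=> x; rewrite VE; have := hV x; have := KV x; have := aV x; lra.
- move=> x; rewrite VE (le_trans (ler_normB _ _))//.
  have : `|2 * a * (x * h x * E x)| <= 2 * (a * V x).
    rewrite normrM ger0_norm; last by rewrite mulr_ge0// ltW.
    by rewrite [leRHS]mulrA ler_wpM2l// mulr_ge0// ltW.
  have := h'V x; have := V0 x; lra.
Qed.

Let cos_x xi x : is_derive x 1 (fun x => cos (xi * x)) (- xi * sin (xi * x)).
Proof.
rewrite mulNr mulrC -mulNr; apply: is_derive_comp1.
by apply: is_derive_eq; rewrite /GRing.scale/=; ring.
Qed.

Let sin_x xi x : is_derive x 1 (fun x => sin (xi * x)) (xi * cos (xi * x)).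
Proof.
rewrite mulrC; apply: is_derive_comp1.
by apply: is_derive_eq; rewrite /GRing.scale/=; ring.
Qed.

Let le1W x : 1 <= 1 + x ^+ 2. Proof. by rewrite lerDl sqr_ge0. Qed.

Let ccos xi : continuous (fun x => cos (xi * x)).
Proof. exact: continuous_derive1 (cos_x xi). Qed.

Let csin xi : continuous (fun x => sin (xi * x)).
Proof. exact: continuous_derive1 (sin_x xi). Qed.

Let cosb t x : `|cos t| <= 1 + x ^+ 2.
Proof. by rewrite (le_trans _ (le1W x))// cos_max. Qed.

Let sinb t x : `|sin t| <= 1 + x ^+ 2.
Proof. by rewrite (le_trans _ (le1W x))// sin_max. Qed.

Let mulb (h : R) x : `|h| <= 1 -> `|x * h| <= 1 + x ^+ 2.
Proof.
by move=> hb; rewrite normrM (le_trans _ (le_norm_onePsqr x))// ler_piMr.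
Qed.

Let mul2b (h : R) x : `|h| <= 1 -> `|x * (x * h)| <= 1 + x ^+ 2.
Proof.
move=> hb; rewrite mulrA normrM -expr2 normrX real_normK ?num_real//.
by rewrite (le_trans (ler_piMr _ hb)) ?sqr_ge0// lerDr.
Qed.

(** Only [k <= 2] will occur, since the products of components of the vortex are quadratic in the
    coordinates; the majorant 1 + x^2 covers these moments. *)
Definition gauss_cos k xi := \int[leb]_x (x ^+ k * cos (xi * x) * E x).
Definition gauss_sin k xi := \int[leb]_x (x ^+ k * sin (xi * x) * E x).

Lemma integrable_gauss_cos k xi : (k <= 2)%N ->
  integrable_fun leb (fun x => x ^+ k * cos (xi * x) * E x).
Proof.
move=> k2; apply: integrable_gauss1_mul => //.
  apply: measurable_funM; first exact: measurable_funX.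
  exact: continuous_measurable_fun.
move=> x; move: k k2 => [|[|[|//]]] _; rewrite ?expr0 ?mul1r ?expr1.
- exact: cosb.
- exact/mulb/cos_max.
- by rewrite expr2 -mulrA; exact/mul2b/cos_max.
Qed.

Lemma integrable_gauss_sin k xi : (k <= 2)%N ->
  integrable_fun leb (fun x => x ^+ k * sin (xi * x) * E x).
Proof.
move=> k2; apply: integrable_gauss1_mul => //.
  apply: measurable_funM; first exact: measurable_funX.
  exact: continuous_measurable_fun.
move=> x; move: k k2 => [|[|[|//]]] _; rewrite ?expr0 ?mul1r ?expr1.
- exact: sinb.
- exact/mulb/sin_max.
- by rewrite expr2 -mulrA; exact/mul2b/sin_max.
Qed.

Lemma gauss_cos1E xi : - xi * gauss_sin 0 xi = 2 * a * gauss_cos 1 xi.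
Proof.
rewrite /gauss_sin -RintegralZl//; last exact: integrable_gauss_sin.
transitivity (\int[leb]_x (- xi * sin (xi * x) * E x)).
  by apply: eq_Rint => x; rewrite expr0 mul1r mulrA.
rewrite (@integral_gauss1_by_parts (fun x => cos (xi * x)) _ `|xi| (cos_x xi)).
- by congr (_ * _); apply: eq_Rint => x; rewrite expr1.
- by move=> x; apply: cvgM; [exact: cvg_cst|exact: csin].
- by move=> x; exact: cosb.
- by move=> x; exact/mulb/cos_max.
- by move=> x; rewrite normrM normrN ler_wpM2l.
Qed.

Lemma gauss_sin1E xi : xi * gauss_cos 0 xi = 2 * a * gauss_sin 1 xi.
Proof.
rewrite /gauss_cos -RintegralZl//; last exact: integrable_gauss_cos.
transitivity (\int[leb]_x (xi * cos (xi * x) * E x)).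
  by apply: eq_Rint => x; rewrite expr0 mul1r mulrA.
rewrite (@integral_gauss1_by_parts (fun x => sin (xi * x)) _ `|xi| (sin_x xi)).
- by congr (_ * _); apply: eq_Rint => x; rewrite expr1.
- by move=> x; apply: cvgM; [exact: cvg_cst|exact: ccos].
- by move=> x; exact: sinb.
- by move=> x; exact/mulb/sin_max.
- by move=> x; rewrite normrM ler_wpM2l.
Qed.

Lemma gauss_cos2E xi :
  gauss_cos 0 xi - xi * gauss_sin 1 xi = 2 * a * gauss_cos 2 xi.
Proof.
rewrite /gauss_cos /gauss_sin -RintegralZl//; last exact: integrable_gauss_sin.
rewrite -RintegralB//; [|exact: integrable_gauss_cos|
  by apply: integrable_funZl; exact: integrable_gauss_sin].
transitivity (\int[leb]_x ((cos (xi * x) - x * (xi * sin (xi * x))) * E x)).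
  by apply: eq_Rint => x; rewrite expr0 expr1; ring.
have dh x : is_derive x 1 (fun x => x * cos (xi * x))
    (cos (xi * x) - x * (xi * sin (xi * x))).
  have dc := cos_x xi x.
  by apply: is_derive_eq; rewrite /GRing.scale/=; ring.
rewrite (integral_gauss1_by_parts (K := 1 + `|xi|) dh).
- by congr (_ * _); apply: eq_Rint => x; rewrite expr2 !mulrA.
- move=> x; apply: cvgB; first exact: ccos.
  by apply: cvgM; [exact: cvg_id|apply: cvgM; [exact: cvg_cst|exact: csin]].
- by move=> x; exact/mulb/cos_max.
- by move=> x; exact/mul2b/cos_max.
- move=> x; rewrite (le_trans (ler_normB _ _))// mulrDl mul1r lerD ?cosb//.
  rewrite mulrCA normrM ler_wpM2l//; exact/mulb/sin_max.
Qed.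

Lemma gauss_sin2E xi :
  gauss_sin 0 xi + xi * gauss_cos 1 xi = 2 * a * gauss_sin 2 xi.
Proof.
rewrite /gauss_cos /gauss_sin -RintegralZl//; last exact: integrable_gauss_cos.
rewrite -RintegralD//; [|exact: integrable_gauss_sin|
  by apply: integrable_funZl; exact: integrable_gauss_cos].
transitivity (\int[leb]_x ((sin (xi * x) + x * (xi * cos (xi * x))) * E x)).
  by apply: eq_Rint => x; rewrite expr0 expr1; ring.
have dh x : is_derive x 1 (fun x => x * sin (xi * x))
    (sin (xi * x) + x * (xi * cos (xi * x))).
  have dc := sin_x xi x.
  by apply: is_derive_eq; rewrite /GRing.scale/=; ring.
rewrite (integral_gauss1_by_parts (K := 1 + `|xi|) dh).
- by congr (_ * _); apply: eq_Rint => x; rewrite expr2 !mulrA.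
- move=> x; apply: cvgD; first exact: csin.
  by apply: cvgM; [exact: cvg_id|apply: cvgM; [exact: cvg_cst|exact: ccos]].
- by move=> x; exact/mulb/sin_max.
- by move=> x; exact/mul2b/sin_max.
- move=> x; rewrite (le_trans (ler_normD _ _))// mulrDl mul1r lerD ?sinb//.
  rewrite mulrCA normrM ler_wpM2l//; exact/mulb/cos_max.
Qed.

(** Dominated differentiation under the integral sign; the majorant does not depend on [xi], so any
    neighbourhood of [xi] serves. *)
Let is_derive_under (f f' : R -> R -> R) xi :
  (forall xi, integrable_fun leb (f xi)) ->
  (forall x xi, is_derive xi 1 (f ^~ x) (f' xi x)) ->
  (forall x xi, `|f' xi x| <= (1 + x ^+ 2) * E x) ->
  is_derive xi 1 (fun xi => \int[leb]_x f xi x) (\int[leb]_x f' xi x).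
Proof.
move=> If df f'b.
have xiI : `](xi - 1), (xi + 1)[%classic xi.
  by rewrite /= in_itv/= ltrBlDr ltrDl ltr01.
have IG : integrable_fun leb (fun x => (1 + x ^+ 2) * E x).
  apply: integrable_gauss1_mul => //.
    by apply: measurable_funD => //; exact: measurable_funX.
  by move=> x; rewrite ger0_norm// addr_ge0 ?sqr_ge0.
have G0 y : 0 <= (1 + y ^+ 2) * E y.
  by rewrite mulr_ge0 ?expR_ge0// addr_ge0 ?sqr_ge0.
have If' x : `](xi - 1), (xi + 1)[%classic x -> integrable_fun leb (f x) by [].
have df' x y : `](xi - 1), (xi + 1)[%classic x -> [set: R] y ->
  derivable (f ^~ y) x 1 by move=> _ _; case: (df y x).
have pE x y : derive1 (f ^~ y) x = f' x y by rewrite derive1E; case: (df y x).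
have ub x y : `](xi - 1), (xi + 1)[%classic x -> [set: R] y ->
  `|derive1 (f ^~ y) x| <= (1 + y ^+ 2) * E y by rewrite pE.
have D := derivable_under_integral measurableT xiI If' df' G0 IG ub.
have D' := differentiation_under_integral measurableT xiI If' df' G0 IG ub.
apply: DeriveDef => //; rewrite -derive1E D'.
by apply: eq_Rint => x; exact: pE.
Qed.

Let cos_xi x xi : is_derive xi 1 (fun xi => cos (xi * x)) (- x * sin (xi * x)).
Proof.
rewrite mulNr mulrC -mulNr; apply: is_derive_comp1.
by apply: is_derive_eq; rewrite /GRing.scale/=; ring.
Qed.

Let sin_xi x xi : is_derive xi 1 (fun xi => sin (xi * x)) (x * cos (xi * x)).
Proof.
rewrite mulrC; apply: is_derive_comp1.
by apply: is_derive_eq; rewrite /GRing.scale/=; ring.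
Qed.

(** Differentiating in [xi] gives minus the first sine moment, which [gauss_sin1E] turns back into
    the cosine transform: a linear equation of first order. *)
Lemma derive_gauss_cos0 xi : is_derive xi 1 (gauss_cos 0) (- (xi / (2 * a)) * gauss_cos 0 xi).
Proof.
have -> : - (xi / (2 * a)) * gauss_cos 0 xi = - gauss_sin 1 xi.
  rewrite mulNr mulrAC gauss_sin1E mulrAC divff ?mul1r//.
  by rewrite gt_eqF// mulr_gt0.
have -> : - gauss_sin 1 xi = \int[leb]_x (- x * sin (xi * x) * E x).
  rewrite -mulN1r -RintegralZl//; last exact: integrable_gauss_sin.
  by apply: eq_Rint => x; rewrite expr1; ring.
apply: (is_derive_under (f := fun xi x => x ^+ 0 * cos (xi * x) * E x)
  (f' := fun xi x => - x * sin (xi * x) * E x)) => [z|x z|x z].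
- exact: integrable_gauss_cos.
- have := cos_xi x z => dc; rewrite expr0.
  by apply: is_derive_eq; rewrite /GRing.scale/=; ring.
- rewrite normrM [X in _ * X]ger0_norm ?expR_ge0// ler_wpM2r ?expR_ge0//.
  by rewrite mulNr normrN; exact/mulb/sin_max.
Qed.

Lemma derive_gauss_sin0 xi : is_derive xi 1 (gauss_sin 0) (- (xi / (2 * a)) * gauss_sin 0 xi).
Proof.
have -> : - (xi / (2 * a)) * gauss_sin 0 xi = gauss_cos 1 xi.
  rewrite -mulNr mulrAC gauss_cos1E mulrAC divff ?mul1r//.
  by rewrite gt_eqF// mulr_gt0.
have -> : gauss_cos 1 xi = \int[leb]_x (x * cos (xi * x) * E x).
  by apply: eq_Rint => x; rewrite expr1.
apply: (is_derive_under (f := fun xi x => x ^+ 0 * sin (xi * x) * E x)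
  (f' := fun xi x => x * cos (xi * x) * E x)) => [z|x z|x z].
- exact: integrable_gauss_sin.
- have := sin_xi x z => dc; rewrite expr0.
  by apply: is_derive_eq; rewrite /GRing.scale/=; ring.
- rewrite normrM [X in _ * X]ger0_norm ?expR_ge0// ler_wpM2r ?expR_ge0//.
  exact/mulb/cos_max.
Qed.

Let ode (F : R -> R) : (forall xi, is_derive xi 1 F (- (xi / (2 * a)) * F xi)) ->
  forall xi, F xi = F 0 * expR (- (xi ^+ 2 / (4 * a))).
Proof.
move=> dF xi.
(* The integrating factor exp (z^2 / (4 a)) is written as a Gaussian with negative parameter, so
   that [is_derive_gauss1] applies. *)
pose G z := F z * expR (- (- (4 * a)^-1 * z ^+ 2)).
have dG (z : R) : is_derive z 1 G 0.
  have h1 := dF z; have h2 := is_derive_gauss1 (- (4 * a)^-1) z.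
  apply: is_derive_eq; rewrite /GRing.scale/=; field.
  by rewrite gt_eqF.
have := @is_derive_0_is_cst R G xi 0 dG; rewrite /G expr0n/= mulr0 oppr0 expR0 mulr1 => <-.
by rewrite -mulrA -expRD (_ : _ + _ = 0) ?expR0 ?mulr1//; ring.
Qed.

Lemma gauss_cos0E xi :
  gauss_cos 0 xi = Num.sqrt (pi / a) * expR (- (xi ^+ 2 / (4 * a))).
Proof.
rewrite (ode derive_gauss_cos0) -integral_gauss1//; congr (_ * _).
by apply: eq_Rint => x; rewrite expr0 mul0r cos0 !mul1r.
Qed.

Lemma gauss_sin0E xi : gauss_sin 0 xi = 0.
Proof.
rewrite (ode derive_gauss_sin0) (_ : gauss_sin 0 0 = 0) ?mul0r//.
rewrite /gauss_sin (eq_Rint _ (g := cst 0)) => [|x]; last by rewrite mul0r sin0 mulr0 mul0r.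
by rewrite Rintegral_cst// mul0r.
Qed.

End gaussian_fourier.

(** * Integration by parts and Schwartz functions *)

Section rV_coordinates.
Context (R : realType).
Implicit Types (n : nat) (t : R).

Lemma cons_rV0 n t (y : 'rV[R]_n) : cons_rV (t, y) 0 ord0 = t.
Proof. by rewrite mxE unlift_none. Qed.

Lemma cons_rVS n t (y : 'rV[R]_n) j : cons_rV (t, y) 0 (lift ord0 j) = y 0 j.
Proof. by rewrite mxE liftK. Qed.

Lemma cons_rV_add0 n (h t : R) (y : 'rV[R]_n) :
  cons_rV (h + t, y) = h *: delta_mx 0 ord0 + cons_rV (t, y).
Proof.
apply/rowP => i; rewrite !mxE; case: unliftP => [j|] -> /=.
  by rewrite mulr0 add0r.
by rewrite mulr1.
Qed.

Lemma cons_rV_addS n (h t : R) (y : 'rV[R]_n) j :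
  cons_rV (t, h *: delta_mx 0 j + y) = h *: delta_mx 0 (lift ord0 j) + cons_rV (t, y).
Proof.
apply/rowP => i; rewrite !mxE; case: unliftP => [k|] -> /=.
  by rewrite !mxE (inj_eq lift_inj).
by rewrite mulr0 add0r.
Qed.

Lemma dotp_cons n (s t : R) (x y : 'rV[R]_n) :
  dotp (cons_rV (s, x)) (cons_rV (t, y)) = s * t + dotp x y.
Proof.
rewrite /dotp big_ord_recl !cons_rV0; congr (_ + _).
by apply: eq_bigr => i _; rewrite !cons_rVS.
Qed.

Lemma uncons_rVK n : cancel (@uncons_rV R n) (@cons_rV R n).
Proof.
by move=> x; apply/rowP => i; rewrite mxE; case: unliftP => [j|] -> //=; rewrite mxE.
Qed.

(* A tensor product, so that its integrability reduces to one variable. *)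
Definition weight n (x : 'rV[R]_n) : R := \prod_(i < n) (1 + x 0 i ^+ 2)^-1.

Lemma weight_cons n t (y : 'rV[R]_n) :
  weight (cons_rV (t, y)) = (1 + t ^+ 2)^-1 * weight y.
Proof.
rewrite /weight big_ord_recl cons_rV0; congr (_ * _).
by apply: eq_bigr => i _; rewrite cons_rVS.
Qed.

Lemma weight_ge0 n (x : 'rV[R]_n) : 0 <= weight x.
Proof. by apply: prodr_ge0 => i _; rewrite invr_ge0 addr_ge0 ?sqr_ge0. Qed.

Lemma measurable_coord n (i : 'I_n) : measurable_fun setT (fun x : 'rV[R]_n => x 0 i).
Proof. exact: (@measurable_rV_coord R n i). Qed.

Lemma measurable_weight n : measurable_fun setT (@weight n).
Proof.
apply: measurable_prod => i _; apply: measurable_funV_real.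
by apply: measurable_funD => //; apply: measurable_funX; exact: measurable_coord.
Qed.

Lemma measurable_dotp n d (T : measurableType d) (f g : T -> 'rV[R]_n) :
  measurable_fun setT f -> measurable_fun setT g ->
  measurable_fun setT (fun x => dotp (f x) (g x)).
Proof.
move=> mf mg; apply: measurable_sum => i; apply: measurable_funM.
  exact: (measurableT_comp (measurable_coord i)).
exact: (measurableT_comp (measurable_coord i)).
Qed.

Lemma integrable_rV0 (f : 'rV[R]_0 -> R) :
  measurable_fun setT f -> integrable_fun (@lebesgue_rV R 0) f.
Proof.
move=> mf; apply/integrableP; split; first exact/measurable_EFinP.
rewrite integral_dirac//; last by do 2 apply: measurableT_comp => //.
by rewrite diracT mul1e ltry.
Qed.

Lemma Rintegral_rV0 (f : 'rV[R]_0 -> R) : measurable_fun setT f ->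
  \int[@lebesgue_rV R 0]_x f x = f 0.
Proof.
move=> mf; rewrite /Rintegral integral_dirac//; last exact/measurable_EFinP.
by rewrite diracT mul1e.
Qed.

Lemma integrable_weight n : integrable_fun (@lebesgue_rV R n) (@weight n).
Proof.
elim: n => [|n IH]; first by apply: integrable_rV0; exact: measurable_weight.
apply: integrable_tensor (@weight_cons n) _ IH; first exact: measurable_weight.
exact: integrable_oneDsqrV.
Qed.

(** Fubini reduces to fewer variables. If [j] is the first coordinate, the integral along it
    vanishes by [Rintegral_derive_eq0]; otherwise the induction hypothesis applies to every slice,
    with constant [C / (1 + t ^+ 2)]. Continuity is asked only along lines of direction [j], a form
    that slices inherit. *)
Lemma Rintegral_partial_eq0 n (j : 'I_n) (F D : 'rV[R]_n -> R) (C : R) :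
  (forall x, is_derive x (delta_mx 0 j) F (D x)) ->
  (forall x, continuous (fun t : R => D (t *: delta_mx 0 j + x))) ->
  measurable_fun setT D ->
  (forall x, `|F x| <= C * weight x) -> (forall x, `|D x| <= C * weight x) ->
  \int[@lebesgue_rV R n]_x D x = 0.
Proof.
elim: n j F D C => [|n IH] j F D C dF cD mD FC DC; first by case: (j) => m; rewrite ltn0.
have ID : integrable_fun (@lebesgue_rV R n.+1) D.
  apply: integrable_fun_dominated DC _ => //.
  exact: integrable_funZl (integrable_weight _).
have IDc := (integrable_cons_rV mD).1 ID.
rewrite /Rintegral integral_cons_rV//.
rewrite -[LHS]/(\int[(lebesgue_measure \x lebesgue_rV)%E]_z (D \o @cons_rV R n) z).
move: dF cD; case: (unliftP ord0 j) => [k|] -> dF cD.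
  rewrite -Rintegral_product1// (eq_Rint _ (g := cst 0)).
    by rewrite Rintegral_cst// mul0r.
  move=> t; apply: (IH k (fun y => F (cons_rV (t, y))) _ (C / (1 + t ^+ 2))).
  - move=> y; have [h1 h2] := dF (cons_rV (t, y)).
    have E : (fun h => h^-1 *: (F (cons_rV (t, h *: delta_mx 0 k + y)) - F (cons_rV (t, y))))
      = (fun h => h^-1 *: (F (h *: delta_mx 0 (lift ord0 k) + cons_rV (t, y)) - F (cons_rV (t, y)))).
      by apply/funext => h; rewrite cons_rV_addS.
    by apply: DeriveDef; rewrite /derivable /derive /= E.
  - move=> y; under eq_fun do rewrite /= cons_rV_addS; exact: cD.
  - apply: (measurableT_comp mD); apply: (measurableT_comp (@measurable_cons_rV R n)).
    exact: measurable_pair1.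
  - by move=> y; rewrite (le_trans (FC _))// weight_cons mulrA.
  - by move=> y; rewrite (le_trans (DC _))// weight_cons mulrA.
rewrite -Rintegral_product2// (eq_Rint _ (g := cst 0)).
  by rewrite Rintegral_cst// mul0r.
move=> y; apply: (@Rintegral_derive_eq0 _ (fun t => F (cons_rV (t, y))) _ (C * weight y)).
- move=> t; have [h1 h2] := dF (cons_rV (t, y)).
  have E : (fun h => h^-1 *: (F (cons_rV (h *: 1 + t, y)) - F (cons_rV (t, y))))
    = (fun h => h^-1 *: (F (h *: delta_mx 0 ord0 + cons_rV (t, y)) - F (cons_rV (t, y)))).
    by apply/funext => h; rewrite -cons_rV_add0 /GRing.scale/= mulr1.
  by apply: DeriveDef; rewrite /derivable /derive /= E.
- have := cD (cons_rV (0, y)).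
  by under eq_fun do rewrite /= -cons_rV_add0 addr0.
- by move=> t; rewrite (le_trans (FC _))// weight_cons mulrCA mulrC.
- by move=> t; rewrite (le_trans (DC _))// weight_cons mulrCA mulrC.
Qed.

End rV_coordinates.

Section directional_derivatives.
Context (R : realType) (n : nat).
Implicit Types (F : 'rV[R]_n -> R) (x v xi : 'rV[R]_n).

Lemma is_derive_lineP F x v d :
  is_derive (0 : R) 1 (fun t => F (t *: v + x)) d <-> is_derive x v F d.
Proof.
have E : (fun h : R => h^-1 *: (F ((h *: 1 + 0) *: v + x) - F (0 *: v + x))) =
         (fun h : R => h^-1 *: (F (h *: v + x) - F x)).
  by apply/funext => h; rewrite scale0r add0r addr0 /GRing.scale/= mulr1.
by split=> -[h1 h2]; apply: DeriveDef; move: h1 h2; rewrite /derivable /derive /= E.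
Qed.

Lemma is_derive_rV_comp F x v d (f : R -> R) df :
  is_derive x v F d -> is_derive (F x) 1 f df ->
  is_derive x v (fun x => f (F x)) (df * d).
Proof.
move=> /is_derive_lineP dF dff; apply/is_derive_lineP.
by apply: is_derive_comp1; rewrite scale0r add0r.
Qed.

Lemma dotpC x y : dotp x y = dotp y x.
Proof. by apply: eq_bigr => i _; rewrite mulrC. Qed.

Lemma dotp_line t v x xi : dotp (t *: v + x) xi = t * dotp v xi + dotp x xi.
Proof.
rewrite /dotp mulr_sumr -big_split; apply: eq_bigr => i _ /=.
by rewrite !mxE; ring.
Qed.

Lemma dotp_delta (j : 'I_n) x : dotp (delta_mx 0 j) x = x 0 j.
Proof.
rewrite /dotp (bigD1 j)//= big1 ?addr0 => [|i ij]; rewrite mxE ?eqxx ?mul1r//.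
by rewrite (negbTE ij) mul0r.
Qed.

Lemma dotp_ge0 x : 0 <= dotp x x.
Proof. by apply: sumr_ge0 => i _; rewrite -expr2 sqr_ge0. Qed.

Lemma sqr_coord_le_dotp x i : x 0 i ^+ 2 <= dotp x x.
Proof.
rewrite /dotp (bigD1 i)//= expr2 lerDl; apply: sumr_ge0 => j _.
by rewrite -expr2 sqr_ge0.
Qed.

Lemma enorm_sqr x : enorm x ^+ 2 = dotp x x.
Proof. by rewrite sqr_sqrtr// dotp_ge0. Qed.

Lemma enorm_ge0 x : 0 <= enorm x. Proof. exact: sqrtr_ge0. Qed.

Lemma is_derive_dotp x v xi : is_derive x v (fun x => dotp x xi) (dotp v xi).
Proof.
apply/is_derive_lineP; under eq_fun do rewrite dotp_line.
by apply: is_derive_eq; rewrite /GRing.scale/=; ring.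
Qed.

Lemma continuous_line x v : continuous (fun t : R => t *: v + x).
Proof.
by move=> t; apply: cvgD; [apply: cvgZr_tmp; exact: cvg_id|exact: cvg_cst].
Qed.

Lemma weightV_le x : (weight x)^-1 <= (1 + enorm x ^+ 2) ^+ n.
Proof.
rewrite enorm_sqr /weight -prodfV -[X in _ ^+ X](card_ord n) -prodr_const.
apply: ler_prod => i _; rewrite invrK addr_ge0 ?sqr_ge0//=.
by rewrite lerD2l sqr_coord_le_dotp.
Qed.

Lemma weight_gt0 x : 0 < weight x.
Proof. by apply: prodr_gt0 => i _; rewrite invr_gt0 ltr_pwDl// sqr_ge0. Qed.

End directional_derivatives.

Section schwartz_functions.
Context (R : realType) (n : nat).
Local Notation lam := (@lebesgue_rV R n).
Implicit Types (phi f g : 'rV[R]_n -> R) (x xi : 'rV[R]_n).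

Lemma schwartz_partial j phi : schwartz phi -> schwartz (partial j phi).
Proof.
move=> [sphi dphi]; split=> [s x|k s].
  by have := sphi (rcons s j) x; rewrite /iter_partial foldr_rcons.
by have := dphi k (rcons s j); rewrite /iter_partial foldr_rcons.
Qed.

Lemma schwartz_differentiable phi x : schwartz phi -> differentiable phi x.
Proof. by move=> [/(_ [::])]. Qed.

Lemma schwartz_continuous phi : schwartz phi -> continuous phi.
Proof. by move=> sphi x; exact/differentiable_continuous/schwartz_differentiable. Qed.

Lemma is_derive_schwartz j phi x : schwartz phi ->
  is_derive x (delta_mx 0 j) phi (partial j phi x).
Proof.
by move=> sphi; apply: derivableP; apply: diff_derivable; exact: schwartz_differentiable.
Qed.

(** The seminorms with weights 1 and |x|^(2n) suffice, because (1 + r^2)^n <= 2^n (1 + r^(2n)) and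
    [weight] is at least (1 + |x|^2)^(-n). *)
Lemma schwartz_decay phi : schwartz phi ->
  exists C, forall x, `|phi x| <= C * weight x.
Proof.
move=> [_ dphi].
have [M0 hM0] := dphi 0 [::]; have [M hM] := dphi (n + n)%N [::].
exists (2 ^+ n * (M0 + M)) => x.
rewrite -ler_pdivrMr ?weight_gt0// mulrC.
rewrite (le_trans (ler_wpM2r _ (weightV_le x)))//.
have h : (1 + enorm x ^+ 2) ^+ n <= 2 ^+ n * (1 + enorm x ^+ (n + n)).
  have [e1|e1] := leP (enorm x) 1.
    apply: (@le_trans _ _ (2 ^+ n)).
      rewrite lerXn2r// ?nnegrE ?addr_ge0 ?sqr_ge0//.
      by rewrite -[leRHS]/(1 + 1) lerD2l exprn_ile1// enorm_ge0.
    by rewrite ler_peMr ?exprn_ge0// lerDl exprn_ge0// enorm_ge0.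
  apply: (@le_trans _ _ ((2 * enorm x ^+ 2) ^+ n)).
    have r1 : 1 <= enorm x ^+ 2 by rewrite exprn_ege1// ltW.
    by rewrite lerXn2r// ?nnegrE ?addr_ge0 ?mulr_ge0 ?sqr_ge0//; lra.
  rewrite exprMn -exprM mul2n -addnn ler_wpM2l ?exprn_ge0// lerDr//.
rewrite (le_trans (ler_wpM2r _ h))// -mulrA ler_wpM2l ?exprn_ge0//.
by rewrite mulrDl mul1r lerD ?hM//; have := hM0 x; rewrite expr0 mul1r.
Qed.

Lemma schwartz_measurable phi : schwartz phi -> measurable_fun setT phi.
Proof. by move=> /schwartz_continuous; exact: continuous_measurable_rV. Qed.

Lemma schwartz_integrable phi : schwartz phi -> integrable_fun lam phi.
Proof.
move=> sphi; have [C hC] := schwartz_decay sphi.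
apply: integrable_fun_dominated hC _; first exact: schwartz_measurable.
exact: integrable_funZl (integrable_weight _ _).
Qed.

End schwartz_functions.

(** * Cosine and sine transforms *)

Section product_integrability.
Context (R : realType).

Lemma integrable_product_mul d1 d2 (T1 : measurableType d1) (T2 : measurableType d2)
  (m1 : {sigma_finite_measure set T1 -> \bar R})
  (m2 : {sigma_finite_measure set T2 -> \bar R}) (f1 : T1 -> R) (f2 : T2 -> R) :
  integrable_fun m1 f1 -> integrable_fun m2 f2 ->
  integrable_fun (m1 \x m2)%E (fun z => f1 z.1 * f2 z.2).
Proof.
move=> I1 I2; have mf1 := integrable_fun_measurable I1.
have mf2 := integrable_fun_measurable I2.
apply: integrable_productP => /=.
- by apply: measurable_funM; [exact: (measurableT_comp mf1)|exact: (measurableT_comp mf2)].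
- by move=> x; exact: integrable_funZl.
- rewrite (_ : (fun _ => _) = fun t => (\int[m2]_y `|f2 y|) * `|f1 t|).
    by apply: integrable_funZl; exact: integrable_fun_norm.
  apply/funext => x; rewrite mulrC -RintegralZl//; last exact: integrable_fun_norm.
  by apply: eq_Rint => y; rewrite normrM.
Qed.

Lemma integrable_fun_Mbounded d (T : measurableType d) (mu : {measure set T -> \bar R})
  (f h : T -> R) : integrable_fun mu f -> measurable_fun setT h ->
  (forall x, `|h x| <= 1) -> integrable_fun mu (fun x => f x * h x).
Proof. by move=> If mh h1; exact: integrable_fun_bounded h1 If. Qed.

End product_integrability.

Section oscillatory_integrals.
Context (R : realType) (n : nat).
Local Notation lam := (@lebesgue_rV R n).
Implicit Types (f g phi : 'rV[R]_n -> R) (x xi : 'rV[R]_n).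

(* [fourier f = osc cos f - i osc sin f] *)
Definition osc (k : R -> R) f xi : R := \int[lam]_x (f x * k (dotp x xi)).

Section kernel.
Variable k : R -> R.
Hypotheses (mk : measurable_fun setT k) (k1 : forall t, `|k t| <= 1).

Let mkd : measurable_fun setT (fun z : 'rV[R]_n * 'rV[R]_n => k (dotp z.1 z.2)).
Proof. by apply: (measurableT_comp mk); exact: measurable_dotp. Qed.

Let mkx xi : measurable_fun setT (fun x : 'rV[R]_n => k (dotp x xi)).
Proof. by apply: (measurableT_comp mk); exact: measurable_dotp. Qed.

Lemma integrable_osc f xi : integrable_fun lam f ->
  integrable_fun lam (fun x => f x * k (dotp x xi)).
Proof. by move=> If; apply: integrable_fun_Mbounded. Qed.

Lemma osc_bounded f xi : integrable_fun lam f -> `|osc k f xi| <= \int[lam]_x `|f x|.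
Proof.
move=> If; rewrite (le_trans (le_normr_Rintegral measurableT (integrable_osc _ If)))//.
apply: le_Rintegral => //.
- by apply: integrable_fun_norm; exact: integrable_osc.
- exact: integrable_fun_norm.
- by move=> x _; rewrite normrM ler_piMr.
Qed.

(** The multiplication formula: the kernel [k (dotp x y)] is bounded and symmetric, so both sides
    are the same double integral. *)
Lemma osc_duality f g : integrable_fun lam f -> integrable_fun lam g ->
  \int[lam]_x (g x * osc k f x) = \int[lam]_y (osc k g y * f y).
Proof.
move=> If Ig.
have := @Rintegral_swap _ _ _ _ R lam lam
  (fun z => g z.1 * f z.2 * k (dotp z.1 z.2))
  (integrable_fun_Mbounded (integrable_product_mul Ig If) mkd (fun=> k1 _)).
rewrite /= => E; transitivity (\int[lam]_x \int[lam]_y (g x * f y * k (dotp x y))).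
  apply: eq_Rint => x; rewrite /osc -RintegralZl//; last exact: integrable_osc.
  by apply: eq_Rint => y; rewrite dotpC mulrA.
rewrite E; apply: eq_Rint => y; rewrite /osc -RintegralZr//; last exact: integrable_osc.
by apply: eq_Rint => x; rewrite mulrAC.
Qed.

(** Measurability in the frequency comes from Fubini, which needs an integrand integrable in both
    variables. Multiplying by the positive [weight] of the frequency achieves this and is undone
    afterwards. [measurable_pot] uses the same device. *)
Lemma measurable_osc f : integrable_fun lam f -> measurable_fun setT (osc k f).
Proof.
move=> If.
have := @measurable_Rintegral1 _ _ _ _ R lam lam
  (fun z => weight z.1 * f z.2 * k (dotp z.1 z.2))
  (integrable_fun_Mbounded (integrable_product_mul (integrable_weight R n) If)
     mkd (fun=> k1 _)).
rewrite (_ : (fun x => _) = fun x => weight x * osc k f x); last first.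
  apply/funext => x; rewrite /osc -RintegralZl//; last exact: integrable_osc.
  by apply: eq_Rint => y; rewrite dotpC mulrA.
move=> mwf; rewrite (_ : osc k f = fun x => (weight x)^-1 * (weight x * osc k f x)).
  by apply: measurable_funM => //; apply: measurable_funV_real; exact: measurable_weight.
by apply/funext => x; rewrite mulKf// gt_eqF// weight_gt0.
Qed.

End kernel.

Local Notation oscc := (osc (@cos R)).
Local Notation oscs := (osc (@sin R)).

Lemma measurable_cos : measurable_fun setT (@cos R).
Proof. by apply: continuous_measurable_fun; exact: continuous_cos. Qed.

Lemma measurable_sin : measurable_fun setT (@sin R).
Proof. by apply: continuous_measurable_fun; exact: continuous_sin. Qed.

(** The derivative of [phi x * k (dotp x xi)] in direction j integrates to 0. A general kernel [k]
    with derivative [k'] treats cosine and sine at once. *)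
Let by_parts (k k' : R -> R) j phi xi : schwartz phi ->
  (forall t : R, is_derive t 1 k (k' t)) -> continuous k' ->
  (forall t, `|k t| <= 1) -> (forall t, `|k' t| <= 1) ->
  osc k (partial j phi) xi = - (xi 0 j * osc k' phi xi).
Proof.
move=> sphi dk ck' k1 k'1.
have sdphi := schwartz_partial j sphi.
have ck := continuous_derive1 dk.
have mk : measurable_fun setT k by exact: continuous_measurable_fun.
have mk' : measurable_fun setT k' by exact: continuous_measurable_fun.
have [C hC] := schwartz_decay sphi; have [C' hC'] := schwartz_decay sdphi.
have I1 := integrable_osc mk k1 xi (schwartz_integrable sdphi).
have I2 := integrable_osc mk' k'1 xi (schwartz_integrable sphi).
have Cw x : 0 <= C * weight x := le_trans (normr_ge0 _) (hC x).
have Cw' x : 0 <= C' * weight x := le_trans (normr_ge0 _) (hC' x).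
have Cx x : 0 <= `|xi 0 j| * C * weight x by rewrite -mulrA mulr_ge0.
apply/eqP; rewrite -addr_eq0 /osc -RintegralZl// -RintegralD//; last exact: integrable_funZl.
apply/eqP; apply: (@Rintegral_partial_eq0 _ _ j (fun x => phi x * k (dotp x xi)) _
  (C + C' + `|xi 0 j| * C)).
- move=> x; have d1 := is_derive_schwartz j x sphi.
  have d2 := is_derive_rV_comp (is_derive_dotp x (delta_mx 0 j) xi) (dk _).
  by apply: is_derive_eq; rewrite dotp_delta /GRing.scale/=; ring.
- move=> x; under eq_fun do rewrite dotp_line.
  have cl : continuous (fun t : R => t * dotp (delta_mx 0 j) xi + dotp x xi).
    by move=> t; apply: cvgD; [apply: cvgM; [exact: cvg_id|exact: cvg_cst]|exact: cvg_cst].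
  move=> t; apply: cvgD.
    apply: cvgM.
      apply: (@continuous_comp _ _ _ (fun t : R => t *: delta_mx 0 j + x)).
        exact: continuous_line.
      exact: schwartz_continuous.
    by apply: (@continuous_comp _ _ _ (fun t : R => t * dotp (delta_mx 0 j) xi + dotp x xi));
      [exact: cl|exact: ck].
  apply: cvgM; first exact: cvg_cst.
  apply: cvgM.
    apply: (@continuous_comp _ _ _ (fun t : R => t *: delta_mx 0 j + x)).
      exact: continuous_line.
    exact: schwartz_continuous.
  by apply: (@continuous_comp _ _ _ (fun t : R => t * dotp (delta_mx 0 j) xi + dotp x xi));
    [exact: cl|exact: ck'].
- apply: measurable_funD; first exact: integrable_fun_measurable I1.
  by apply: measurable_funM => //; exact: integrable_fun_measurable I2.
- move=> x; have : `|phi x * k (dotp x xi)| <= `|phi x| by rewrite normrM ler_piMr.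
  by have := hC x; have := Cw' x; have := Cx x; rewrite !mulrDl; lra.
- move=> x; rewrite (le_trans (ler_normD _ _))//.
  have : `|partial j phi x * k (dotp x xi)| <= `|partial j phi x| by rewrite normrM ler_piMr.
  have : `|xi 0 j * (phi x * k' (dotp x xi))| <= `|xi 0 j| * C * weight x.
    by rewrite 2!normrM -mulrA ler_wpM2l// (le_trans (ler_piMr _ (k'1 _))).
  by have := hC' x; have := Cw x; rewrite !mulrDl; lra.
Qed.

Lemma oscc_partial j phi xi : schwartz phi ->
  oscc (partial j phi) xi = xi 0 j * oscs phi xi.
Proof.
move=> sphi; rewrite (by_parts (k' := fun t => - sin t))//.
- have Is := integrable_osc measurable_sin (@sin_max R) xi (schwartz_integrable sphi).
  rewrite -mulrN; congr (_ * _); rewrite /osc -[LHS]mulN1r -RintegralZl//.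
    by apply: eq_Rint => x; ring.
  by rewrite (_ : EFin \o _ = fun x => ((-1)%:E * (phi x * sin (dotp x xi))%:E)%E);
    [exact: integrableZl|apply/funext => x /=; rewrite -EFinM; congr EFin; ring].
- by move=> t; apply: cvgN; exact: continuous_sin.
- exact: cos_max.
- by move=> t; rewrite normrN sin_max.
Qed.

Lemma oscs_partial j phi xi : schwartz phi ->
  oscs (partial j phi) xi = - (xi 0 j * oscc phi xi).
Proof.
move=> sphi; apply: by_parts => //.
- exact: continuous_cos.
- exact: sin_max.
- exact: cos_max.
Qed.

(** Two derivatives in x_j multiply both transforms by - xi_j^2, so induction along [s] gains one
    factor 1 + xi_j^2 at a time. Taking all coordinates for [s] yields decay like [weight], hence
    integrable transforms. *)
Let osc_schwartz_prod (s : seq 'I_n) phi : schwartz phi -> exists C, forall xi,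
  `|oscc phi xi| * \prod_(j <- s) (1 + xi 0 j ^+ 2) <= C /\
  `|oscs phi xi| * \prod_(j <- s) (1 + xi 0 j ^+ 2) <= C.
Proof.
elim: s phi => [|j s IH] phi sphi.
  exists (\int[lam]_x `|phi x|) => xi; rewrite !big_nil !mulr1.
  by split; apply: osc_bounded (schwartz_integrable sphi);
    [exact: measurable_cos|exact: cos_max|exact: measurable_sin|exact: sin_max].
have sj := schwartz_partial j sphi; have sjj := schwartz_partial j sj.
have [C hC] := IH _ sphi; have [C' hC'] := IH _ sjj.
exists (C + C') => xi; rewrite big_cons; have [a b] := hC xi.
have [a' b'] := hC' xi.
have H (r q : R) : `|q| * r ^+ 2 = `|r * (r * q)|.
  by rewrite !normrM [RHS]mulrA -[in RHS]expr2 real_normK ?num_real// mulrC.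
have Ec : `|oscc phi xi| * (xi 0 j ^+ 2) = `|oscc (partial j (partial j phi)) xi|.
  by rewrite oscc_partial// oscs_partial// mulrN normrN H.
have Es : `|oscs phi xi| * (xi 0 j ^+ 2) = `|oscs (partial j (partial j phi)) xi|.
  by rewrite oscs_partial// oscc_partial// normrN H.
by split; rewrite mulrA mulrDr mulr1 mulrDl ?Ec ?Es lerD.
Qed.

Lemma osc_schwartz_decay phi : schwartz phi -> exists C, forall xi,
  `|oscc phi xi| <= C * weight xi /\ `|oscs phi xi| <= C * weight xi.
Proof.
move=> sphi; have [C hC] := osc_schwartz_prod (index_enum 'I_n) sphi.
exists C => xi; have [hc hs] := hC xi.
have wE : \prod_(j < n) (1 + xi 0 j ^+ 2) = (weight xi)^-1.
  by rewrite /weight prodfV invrK.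
by split; rewrite -ler_pdivrMr ?weight_gt0// -wE.
Qed.

Lemma integrable_oscc phi : schwartz phi -> integrable_fun lam (oscc phi).
Proof.
move=> sphi; have [C hC] := osc_schwartz_decay sphi.
apply: integrable_fun_dominated (fun x => (hC x).1) _.
  by apply: measurable_osc (schwartz_integrable sphi); [exact: measurable_cos|exact: cos_max].
exact: integrable_funZl (integrable_weight _ _).
Qed.

Lemma integrable_oscs phi : schwartz phi -> integrable_fun lam (oscs phi).
Proof.
move=> sphi; have [C hC] := osc_schwartz_decay sphi.
apply: integrable_fun_dominated (fun x => (hC x).2) _.
  by apply: measurable_osc (schwartz_integrable sphi); [exact: measurable_sin|exact: sin_max].
exact: integrable_funZl (integrable_weight _ _).
Qed.

End oscillatory_integrals.

(** * Transforms of Gaussians times monomials *)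

Section gaussians.
Context (R : realType).
Local Notation leb := (@lebesgue_measure R).
Local Notation oscc := (osc (@cos R)).
Local Notation oscs := (osc (@sin R)).
Implicit Types (n k : nat).

Definition gauss n (a : R) (x : 'rV[R]_n) : R := expR (- (a * dotp x x)).

Lemma gauss_ge0 n a (x : 'rV[R]_n) : 0 <= gauss a x. Proof. exact: expR_ge0. Qed.

Lemma gauss_cons n a t (y : 'rV[R]_n) :
  gauss a (cons_rV (t, y)) = expR (- (a * t ^+ 2)) * gauss a y.
Proof. by rewrite /gauss dotp_cons mulrDr opprD expRD expr2. Qed.

Lemma measurable_gauss n a : measurable_fun setT (@gauss n a).
Proof.
apply: measurableT_comp => //; apply: measurableT_comp => //.
by apply: measurable_funM => //; exact: measurable_dotp.
Qed.

(** Addition formulas for the phase [s * t + dotp y eta]. They mix the cosine and sine transforms of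
    the factors, so the two are carried together through the induction on the dimension. *)
Lemma osc_tensor n (f : R -> R) (F : 'rV[R]_n.+1 -> R) (g : 'rV[R]_n -> R) s eta :
  measurable_fun setT F -> (forall t y, F (cons_rV (t, y)) = f t * g y) ->
  integrable_fun leb f -> integrable_fun lebesgue_rV g ->
  oscc F (cons_rV (s, eta)) = (\int[leb]_t (f t * cos (s * t))) * oscc g eta
    - (\int[leb]_t (f t * sin (s * t))) * oscs g eta /\
  oscs F (cons_rV (s, eta)) = (\int[leb]_t (f t * sin (s * t))) * oscc g eta
    + (\int[leb]_t (f t * cos (s * t))) * oscs g eta.
Proof.
move=> mF FE If Ig.
have mc := @measurable_cos R; have ms := @measurable_sin R.
have mst : measurable_fun setT (fun t : R => s * t) by exact: measurable_funM.
have Ifc : integrable_fun leb (fun t => f t * cos (s * t)).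
  by apply: integrable_fun_Mbounded => // [|t]; [exact: (measurableT_comp mc)|exact: cos_max].
have Ifs : integrable_fun leb (fun t => f t * sin (s * t)).
  by apply: integrable_fun_Mbounded => // [|t]; [exact: (measurableT_comp ms)|exact: sin_max].
have Igc := integrable_osc mc (@cos_max R) eta Ig.
have Igs := integrable_osc ms (@sin_max R) eta Ig.
pose P (u : R -> R) (v : 'rV[R]_n -> R) (x : 'rV[R]_n.+1) :=
  u (uncons_rV x).1 * v (uncons_rV x).2.
have mP u v : integrable_fun leb u -> integrable_fun lebesgue_rV v ->
    measurable_fun setT (P u v).
  move=> /integrable_fun_measurable mu /integrable_fun_measurable mv.
  have mun := @measurable_uncons_rV R n.
  apply: measurable_funM.
    by apply: (measurableT_comp mu); apply: (measurableT_comp _ mun).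
  by apply: (measurableT_comp mv); apply: (measurableT_comp _ mun).
have PE u v t y : P u v (cons_rV (t, y)) = u t * v y by rewrite /P cons_rVK.
have IP u v (Iu : integrable_fun leb u) (Iv : integrable_fun lebesgue_rV v) :=
  integrable_tensor (mP _ _ Iu Iv) (PE u v) Iu Iv.
have JP u v (Iu : integrable_fun leb u) (Iv : integrable_fun lebesgue_rV v) :=
  Rintegral_tensor (mP _ _ Iu Iv) (PE u v) Iu Iv.
rewrite -!JP// -RintegralB//; [|exact: IP..]; rewrite -RintegralD//; [|exact: IP..].
split; apply: eq_Rint => x; rewrite -[x]uncons_rVK; case: (uncons_rV x) => t y;
  rewrite !PE FE dotp_cons [t * s]mulrC ?cosD ?sinD; ring.
Qed.

Lemma integrable_pow_gauss1 k a : 0 < a -> (k <= 2)%N ->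
  integrable_fun leb (fun t => t ^+ k * expR (- (a * t ^+ 2))).
Proof.
move=> a0 k2; have := integrable_gauss_cos a0 0 k2.
by under eq_fun do rewrite mul0r cos0 mulr1.
Qed.

Lemma integrable_gauss n a : 0 < a -> integrable_fun lebesgue_rV (@gauss n a).
Proof.
move=> a0; elim: n => [|n IH]; first by apply: integrable_rV0; exact: measurable_gauss.
apply: integrable_tensor (@gauss_cons n a) _ IH; first exact: measurable_gauss.
by have := integrable_pow_gauss1 a0 (leq0n 2); under eq_fun do rewrite expr0 mul1r.
Qed.

(* The cosine and sine transforms of [t ^+ k * expR (- (a * t ^+ 2))], divided
   by the transform of [expR (- (a * t ^+ 2))]. *)
Definition hermc (a s : R) k : R :=
  match k with 0 => 1 | 1 => 0 | _ => (1 - s ^+ 2 / (2 * a)) / (2 * a) end.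
Definition herms (a s : R) k : R :=
  match k with 1 => s / (2 * a) | _ => 0 end.

Lemma gauss_cosE a s k : 0 < a -> (k <= 2)%N ->
  gauss_cos a k s = hermc a s k * (Num.sqrt (pi / a) * expR (- (s ^+ 2 / (4 * a)))).
Proof.
move=> a0; have a2 : 2 * a != 0 by rewrite gt_eqF// mulr_gt0.
have c1 : gauss_cos a 1 s = 0.
  apply: (mulfI a2); rewrite -gauss_cos1E// gauss_sin0E// mulr0.
  by rewrite mulr0.
case: k => [|[|[|//]]] _ /=.
- by rewrite gauss_cos0E// mul1r.
- by rewrite c1 mul0r.
- apply: (mulfI a2); rewrite -gauss_cos2E//.
  have -> : gauss_sin a 1 s = s / (2 * a) * gauss_cos a 0 s.
    by apply: (mulfI a2); rewrite -gauss_sin1E// mulrA [_ * (s / _)]mulrCA divff// mulr1.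
  by rewrite gauss_cos0E//; field; rewrite gt_eqF.
Qed.

Lemma gauss_sinE a s k : 0 < a -> (k <= 2)%N ->
  gauss_sin a k s = herms a s k * (Num.sqrt (pi / a) * expR (- (s ^+ 2 / (4 * a)))).
Proof.
move=> a0; have a2 : 2 * a != 0 by rewrite gt_eqF// mulr_gt0.
case: k => [|[|[|//]]] _ /=.
- by rewrite gauss_sin0E// mul0r.
- apply: (mulfI a2); rewrite -gauss_sin1E// gauss_cos0E//; field.
  by rewrite gt_eqF.
- apply: (mulfI a2); rewrite -gauss_sin2E// gauss_cosE//= gauss_sin0E//.
  by ring.
Qed.

Lemma osc_pow_tensor n k a (F : 'rV[R]_n.+1 -> R) (g : 'rV[R]_n -> R) s eta :
  0 < a -> (k <= 2)%N ->
  measurable_fun setT F ->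
  (forall t y, F (cons_rV (t, y)) = (t ^+ k * expR (- (a * t ^+ 2))) * g y) ->
  integrable_fun lebesgue_rV g ->
  oscc F (cons_rV (s, eta)) = (Num.sqrt (pi / a) * expR (- (s ^+ 2 / (4 * a)))) *
     (hermc a s k * oscc g eta - herms a s k * oscs g eta) /\
  oscs F (cons_rV (s, eta)) = (Num.sqrt (pi / a) * expR (- (s ^+ 2 / (4 * a)))) *
     (herms a s k * oscc g eta + hermc a s k * oscs g eta).
Proof.
move=> a0 k2 mF FE Ig.
have [-> ->] := osc_tensor s eta mF FE (integrable_pow_gauss1 a0 k2) Ig.
have -> : \int[leb]_t (t ^+ k * expR (- (a * t ^+ 2)) * cos (s * t)) = gauss_cos a k s.
  by apply: eq_Rint => t; rewrite mulrAC.
have -> : \int[leb]_t (t ^+ k * expR (- (a * t ^+ 2)) * sin (s * t)) = gauss_sin a k s.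
  by apply: eq_Rint => t; rewrite mulrAC.
by rewrite gauss_cosE// gauss_sinE//; split; ring.
Qed.

Definition gauss_ft n a (xi : 'rV[R]_n) : R :=
  Num.sqrt (pi / a) ^+ n * expR (- (dotp xi xi / (4 * a))).

Lemma gauss_ft_cons n a s (eta : 'rV[R]_n) : gauss_ft a (cons_rV (s, eta)) =
  (Num.sqrt (pi / a) * expR (- (s ^+ 2 / (4 * a)))) * gauss_ft a eta.
Proof. by rewrite /gauss_ft dotp_cons [(_ + dotp _ _) / _]mulrDl opprD expRD exprS expr2; ring. Qed.

Lemma osc_gauss n a (xi : 'rV[R]_n) : 0 < a ->
  oscc (@gauss n a) xi = gauss_ft a xi /\ oscs (@gauss n a) xi = 0.
Proof.
move=> a0; elim: n xi => [|n IH] xi.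
  have d0 (x y : 'rV[R]_0) : dotp x y = 0 by rewrite /dotp big_ord0.
  rewrite /osc !Rintegral_rV0.
  - by rewrite /gauss /gauss_ft !d0 mulr0 mul0r cos0 sin0 mulr0 oppr0 expR0 expr0.
  - apply: measurable_funM; first exact: measurable_gauss.
    by apply: (measurableT_comp (@measurable_sin R)); exact: measurable_dotp.
  - apply: measurable_funM; first exact: measurable_gauss.
    by apply: (measurableT_comp (@measurable_cos R)); exact: measurable_dotp.
rewrite -[xi]uncons_rVK; case: (uncons_rV xi) => s eta.
have [-> ->] := @osc_pow_tensor n 0 a (@gauss n.+1 a) _ s eta a0 isT
  (measurable_gauss a) (fun t y => etrans (gauss_cons a t y) (esym (congr1 ( *%R^~ _) (mul1r _))))
  (integrable_gauss _ a0).
by have [-> ->] := IH eta; rewrite /= gauss_ft_cons; split; ring.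
Qed.

End gaussians.

Section planar_gaussians.
Context (R : realType) (m : nat).
Local Notation n := m.+2.
Local Notation oscc := (osc (@cos R)).
Local Notation oscs := (osc (@sin R)).
Local Notation "'i0" := (ord0 : 'I_n).
Local Notation "'i1" := (lift ord0 ord0 : 'I_n).
Implicit Types (x xi : 'rV[R]_n).

Definition pgauss (a : R) (k0 k1 : nat) x : R :=
  x 0 'i0 ^+ k0 * x 0 'i1 ^+ k1 * gauss a x.

Lemma measurable_pgauss a k0 k1 : measurable_fun setT (pgauss a k0 k1).
Proof.
apply: measurable_funM; last exact: measurable_gauss.
by apply: measurable_funM; apply: measurable_funX; exact: measurable_coord.
Qed.

Let pgauss1 (a : R) k (x : 'rV[R]_m.+1) : R := x 0 ord0 ^+ k * gauss a x.

Let mpgauss1 a k : measurable_fun setT (pgauss1 a k).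
Proof.
apply: measurable_funM; last exact: measurable_gauss.
by apply: measurable_funX; exact: measurable_coord.
Qed.

Let pgauss1_cons a k t (y : 'rV[R]_m) : pgauss1 a k (cons_rV (t, y)) =
  t ^+ k * expR (- (a * t ^+ 2)) * gauss a y.
Proof. by rewrite /pgauss1 gauss_cons cons_rV0 mulrA. Qed.

Let pgauss_cons a k0 k1 t y : pgauss a k0 k1 (cons_rV (t, y)) =
  t ^+ k0 * expR (- (a * t ^+ 2)) * pgauss1 a k1 y.
Proof. by rewrite /pgauss /pgauss1 gauss_cons cons_rV0 cons_rVS; ring. Qed.

Let Ipgauss1 a k : 0 < a -> (k <= 2)%N -> integrable_fun lebesgue_rV (pgauss1 a k).
Proof.
move=> a0 k2; apply: integrable_tensor (pgauss1_cons a k) _ _ => //.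
- exact: integrable_pow_gauss1.
- exact: integrable_gauss.
Qed.

Lemma integrable_pgauss a k0 k1 : 0 < a -> (k0 <= 2)%N -> (k1 <= 2)%N ->
  integrable_fun lebesgue_rV (pgauss a k0 k1).
Proof.
move=> a0 k02 k12; apply: integrable_tensor (pgauss_cons a k0 k1) _ _ => //.
- exact: measurable_pgauss.
- exact: integrable_pow_gauss1.
- exact: Ipgauss1.
Qed.

Lemma osc_pgauss a k0 k1 xi : 0 < a -> (k0 <= 2)%N -> (k1 <= 2)%N ->
  oscc (pgauss a k0 k1) xi =
    (hermc a (xi 0 'i0) k0 * hermc a (xi 0 'i1) k1 -
     herms a (xi 0 'i0) k0 * herms a (xi 0 'i1) k1) * gauss_ft a xi /\
  oscs (pgauss a k0 k1) xi =
    (herms a (xi 0 'i0) k0 * hermc a (xi 0 'i1) k1 +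
     hermc a (xi 0 'i0) k0 * herms a (xi 0 'i1) k1) * gauss_ft a xi.
Proof.
move=> a0 k02 k12.
rewrite -[xi]uncons_rVK; case: (uncons_rV xi) => s eta.
rewrite -[eta]uncons_rVK; case: (uncons_rV eta) => t zeta.
have [-> ->] := osc_pow_tensor s (cons_rV (t, zeta)) a0 k02 (measurable_pgauss a k0 k1)
  (pgauss_cons a k0 k1) (Ipgauss1 a0 k12).
have [-> ->] := osc_pow_tensor t zeta a0 k12 (mpgauss1 a k1)
  (pgauss1_cons a k1) (integrable_gauss _ a0).
have [-> ->] := osc_gauss zeta a0.
by rewrite cons_rVS !cons_rV0 !gauss_ft_cons; split; ring.
Qed.

End planar_gaussians.

Section superposition.
Context (R : realType) (n : nat) d (T : measurableType d).
Variable mu : {sigma_finite_measure set T -> \bar R}.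
Local Notation lam := (@lebesgue_rV R n).
Implicit Types (phi : 'rV[R]_n -> R) (x xi : 'rV[R]_n).

(** Fubini is applied on both sides of the multiplication formula, with different dominations. In x
    the majorant [b] is uniform and [osc k phi] is integrable. In xi the intended [gh] has no
    uniform integrable majorant (for fixed v, the supremum over xi of [hatom true false] decays only
    like 1 / y); what is uniform is its integral over the parameter, and [phi] supplies
    integrability in xi. *)
Lemma osc_superposition (k : R -> R) (g gh : T -> 'rV[R]_n -> R) (b : T -> R) (C : R) phi :
  measurable_fun setT k -> (forall t, `|k t| <= 1) ->
  measurable_fun setT (fun z : 'rV[R]_n * T => g z.2 z.1) ->
  integrable_fun mu b -> (forall q x, `|g q x| <= b q) ->
  (forall q, integrable_fun lam (g q)) ->
  (forall q xi, osc k (g q) xi = gh q xi) ->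
  measurable_fun setT (fun z : 'rV[R]_n * T => gh z.2 z.1) ->
  (forall xi, integrable_fun mu (gh ^~ xi)) ->
  (forall xi, \int[mu]_q `|gh q xi| <= C) ->
  integrable_fun lam phi -> integrable_fun lam (osc k phi) ->
  integrable_fun lam (fun xi => (\int[mu]_q gh q xi) * phi xi) /\
  \int[lam]_x ((\int[mu]_q g q x) * osc k phi x) =
  \int[lam]_xi ((\int[mu]_q gh q xi) * phi xi).
Proof.
move=> mk k1 mg Ib gb Ig gE mgh Igh ghC Iphi Ioscphi.
have mphi := integrable_fun_measurable Iphi.
have mosc := integrable_fun_measurable Ioscphi.
have mgq x : measurable_fun setT (g ^~ x).
  exact: (measurableT_comp mg (@measurable_pair1 _ _ _ T x)).
have Igx x : integrable_fun mu (g ^~ x).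
  exact: integrable_fun_dominated (mgq x) (fun q => gb q x) Ib.
have b0 q : 0 <= b q := le_trans (normr_ge0 _) (gb q 0).
have I1 : integrable_fun (lam \x mu)%E (fun z => g z.2 z.1 * osc k phi z.1).
  apply: integrable_fun_dominated; last first.
  - exact: (integrable_product_mul (integrable_fun_norm Ioscphi) Ib).
  - by move=> z; rewrite normrM mulrC ler_wpM2l.
  - by apply: measurable_funM => //; exact: (measurableT_comp mosc).
have I2 : integrable_fun (lam \x mu)%E (fun z => gh z.2 z.1 * phi z.1).
  apply: integrable_productP => /=.
  - by apply: measurable_funM => //; exact: (measurableT_comp mphi).
  - move=> xi; have := integrable_funZl (phi xi) (Igh xi).
    by under eq_fun do rewrite mulrC.
  - apply: integrable_fun_dominated; last first.
    + exact: (integrable_funZl C (integrable_fun_norm Iphi)).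
    + move=> xi; rewrite ger0_norm ?Rintegral_ge0//.
      rewrite (eq_Rint _ (g := fun q => `|phi xi| * `|gh q xi|)) => [|q]; last first.
        by rewrite normrM mulrC.
      by rewrite RintegralZl//; [rewrite mulrC ler_wpM2r|exact: integrable_fun_norm].
    + apply: (measurableT_comp (@fine_measurable R setT measurableT)).
      apply: (measurable_fun_fubini_tonelli_F
        (fun z : 'rV[R]_n * T => (`|gh z.2 z.1 * phi z.1|)%:E)) => //.
      apply/measurable_EFinP; apply: measurableT_comp => //.
      by apply: measurable_funM => //; exact: (measurableT_comp mphi).
have E xi : \int[mu]_q (gh q xi * phi xi) = (\int[mu]_q gh q xi) * phi xi.
  by rewrite RintegralZr.
split; first by have := integrable_Rintegral1 I2; rewrite /= (funext E).
transitivity (\int[lam]_x \int[mu]_q (g q x * osc k phi x)).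
  by apply: eq_Rint => x; rewrite RintegralZr.
rewrite (Rintegral_swap I1).
transitivity (\int[mu]_q \int[lam]_xi (gh q xi * phi xi)).
  apply: eq_Rint => q; rewrite /= osc_duality//.
  by apply: eq_Rint => xi; rewrite gE.
by rewrite -(Rintegral_swap I2); apply: eq_Rint => xi; exact: E.
Qed.

End superposition.

Section square_bound.
Context d (T : measurableType d) (R : realType) (mu : {measure set T -> \bar R}).

Lemma sqr_Rintegral_le (rho h : T -> R) (c : R) :
  (forall t, 0 <= rho t) -> integrable_fun mu rho -> 0 < c -> \int[mu]_t rho t <= c ->
  integrable_fun mu (fun t => rho t * h t) ->
  integrable_fun mu (fun t => rho t * h t ^+ 2) ->
  (\int[mu]_t (rho t * h t)) ^+ 2 <= c * \int[mu]_t (rho t * h t ^+ 2).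
Proof.
move=> rho0 Irho c0 Ic I1 I2; set Q := \int[mu]_t (rho t * h t).
set H := \int[mu]_t (rho t * h t ^+ 2).
(* Integrate [2 h Q <= c h^2 + Q^2 / c] against [rho]. *)
have : 2 * Q * Q <= c * H + Q ^+ 2 / c * \int[mu]_t rho t.
  rewrite -[2 * Q * Q](@RintegralZl _ _ _ mu setT _ (2 * Q) measurableT I1).
  rewrite -[c * H](@RintegralZl _ _ _ mu setT _ c measurableT I2).
  rewrite -[_ / c * _](@RintegralZl _ _ _ mu setT _ (Q ^+ 2 / c) measurableT Irho).
  rewrite -RintegralD//; [|exact: integrable_funZl..].
  apply: le_Rintegral => //; [exact: integrable_funZl| |].
    by apply: integrable_funD; exact: integrable_funZl.
  move=> t _; have -> : c * (rho t * h t ^+ 2) + Q ^+ 2 / c * rho t =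
      rho t * (c * h t ^+ 2 + Q ^+ 2 / c) by ring.
  rewrite mulrCA ler_wpM2l//.
  have : c * h t ^+ 2 + Q ^+ 2 / c - 2 * Q * h t = (c * h t - Q) ^+ 2 / c.
    by field; rewrite gt_eqF.
  have : 0 <= (c * h t - Q) ^+ 2 / c by rewrite divr_ge0 ?sqr_ge0// ltW.
  by move=> h0 hE; rewrite -subr_ge0 hE.
have : Q ^+ 2 / c * \int[mu]_t rho t <= Q ^+ 2.
  by rewrite -[leRHS](divfK (lt0r_neq0 c0)) ler_wpM2l// divr_ge0 ?sqr_ge0// ltW.
rewrite expr2; lra.
Qed.

Lemma Lfun2P (f : T -> R) : measurable_fun setT f ->
  integrable_fun mu (fun x => f x ^+ 2) -> f \in Lfun mu 2%:E.
Proof.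
move=> mf /integrableP[_ foo]; rewrite inE; apply/andP; split; first by rewrite inE.
rewrite inE/= /finite_norm unlock /=.
rewrite poweR_lty//; apply: le_lt_trans foo; rewrite le_eqVlt; apply/orP; left.
apply/eqP; apply: eq_integral => x _ /=.
by rewrite powR_mulrn// normrX.
Qed.

End square_bound.

(** * Gaussian superpositions *)

Section atoms.
Context (R : realType) (m : nat).
Local Notation n := m.+2.
Local Notation leb := (@lebesgue_measure R).
Local Notation lam := (@lebesgue_rV R n).
Local Notation oscc := (osc (@cos R)).
Local Notation oscs := (osc (@sin R)).
Local Notation "'i0" := (ord0 : 'I_n).
Local Notation "'i1" := (lift ord0 ord0 : 'I_n).
Implicit Types (x xi : 'rV[R]_n) (a t v y s : R) (b : bool) (q : measurableTypeR R * measurableTypeR R).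

(* The Fourier transform of [dd true a t * expR (- (a * t ^+ 2))] is
   [hd true a xi] times that of [expR (- (a * t ^+ 2))]. *)
Definition dd b a t : R := if b then 2 * a * t ^+ 2 - 1 else 1.
Definition hd b a t : R := if b then - (t ^+ 2 / (2 * a)) else 1.

(** As the second derivative of exp (- a t^2) is 2 a (2 a t^2 - 1) exp (- a t^2), this is, up to
    powers of 2 a, the Gaussian differentiated twice in each flagged coordinate. *)
Definition base b0 b1 a x : R := dd b0 a (x 0 'i0) * dd b1 a (x 0 'i1) * gauss a x.

Let baseE b0 b1 a x : base b0 b1 a x =
  (if b0 then 2 * a else 0) * (if b1 then 2 * a else 0) * pgauss a 2 2 x +
  (if b0 then 2 * a else 0) * (if b1 then -1 else 1) * pgauss a 2 0 x +
  (if b0 then -1 else 1) * (if b1 then 2 * a else 0) * pgauss a 0 2 x +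
  (if b0 then -1 else 1) * (if b1 then -1 else 1) * pgauss a 0 0 x.
Proof. by rewrite /base /pgauss /dd; case: b0; case: b1; ring. Qed.

Lemma osc_linear (k : R -> R) (f g : 'rV[R]_n -> R) (c d : R) xi :
  measurable_fun setT k -> (forall t, `|k t| <= 1) ->
  integrable_fun lam f -> integrable_fun lam g ->
  osc k (fun x => c * f x + d * g x) xi = c * osc k f xi + d * osc k g xi.
Proof.
move=> mk k1 If Ig; have kf := integrable_osc mk k1 xi If; have kg := integrable_osc mk k1 xi Ig.
rewrite /osc -!RintegralZl// -RintegralD//; [|exact: integrable_funZl..].
by apply: eq_Rint => x; ring.
Qed.

Lemma integrable_base b0 b1 a : 0 < a -> integrable_fun lam (base b0 b1 a).
Proof.
move=> a0; have Ip k0 k1 := @integrable_pgauss R m a k0 k1 a0.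
have -> := funext (baseE b0 b1 a).
have Z c k0 k1 (h0 : (k0 <= 2)%N) (h1 : (k1 <= 2)%N) := integrable_funZl c (Ip k0 k1 h0 h1).
exact: (integrable_funD (integrable_funD (integrable_funD (Z _ _ _ _ _) (Z _ _ _ _ _)) (Z _ _ _ _ _)) (Z _ _ _ _ _)).
Qed.

Lemma osc_base b0 b1 a xi : 0 < a ->
  oscc (base b0 b1 a) xi = hd b0 a (xi 0 'i0) * hd b1 a (xi 0 'i1) * gauss_ft a xi /\
  oscs (base b0 b1 a) xi = 0.
Proof.
move=> a0; have Ip k0 k1 := @integrable_pgauss R m a k0 k1 a0.
have osc_baseE (k : R -> R) : measurable_fun setT k -> (forall t, `|k t| <= 1) ->
    osc k (base b0 b1 a) xi =
  (if b0 then 2 * a else 0) * (if b1 then 2 * a else 0) * osc k (pgauss a 2 2) xi +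
  (if b0 then 2 * a else 0) * (if b1 then -1 else 1) * osc k (pgauss a 2 0) xi +
  (if b0 then -1 else 1) * (if b1 then 2 * a else 0) * osc k (pgauss a 0 2) xi +
  (if b0 then -1 else 1) * (if b1 then -1 else 1) * osc k (pgauss a 0 0) xi.
  move=> mk k1.
  have Z c k0 l0 (h0 : (k0 <= 2)%N) (h1 : (l0 <= 2)%N) := integrable_funZl c (Ip k0 l0 h0 h1).
  have -> : base b0 b1 a = (fun x =>
    1 * ((fun x => 1 * ((fun x => (if b0 then 2 * a else 0) * (if b1 then 2 * a else 0) * pgauss a 2 2 x +
      (if b0 then 2 * a else 0) * (if b1 then -1 else 1) * pgauss a 2 0 x) x)
    + (if b0 then -1 else 1) * (if b1 then 2 * a else 0) * pgauss a 0 2 x) x)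
    + (if b0 then -1 else 1) * (if b1 then -1 else 1) * pgauss a 0 0 x).
    by apply/funext => x; rewrite baseE !mul1r.
  have I1 := integrable_funD (Z ((if b0 then 2 * a else 0) * (if b1 then 2 * a else 0)) 2 2 erefl erefl)
    (Z ((if b0 then 2 * a else 0) * (if b1 then -1 else 1)) 2 0 erefl erefl).
  have I2 := integrable_funD (integrable_funZl 1 I1)
    (Z ((if b0 then -1 else 1) * (if b1 then 2 * a else 0)) 0 2 erefl erefl).
  by rewrite !osc_linear ?mul1r//; exact: Ip.
rewrite (osc_baseE _ (@measurable_cos R) (@cos_max R)).
rewrite (osc_baseE _ (@measurable_sin R) (@sin_max R)).
have E i j (hi : (i <= 2)%N) (hj : (j <= 2)%N) := osc_pgauss xi a0 hi hj.
rewrite !(E _ _ _ _).1// !(E _ _ _ _).2//=.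
clear osc_baseE; by split; rewrite /hd; case: b0; case: b1; field; rewrite ?gt_eqF.
Qed.

Lemma measurable_dd b d (T : measurableType d) (f g : T -> R) :
  measurable_fun setT f -> measurable_fun setT g ->
  measurable_fun setT (fun z => dd b (f z) (g z)).
Proof.
move=> mf mg; case: b => //=; apply: measurable_funB => //.
by apply: measurable_funM; [exact: measurable_funM|exact: measurable_funX].
Qed.

Lemma measurable_hd b d (T : measurableType d) (f g : T -> R) :
  measurable_fun setT f -> measurable_fun setT g ->
  measurable_fun setT (fun z => hd b (f z) (g z)).
Proof.
move=> mf mg; case: b => //=; apply: measurableT_comp => //.
apply: measurable_funM; first exact: measurable_funX.
by apply: measurable_funV_real; exact: measurable_funM.
Qed.

(** With T = a |x|^2 each Hermite factor is at most 8 (1 + T / 4) <= 8 exp (T / 4). The two of them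
    consume half of the exponent. *)
Lemma base_bound b0 b1 a x : 0 <= a ->
  `|base b0 b1 a x| <= 64 * expR (- (a * dotp x x / 2)).
Proof.
move=> a0; pose T := a * dotp x x.
have T0 : 0 <= T by rewrite mulr_ge0 ?dotp_ge0.
have h b i : `|dd b a (x 0 i)| <= 8 * expR (T / 4).
  have e4 := expR_ge1Dx (T / 4).
  have t0 : 0 <= a * x 0 i ^+ 2 by rewrite mulr_ge0 ?sqr_ge0.
  have t1 : a * x 0 i ^+ 2 <= T by rewrite ler_wpM2l ?sqr_coord_le_dotp.
  case: b; rewrite /dd ?normr1; last lra.
  by rewrite ler_norml; apply/andP; split; lra.
rewrite /base !normrM [X in _ * X]ger0_norm ?gauss_ge0//.
apply: (@le_trans _ _ ((8 * expR (T / 4)) * (8 * expR (T / 4)) * gauss a x)).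
  by rewrite ler_wpM2r ?gauss_ge0// ler_pM.
rewrite (_ : _ * _ * gauss a x = 64 * (expR (T / 4) * expR (T / 4) * gauss a x)); last by ring.
rewrite /gauss -/T -!expRD ler_wpM2l// ler_expR le_eqVlt; apply/orP; left.
by apply/eqP; field.
Qed.

Definition ind y : R := if 1 <= y then 1 else 0.

Lemma measurable_ind : measurable_fun setT ind.
Proof.
apply: measurable_fun_ifT => //.
by apply: measurable_fun_ler.
Qed.

(* A parameter [q = (v, y)] is made of the variable [v] of
   [1 / |x| = pi^(-1/2) \int expR (- v^2 |x|^2) dv] and of the variable [y >= 1] of
   [expR (- c) / c = \int_(y >= 1) 2 y expR (- c y^2) dy]. *)
Definition sv v : R := 1 + v ^+ 2.

Lemma sv_ge1 v : 1 <= sv v. Proof. by rewrite lerDl sqr_ge0. Qed.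
Lemma sv_gt0 v : 0 < sv v. Proof. exact: lt_le_trans ltr01 (sv_ge1 v). Qed.

Definition alpha q : R := sv q.1 / q.2 ^+ 2.

Definition ycut (k : nat) y : R := ind y * y^-1 ^+ k.+2.

(** The powers of y and the factor 1 / (2 s) are dictated by the frequency side. There the Gaussian
    of parameter [alpha] produces y^n and each flagged factor y^2. Against y^(-n-1) from
    [ycut m.+1], and y^(-2) more if both flags are on, a single y is left in front of exp (- c y^2),
    c = |xi|^2 / (4 s). The integral of y exp (- c y^2) over y >= 1 is 2 s exp (- c) / |xi|^2. *)
Definition atom b0 b1 q x : R :=
  ycut m.+1 q.2 * (q.2^-1) ^+ (2 * (b0 && b1)) / (2 * sv q.1) * base b0 b1 (alpha q) x.
End atoms.

Section atom_estimates.
Context (R : realType) (m : nat).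
Local Notation n := m.+2.
Local Notation leb := (@lebesgue_measure R).
Local Notation lam := (@lebesgue_rV R n).
Local Notation leb2 := (leb \x leb)%E.
Local Notation oscc := (osc (@cos R)).
Local Notation oscs := (osc (@sin R)).
Local Notation "'i0" := (ord0 : 'I_n).
Local Notation "'i1" := (lift ord0 ord0 : 'I_n).
Implicit Types (x xi : 'rV[R]_n) (a c t v y s : R) (b : bool) (q : measurableTypeR R * measurableTypeR R).

Lemma ycut_ge0 k y : 0 <= ycut k y.
Proof.
rewrite /ycut /ind; case: ifPn => [y1|_]; last by rewrite mul0r.
by rewrite mul1r exprn_ge0// invr_ge0 (le_trans ler01).
Qed.

Lemma ycut_le k y : ycut k y <= 2 / (1 + y ^+ 2).
Proof.
have y2 : 0 < 1 + y ^+ 2 by rewrite ltr_pwDl// sqr_ge0.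
rewrite /ycut /ind; case: ifPn => [y1|_]; last by rewrite mul0r divr_ge0// ltW.
have y0 : 0 < y := lt_le_trans ltr01 y1.
rewrite mul1r (@le_trans _ _ (y^-1 ^+ 2))//.
  by rewrite ler_wiXn2l// ?invr_ge0 ?(ltW y0)// invf_le1.
rewrite exprVn ler_pdivlMr// mulrC ler_pdivrMr ?exprn_gt0//.
have y21 : 1 <= y ^+ 2 by rewrite exprn_ege1.
lra.
Qed.

Lemma measurable_ycut k : measurable_fun setT (ycut k : R -> R).
Proof.
apply: measurable_funM; first exact: measurable_ind.
by apply: measurable_funX; exact: measurable_funV_real.
Qed.

Lemma integrable_ycut k : integrable_fun leb (ycut k : R -> R).
Proof.
apply: integrable_fun_dominated; last first.
- exact: (integrable_funZl 2 (@integrable_oneDsqrV R)).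
- by move=> y; rewrite ger0_norm ?ycut_ge0// ycut_le.
- exact: measurable_ycut.
Qed.

Lemma measurable_sv : measurable_fun setT (@sv R).
Proof. by apply: measurable_funD => //; exact: measurable_funX. Qed.

Lemma integrable_svV : integrable_fun leb (fun v => (sv v)^-1).
Proof. exact: integrable_oneDsqrV. Qed.

Lemma alpha_ge0 q : 0 <= alpha q.
Proof. by rewrite divr_ge0 ?sqr_ge0// ltW// sv_gt0. Qed.

Definition envelope y x : R := ycut m.+1 y * expR (- (dotp x x / (2 * y ^+ 2))).

(** Since [sv] is at least 1, the Gaussian of parameter [alpha] is dominated by one without v, and
    the bound separates v from (y, x). The constant 32 is the 64 of [base_bound] over the 2 of
    [2 * sv]. *)
Lemma atom_bound b0 b1 q x :
  `|atom b0 b1 q x| <= 32 / sv q.1 * envelope q.2 x.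
Proof.
case: q => v y; rewrite /envelope /atom /ycut /ind [(v, y).1]/= [(v, y).2]/=.
case: ifPn => [y1|_]; last by rewrite !mul0r normr0 mulr0.
have y0 : 0 < y := lt_le_trans ltr01 y1.
have s0 := sv_gt0 v; have s1 := sv_ge1 v.
have h2 : `|base b0 b1 (alpha (v, y)) x| <= 64 * expR (- (dotp x x / (2 * y ^+ 2))).
  rewrite (le_trans (base_bound _ _ _ (alpha_ge0 _)))// ler_wpM2l// ler_expR lerN2.
  rewrite /alpha /= (_ : _ / _ * _ / _ = sv v * (dotp x x / (2 * y ^+ 2))); last first.
    by field; rewrite gt_eqF.
  by rewrite ler_peMl// divr_ge0 ?dotp_ge0// mulr_ge0 ?sqr_ge0.
have y'0 : 0 <= y^-1 by rewrite invr_ge0 ltW.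
have p0 : 0 <= y^-1 ^+ m.+3 by rewrite exprn_ge0.
have q0 : 0 <= y^-1 ^+ (2 * (b0 && b1)) by rewrite exprn_ge0.
have q1 : y^-1 ^+ (2 * (b0 && b1)) <= 1 by rewrite exprn_ile1// invf_le1.
move: (y^-1 ^+ m.+3) (y^-1 ^+ (2 * (b0 && b1))) (base _ _ _ _) (expR _) p0 q0 q1 h2.
move=> P Q B e p0 q0 q1 h2.
have c0 : 0 <= 1 * P * Q / (2 * sv v).
  rewrite mulr_ge0 ?invr_ge0 ?mulr_ge0 ?(ltW s0)//.
rewrite normrM ger0_norm//.
apply: (@le_trans _ _ (P * 1 / (2 * sv v) * (64 * e))).
  apply: ler_pM => //.
  by rewrite mul1r ler_wpM2r ?invr_ge0 ?mulr_ge0 ?(ltW s0)// ler_wpM2l.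
by rewrite le_eqVlt; apply/orP; left; apply/eqP; field; rewrite gt_eqF.
Qed.

Lemma envelope_le y x : envelope y x <= 2 / (1 + y ^+ 2).
Proof.
rewrite (le_trans _ (ycut_le m.+1 y))// ler_piMr ?ycut_ge0// -expR0 ler_expR oppr_le0.
by rewrite divr_ge0 ?dotp_ge0// mulr_ge0 ?sqr_ge0.
Qed.

Lemma envelope_ge0 y x : 0 <= envelope y x.
Proof. by rewrite mulr_ge0 ?ycut_ge0 ?expR_ge0. Qed.

Definition bnd q : R := 32 / sv q.1 * (2 / (1 + q.2 ^+ 2)).

Lemma integrable_bnd : integrable_fun leb2 bnd.
Proof.
exact: (integrable_product_mul (integrable_funZl 32 integrable_svV)
  (integrable_funZl 2 (@integrable_oneDsqrV R))).
Qed.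

Lemma atom_le_bnd b0 b1 q x : `|atom b0 b1 q x| <= bnd q.
Proof.
rewrite (le_trans (atom_bound _ _ _ _))// ler_wpM2l ?envelope_le//.
by rewrite divr_ge0// ltW// sv_gt0.
Qed.

Lemma measurable_atom b0 b1 :
  measurable_fun setT (fun z : 'rV[R]_n * (measurableTypeR R * measurableTypeR R) =>
    atom b0 b1 z.2 z.1).
Proof.
have m1 : measurable_fun setT (fun z : 'rV[R]_n * (measurableTypeR R * measurableTypeR R) => sv z.2.1).
  by apply: (measurableT_comp measurable_sv); apply: measurableT_comp.
have m2 : measurable_fun setT (fun z : 'rV[R]_n * (measurableTypeR R * measurableTypeR R) => (z.2.2 : R)).
  by apply: measurableT_comp.
have m3 : measurable_fun setT (fun z : 'rV[R]_n * (measurableTypeR R * measurableTypeR R) => alpha z.2).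
  by apply: measurable_funM => //; apply: measurable_funV_real; exact: measurable_funX.
have m4 i : measurable_fun setT
    (fun z : 'rV[R]_n * (measurableTypeR R * measurableTypeR R) => (z.1 : 'rV[R]_n) 0 i).
  by apply: (measurableT_comp (measurable_coord i)).
apply: measurable_funM.
  apply: measurable_funM; last first.
    by apply: measurable_funV_real; exact: measurable_funM.
  apply: measurable_funM; first exact: (measurableT_comp (measurable_ycut _)).
  by apply: measurable_funX; exact: measurable_funV_real.
apply: measurable_funM.
  by apply: measurable_funM; exact: measurable_dd.
apply: measurableT_comp => //; apply: measurableT_comp => //.
apply: measurable_funM => //.
exact: measurable_dotp.
Qed.

Definition hatom b0 b1 q xi : R :=
  (2 * sv q.1)^-1 * (hd b0 (sv q.1) (xi 0 'i0) * hd b1 (sv q.1) (xi 0 'i1)) *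
  Num.sqrt (pi / sv q.1) ^+ n *
  (ind q.2 * (q.2 * expR (- (dotp xi xi / (4 * sv q.1) * q.2 ^+ 2)))).

Lemma integrable_atom b0 b1 q : integrable_fun lam (atom b0 b1 q).
Proof.
rewrite /atom /ycut /ind; case: ifPn => [y1|_].
  apply: integrable_funZl; apply: integrable_base.
  by rewrite divr_gt0 ?sv_gt0// exprn_gt0// (lt_le_trans ltr01).
rewrite (_ : (fun x => _) = cst 0); last by apply/funext => x; rewrite !mul0r.
exact: integrable0.
Qed.

(** Counting powers of y. With no flag the count would leave 1 / y instead of y, and no numerator
    would compensate the division by |xi|^2. *)
Lemma osc_atom b0 b1 q xi : b0 || b1 ->
  oscc (atom b0 b1 q) xi = hatom b0 b1 q xi /\ oscs (atom b0 b1 q) xi = 0.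
Proof.
move=> b01; case: q => v y; rewrite /osc /hatom /atom /ycut /ind /=.
case: ifPn => [y1|_]; last first.
  rewrite !mul0r mulr0; split; rewrite (eq_Rint _ (g := cst 0)) ?Rintegral_cst ?mul0r//.
    by move=> x; rewrite !mul0r.
  by move=> x; rewrite !mul0r.
have y0 : 0 < y := lt_le_trans ltr01 y1.
have s0 := sv_gt0 v.
pose a := alpha (v, y); have a0 : 0 < a by rewrite divr_gt0 ?exprn_gt0.
have Ib := @integrable_base R m b0 b1 a a0.
have [Ec Es] := osc_base b0 b1 xi a0.
pose c := 1 * y^-1 ^+ m.+3 * y^-1 ^+ (2 * (b0 && b1)) / (2 * sv v).
have E (k : R -> R) : measurable_fun setT k -> (forall t, `|k t| <= 1) ->
    \int[lam]_x (c * base b0 b1 a x * k (dotp x xi)) = c * osc k (base b0 b1 a) xi.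
  move=> mk k1; rewrite /osc -RintegralZl//; last exact: integrable_osc.
  by apply: eq_Rint => x; rewrite mulrA.
rewrite (E _ (@measurable_cos R) (@cos_max R)) (E _ (@measurable_sin R) (@sin_max R)).
rewrite Ec Es mulr0; split => //.
have sqE : Num.sqrt (pi / a) = Num.sqrt (pi / sv v) * y.
  rewrite /a /alpha /= invf_div mulrCA [y ^+ 2 * _]mulrC sqrtrM ?divr_ge0 ?pi_ge0 ?ltW//.
  by rewrite sqrtr_sqr gtr0_norm.
have expE : dotp xi xi / (4 * a) = dotp xi xi / (4 * sv v) * y ^+ 2.
  by rewrite /a /alpha /=; field; rewrite !gt_eqF.
rewrite /gauss_ft sqE exprMn expE.
have hdE t : hd true a t = y ^+ 2 * hd true (sv v) t.
  by rewrite /hd /a /alpha /=; field; rewrite !gt_eqF.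
have yE : y^-1 ^+ m.+3 * y ^+ m.+2 = y^-1.
  by rewrite exprS -mulrA -exprMn mulVf ?gt_eqF// expr1n mulr1.
transitivity ((y^-1 ^+ m.+3 * y ^+ m.+2) * (y^-1 ^+ (2 * (b0 && b1)) *
   (hd b0 a (xi 0 'i0) * hd b1 a (xi 0 'i1))) / (2 * sv v) *
   (Num.sqrt (pi / sv v) ^+ n * expR (- (dotp xi xi / (4 * sv v) * y ^+ 2)))).
  by rewrite /c; ring.
have -> : y^-1 ^+ (2 * (b0 && b1)) * (hd b0 a (xi 0 'i0) * hd b1 a (xi 0 'i1)) =
    y ^+ 2 * (hd b0 (sv v) (xi 0 'i0) * hd b1 (sv v) (xi 0 'i1)).
  have y2 : y^-1 ^+ 2 * y ^+ 2 = 1 by rewrite -exprMn mulVf ?gt_eqF// expr1n.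
  clear c E Ib Ec Es.
  have hdF r t : hd false r t = 1 by [].
  case: b0 b01 => [_|/= ->]; last by rewrite !hdE muln0 expr0 !mul1r.
  case: b1; last by rewrite !hdE !hdF [(2 * _)%N]/= expr0 !mulr1 mul1r.
  rewrite !hdE [(2 * _)%N]/=; move: (hd _ _ _) (hd _ _ _) => A B.
  by rewrite -[RHS]mul1r -y2; ring.
rewrite yE; field; rewrite !gt_eqF//.
Qed.

End atom_estimates.

Section atom_superposition.
Context (R : realType) (m : nat).
Local Notation n := m.+2.
Local Notation leb := (@lebesgue_measure R).
Local Notation "'i0" := (ord0 : 'I_n).
Local Notation "'i1" := (lift ord0 ord0 : 'I_n).
Implicit Types (x xi : 'rV[R]_n) (a c t v y s : R) (b : bool) (q : measurableTypeR R * measurableTypeR R).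

Lemma cvg_gauss1 c : 0 < c -> expR (- (c * y ^+ 2)) @[y --> +oo] --> (0 : R).
Proof.
move=> c0; apply: (cvg_comp (fun y => c * y ^+ 2) (fun z => expR (- z))); last exact: cvgr_expR.
by apply: gt0_cvgMry => //; exact: cvgr_expr2.
Qed.

Lemma integral_ind_gauss1 c : 0 < c ->
  integrable_fun leb (fun y => ind y * (y * expR (- (c * y ^+ 2)))) /\
  \int[leb]_y (ind y * (y * expR (- (c * y ^+ 2)))) = expR (- c) / (2 * c).
Proof.
move=> c0.
have dE t : is_derive t 1 (fun y => - (expR (- (c * y ^+ 2)) / (2 * c))) (t * expR (- (c * t ^+ 2))).
  have h := is_derive_gauss1 c t.
  by apply: is_derive_eq; rewrite /GRing.scale/=; field; rewrite gt_eqF.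
have cf : continuous (fun y => y * expR (- (c * y ^+ 2))).
  move=> t; apply: cvgM; first exact: cvg_id.
  exact: continuous_derive1 (is_derive_gauss1 c) t.
have E : (\int[leb]_y (ind y * (y * expR (- (c * y ^+ 2))))%:E = (expR (- c) / (2 * c))%:E)%E.
  transitivity (\int[leb]_(y in `[1%R, +oo[) (y * expR (- (c * y ^+ 2)))%:E)%E; last first.
    rewrite (@ge0_continuous_FTC2y _ _ (fun y => - (expR (- (c * y ^+ 2)) / (2 * c))) 1 0).
    - by rewrite expr1n mulr1 -EFinB sub0r opprK.
    - by move=> y y1; rewrite mulr_ge0 ?expR_ge0// (le_trans ler01).
    - exact: continuous_subspaceT.
    - rewrite -oppr0 -(mul0r (2 * c)^-1); apply: cvgN; apply: cvgM; last exact: cvg_cst.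
      exact: cvg_gauss1.
    - by move=> y _; case: (dE y).
    - by apply: cvg_at_right_filter; exact: continuous_derive1 dE 1.
    - by move=> y _; rewrite derive1E; case: (dE y).
  rewrite [RHS]integral_mkcond; apply: eq_integral => y _.
  rewrite patchE /ind mem_setE in_itv/= andbT.
  by case: ifP => _; rewrite ?mul1r ?mul0r.
have I : integrable_fun leb (fun y => ind y * (y * expR (- (c * y ^+ 2)))).
  apply: integral_ge0_lty.
  - apply: measurable_funM; first exact: measurable_ind.
    exact: continuous_measurable_fun.
  - move=> y; rewrite /ind; case: ifP => [y1|_]; last by rewrite mul0r.
    by rewrite mul1r mulr_ge0 ?expR_ge0// (le_trans ler01).
  - by rewrite E ltry.
by split => //; rewrite /Rintegral E.
Qed.

Definition hprofile b0 b1 xi v : R :=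
  hd b0 (sv v) (xi 0 'i0) * hd b1 (sv v) (xi 0 'i1) * gauss_ft (sv v) xi / dotp xi xi.

Lemma dotp_eq0 k (x : 'rV[R]_k) : (dotp x x == 0) = (x == 0).
Proof.
apply/eqP/eqP => [x0|->]; last first.
  by rewrite /dotp big1// => i _; rewrite mxE mul0r.
apply/rowP => i; rewrite mxE; apply/eqP; rewrite -sqrf_eq0 eq_le sqr_ge0 andbT.
by rewrite -x0 sqr_coord_le_dotp.
Qed.

Lemma hd_eq0 b0 b1 xi a : b0 || b1 -> xi = 0 -> hd b0 a (xi 0 'i0) * hd b1 a (xi 0 'i1) = 0.
Proof.
move=> b01 ->; rewrite !mxE; case: b0 b01 => [_|/= ->]; rewrite /hd expr0n/= !mul0r oppr0.
  by rewrite mul0r.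
by rewrite mulr0.
Qed.

(** This is [integral_ind_gauss1] with c = |xi|^2 / (4 s). The slice has constant sign in y, so its
    L^1 norm is the absolute value of its integral. *)
Lemma hatom_slice b0 b1 xi v : b0 || b1 ->
  [/\ integrable_fun leb (fun y => hatom b0 b1 (v, y) xi),
     \int[leb]_y hatom b0 b1 (v, y) xi = hprofile b0 b1 xi v &
     \int[leb]_y `|hatom b0 b1 (v, y) xi| = `|hprofile b0 b1 xi v| ].
Proof.
move=> b01; have s0 := sv_gt0 v; have [xi0|xi0] := eqVneq xi 0.
  (* At [xi = 0] the quotient in [hprofile] is a division by 0; a flagged factor makes both sides
     vanish. *)
  rewrite /hprofile (hd_eq0 _ b01 xi0) !mul0r normr0.
  have E y : hatom b0 b1 (v, y) xi = 0 by rewrite /hatom (hd_eq0 _ b01 xi0) mulr0 !mul0r.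
  split.
  - rewrite (_ : (fun y => _) = cst 0); last by apply/funext => y; exact: E.
    exact: integrable0.
  - by rewrite (eq_Rint _ (g := cst 0)) ?Rintegral_cst ?mul0r.
  - rewrite (eq_Rint _ (g := cst 0)) ?Rintegral_cst ?mul0r// => y.
    by rewrite E normr0.
have d0 : 0 < dotp xi xi by rewrite lt_neqAle eq_sym dotp_eq0 xi0 dotp_ge0.
have c0 : 0 < dotp xi xi / (4 * sv v) by rewrite divr_gt0// mulr_gt0.
have [I E] := integral_ind_gauss1 c0.
pose X := (2 * sv v)^-1 * (hd b0 (sv v) (xi 0 'i0) * hd b1 (sv v) (xi 0 'i1)) *
  Num.sqrt (pi / sv v) ^+ n.
have XE : X * (expR (- (dotp xi xi / (4 * sv v))) / (2 * (dotp xi xi / (4 * sv v)))) =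
    hprofile b0 b1 xi v.
  by rewrite /hprofile /gauss_ft /X; field; rewrite !gt_eqF.
split.
- exact: (integrable_funZl X I).
- by rewrite /hatom /= RintegralZl// E -XE.
- transitivity (\int[leb]_y (`|X| * (ind y * (y * expR (- (dotp xi xi / (4 * sv v) * y ^+ 2)))))).
    apply: eq_Rint => y; rewrite /hatom normrM; congr (_ * _); rewrite ger0_norm//= /ind.
    case: ifP => [y1|_]; last by rewrite mul0r.
    by rewrite mul1r mulr_ge0 ?expR_ge0// (le_trans ler01).
  clearbody X; rewrite RintegralZl// E -XE normrM [Y in _ = _ * Y]ger0_norm// divr_ge0 ?expR_ge0//.
  by rewrite mulr_ge0// ltW.
Qed.

(** Here the singularity at xi = 0 is removed. A flagged factor is at most A = |xi|^2 / (2 s), which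
    cancels |xi|^2 and leaves 1 / s, integrable in v. A second flag brings another A, absorbed by
    the Gaussian: A exp (- A / 2) <= 2. *)
Lemma hprofile_bound b0 b1 xi v : b0 || b1 ->
  `|hprofile b0 b1 xi v| <= Num.sqrt pi ^+ n / sv v.
Proof.
move=> b01; have s0 := sv_gt0 v; have s1 := sv_ge1 v; have [xi0|xi0] := eqVneq xi 0.
  by rewrite /hprofile (hd_eq0 _ b01 xi0) !mul0r normr0 divr_ge0 ?exprn_ge0 ?sqrtr_ge0// ltW.
have d0 : 0 < dotp xi xi by rewrite lt_neqAle eq_sym dotp_eq0 xi0 dotp_ge0.
pose e := expR (- (dotp xi xi / (4 * sv v))).
have hb : `|hd b0 (sv v) (xi 0 'i0) * hd b1 (sv v) (xi 0 'i1)| * e <= dotp xi xi / sv v.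
  have e0 : 0 <= e by exact: expR_ge0.
  have e1 : e <= 1 by rewrite -expR0 ler_expR oppr_le0 divr_ge0 ?mulr_ge0// ltW.
  have hdt i : `|hd true (sv v) (xi 0 i)| <= dotp xi xi / sv v / 2.
    rewrite /hd normrN ger0_norm ?divr_ge0 ?sqr_ge0 ?mulr_ge0 ?(ltW s0)//.
    rewrite -mulrA -invfM mulrC [sv v * 2]mulrC mulrC ler_wpM2r ?sqr_coord_le_dotp//.
    by rewrite invr_ge0 mulr_ge0// ltW.
  have A0 : 0 <= dotp xi xi / sv v by rewrite divr_ge0// ltW.
  have Ae : dotp xi xi / sv v / 2 * e <= 2.
    have := expR_ge1Dx (dotp xi xi / (4 * sv v)).
    have -> : dotp xi xi / sv v / 2 = 2 * (dotp xi xi / (4 * sv v)).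
      by field; rewrite gt_eqF.
    rewrite /e expRN -mulrA => h; rewrite -[leRHS]mulr1 ler_wpM2l//.
    by rewrite ler_pdivrMr ?expR_gt0// mul1r (le_trans _ h)// lerDr.
  case: b0 b01 => [_|/= ->]; last first.
    rewrite mul1r; rewrite (le_trans (ler_piMr _ e1))// (le_trans (hdt 'i1))//.
    by rewrite ler_pdivrMr// ler_peMr// ler1n.
  case: b1; last first.
    rewrite mulr1; rewrite (le_trans (ler_piMr _ e1))// (le_trans (hdt 'i0))//.
    by rewrite ler_pdivrMr// ler_peMr// ler1n.
  rewrite normrM -mulrA; apply: (@le_trans _ _ (dotp xi xi / sv v / 2 * (dotp xi xi / sv v / 2 * e))).
    by apply: ler_pM => //; [rewrite mulr_ge0|rewrite ler_wpM2r].
  rewrite [leRHS](_ : _ = dotp xi xi / sv v / 2 * 2); last by field; rewrite gt_eqF.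
  by rewrite ler_wpM2l// divr_ge0.
rewrite /hprofile /gauss_ft -/e normrM normfV (ger0_norm (ltW d0)) ler_pdivrMr//.
have sn : 0 <= Num.sqrt (pi / sv v) ^+ n by exact/exprn_ge0/sqrtr_ge0.
have e0 : 0 <= e by exact: expR_ge0.
rewrite normrM [X in _ * X]ger0_norm ?(mulr_ge0 sn e0)//.
rewrite mulrCA [leRHS](_ : _ = (Num.sqrt pi ^+ n) * (dotp xi xi / sv v)); last by ring.
apply: ler_pM => //; first by rewrite mulr_ge0.
by rewrite lerXn2r ?nnegrE ?sqrtr_ge0// ler_sqrt ?pi_ge0// ler_pdivrMr// ler_peMr ?pi_ge0.
Qed.
End atom_superposition.

Section atom_potentials.
Context (R : realType) (m : nat).
Local Notation n := m.+2.
Local Notation leb := (@lebesgue_measure R).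
Local Notation lam := (@lebesgue_rV R n).
Local Notation leb2 := (leb \x leb)%E.
Local Notation oscc := (osc (@cos R)).
Local Notation oscs := (osc (@sin R)).
Local Notation par := (measurableTypeR R * measurableTypeR R)%type.
Implicit Types (x xi : 'rV[R]_n) (a c t v y s : R) (b : bool) (q : par).

Definition pot b0 b1 x : R := \int[leb2]_q atom b0 b1 q x.
Definition prof b0 b1 xi : R := \int[leb]_v hprofile b0 b1 xi v.

Lemma measurable_atom_q b0 b1 x : measurable_fun setT (fun q => atom b0 b1 q x).
Proof. exact: (measurableT_comp (@measurable_atom R m b0 b1) (@measurable_pair1 _ _ _ par x)). Qed.

Lemma integrable_atom_q b0 b1 x : integrable_fun leb2 (fun q => atom b0 b1 q x).
Proof.
exact: integrable_fun_dominated (measurable_atom_q b0 b1 x)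
  (fun q => atom_le_bnd b0 b1 q x) (@integrable_bnd R).
Qed.

Lemma measurable_hatom b0 b1 :
  measurable_fun setT (fun z : 'rV[R]_n * par => hatom b0 b1 z.2 z.1).
Proof.
have m1 : measurable_fun setT (fun z : 'rV[R]_n * par => sv z.2.1).
  by apply: (measurableT_comp (@measurable_sv R)); apply: measurableT_comp.
have m2 : measurable_fun setT (fun z : 'rV[R]_n * par => (z.2.2 : R)).
  by apply: measurableT_comp.
have m4 i : measurable_fun setT (fun z : 'rV[R]_n * par => (z.1 : 'rV[R]_n) 0 i).
  by apply: (measurableT_comp (measurable_coord i)).
apply: measurable_funM; last first.
  apply: measurable_funM; first exact: (measurableT_comp (@measurable_ind R)).
  apply: measurable_funM => //; apply: measurableT_comp => //; apply: measurableT_comp => //.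
  apply: measurable_funM; last exact: measurable_funX.
  apply: measurable_funM; first exact: measurable_dotp.
  by apply: measurable_funV_real; exact: measurable_funM.
apply: measurable_funM; last first.
  apply: measurable_funX; apply: measurable_sqrt; apply: measurable_funM => //.
  exact: measurable_funV_real.
apply: measurable_funM.
  by apply: measurable_funV_real; exact: measurable_funM.
by apply: measurable_funM; exact: measurable_hd.
Qed.

Lemma measurable_hatom_q b0 b1 xi : measurable_fun setT (fun q => hatom b0 b1 q xi).
Proof. exact: (measurableT_comp (@measurable_hatom b0 b1) (@measurable_pair1 _ _ _ par xi)). Qed.

Lemma measurable_hprofile b0 b1 xi : measurable_fun setT (hprofile b0 b1 xi : R -> R).
Proof.
have msv := @measurable_sv R.
apply: measurable_funM => //; apply: measurable_funM.
  by apply: measurable_funM; exact: measurable_hd.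
apply: measurable_funM.
  apply: measurable_funX; apply: measurable_sqrt; apply: measurable_funM => //.
  exact: measurable_funV_real.
apply: measurableT_comp => //; apply: measurableT_comp => //; apply: measurable_funM => //.
by apply: measurable_funV_real; exact: measurable_funM.
Qed.

Lemma integrable_hprofile b0 b1 xi : b0 || b1 -> integrable_fun leb (hprofile b0 b1 xi).
Proof.
move=> b01; apply: (@integrable_fun_dominated _ (measurableTypeR R) R leb (fun v => Num.sqrt pi ^+ n / sv v)).
- exact: measurable_hprofile.
- by move=> v; exact: hprofile_bound.
- exact: integrable_funZl (@integrable_svV R).
Qed.

Lemma integrable_hatom_q b0 b1 xi : b0 || b1 -> integrable_fun leb2 (fun q => hatom b0 b1 q xi).
Proof.
move=> b01; apply: integrable_productP; first exact: measurable_hatom_q.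
  by move=> v; case: (hatom_slice xi v b01).
rewrite (_ : (fun v => _) = fun v => `|hprofile b0 b1 xi v|).
  by apply: integrable_fun_norm; exact: integrable_hprofile.
by apply/funext => v; case: (hatom_slice xi v b01).
Qed.

Lemma Rintegral_hatom b0 b1 xi : b0 || b1 ->
  \int[leb2]_q hatom b0 b1 q xi = prof b0 b1 xi.
Proof.
move=> b01; rewrite -Rintegral_product1; last exact: integrable_hatom_q.
by apply: eq_Rint => v; case: (hatom_slice xi v b01).
Qed.

Lemma Rintegral_norm_hatom b0 b1 xi : b0 || b1 ->
  \int[leb2]_q `|hatom b0 b1 q xi| <= \int[leb]_v (Num.sqrt pi ^+ n / sv v).
Proof.
move=> b01; have I := integrable_hatom_q xi b01.
have In := integrable_fun_norm I.
rewrite -(Rintegral_product1 In).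
have -> : \int[leb]_v \int[leb]_y `|hatom b0 b1 (v, y) xi| =
    \int[leb]_v `|hprofile b0 b1 xi v|.
  by apply: eq_Rint => v; case: (hatom_slice xi v b01).
apply: le_Rintegral => //.
- by apply: integrable_fun_norm; exact: integrable_hprofile.
- exact: integrable_funZl (@integrable_svV R).
- by move=> v _; exact: hprofile_bound.
Qed.

(** Both parts come from [osc_superposition], for the sine with transform 0 because the atoms are
    even. [sfprod] supplies the sigma-finite structure on the parameters. *)
Lemma pot_duality b0 b1 phi : b0 || b1 -> schwartz phi ->
  [/\ integrable_fun lam (fun xi => prof b0 b1 xi * phi xi),
  \int[lam]_x (pot b0 b1 x * oscc phi x) = \int[lam]_xi (prof b0 b1 xi * phi xi) &
  \int[lam]_x (pot b0 b1 x * oscs phi x) = 0].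
Proof.
move=> b01 sphi; have Iphi := schwartz_integrable sphi.
have h0 q xi : oscs (atom b0 b1 q) xi = 0 by case: (osc_atom q xi b01).
have n0 (xi : 'rV[R]_n) : \int[leb2]_q `|0 : R| <= 0.
  by rewrite normr0 Rintegral_cst// mul0r.
have hc q xi : oscc (atom b0 b1 q) xi = hatom b0 b1 q xi by case: (osc_atom q xi b01).
have [Ic Ec] := @osc_superposition R n _ par (sfprod leb leb) _ (atom b0 b1) (hatom b0 b1) _ _ _
    (@measurable_cos R) (@cos_max R) (@measurable_atom R m b0 b1)
    (@integrable_bnd R) (@atom_le_bnd R m b0 b1) (@integrable_atom R m b0 b1) hc
    (measurable_hatom b0 b1) (fun xi => integrable_hatom_q xi b01)
    (fun xi => Rintegral_norm_hatom xi b01) Iphi (integrable_oscc sphi).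
have pE xi : (\int[sfprod leb leb]_q hatom b0 b1 q xi) * phi xi = prof b0 b1 xi * phi xi.
  by congr (_ * _); exact: Rintegral_hatom.
split; first by rewrite -(funext pE).
  by apply: (etrans Ec); exact: eq_Rint.
transitivity (\int[lam]_xi ((\int[leb2]_q 0) * phi xi)); last first.
  have z0 : \int[leb2]_q (0 : R) = 0 by rewrite Rintegral_cst// mul0r.
  rewrite (eq_Rint _ (g := cst 0)) => [|xi]; last by rewrite z0 mul0r.
  by rewrite Rintegral_cst// mul0r.
have I0 (xi : 'rV[R]_n) : integrable_fun (sfprod leb leb) ((fun _ _ => 0 : R)^~ xi).
  exact: integrable0.
have m0 : measurable_fun setT (fun z : 'rV[R]_n * par => 0 : R) by exact: measurable_cst.
exact: proj2 (@osc_superposition R n _ par (sfprod leb leb) _ (atom b0 b1) (fun _ _ => 0) _ _ _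
    (@measurable_sin R) (@sin_max R) (@measurable_atom R m b0 b1)
    (@integrable_bnd R) (@atom_le_bnd R m b0 b1) (@integrable_atom R m b0 b1) h0
    m0 I0 n0 Iphi (integrable_oscs sphi)).
Qed.

Lemma measurable_pot b0 b1 : measurable_fun setT (pot b0 b1).
Proof.
have := @measurable_Rintegral1 _ _ _ _ R lam (sfprod leb leb)
  (fun z => weight z.1 * atom b0 b1 z.2 z.1).
rewrite (_ : (fun x => _) = fun x => weight x * pot b0 b1 x); last first.
  by apply/funext => x; rewrite /= RintegralZl//; exact: integrable_atom_q.
have Ib : integrable_fun (sfprod leb leb) (@bnd R) by exact: integrable_bnd.
move=> mw; rewrite (_ : pot b0 b1 = fun x => (weight x)^-1 * (weight x * pot b0 b1 x)).
  apply: measurable_funM; first by apply: measurable_funV_real; exact: measurable_weight.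
  apply: mw; apply: integrable_fun_dominated; last first.
  - exact: (integrable_product_mul (integrable_weight R n) Ib).
  - by move=> z; rewrite normrM ger0_norm ?weight_ge0// ler_wpM2l ?weight_ge0// atom_le_bnd.
  - apply: measurable_funM; last exact: measurable_atom.
    exact: (measurableT_comp (@measurable_weight R n)).
by apply/funext => x; rewrite mulKf// gt_eqF// weight_gt0.
Qed.

Lemma pot_bounded b0 b1 x : `|pot b0 b1 x| <= \int[leb2]_q bnd q.
Proof.
rewrite (le_trans (le_normr_Rintegral measurableT (integrable_atom_q b0 b1 x)))//.
apply: le_Rintegral => //.
- by apply: integrable_fun_norm; exact: integrable_atom_q.
- exact: integrable_bnd.
- by move=> q _; exact: atom_le_bnd.
Qed.

Lemma measurable_envelope :
  measurable_fun setT (fun z : measurableTypeR R * 'rV[R]_n => envelope z.1 z.2).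
Proof.
apply: measurable_funM; first exact: (measurableT_comp (@measurable_ycut R _)).
apply: measurableT_comp => //; apply: measurableT_comp => //; apply: measurable_funM.
  exact: measurable_dotp.
apply: measurable_funV_real; apply: measurable_funM => //.
exact: measurable_funX.
Qed.

Lemma integrable_envelope x : integrable_fun leb (fun y => envelope y x).
Proof.
apply: integrable_fun_dominated; last first.
- exact: (integrable_funZl 2 (@integrable_oneDsqrV R)).
- by move=> y; rewrite ger0_norm ?envelope_ge0// envelope_le.
- exact: (measurableT_comp measurable_envelope (@measurable_pair2 _ _ (measurableTypeR R) _ x)).
Qed.

Lemma pot_le_envelope b0 b1 x :
  `|pot b0 b1 x| <= (\int[leb]_v (32 / sv v)) * \int[leb]_y envelope y x.
Proof.
have I32 : integrable_fun leb (fun v => 32 / sv v).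
  exact: integrable_funZl (@integrable_svV R).
have Ie := integrable_envelope x.
have Ip := integrable_product_mul I32 Ie.
rewrite (le_trans (le_normr_Rintegral measurableT (integrable_atom_q b0 b1 x)))//.
apply: (@le_trans _ _ (\int[leb2]_q (32 / sv q.1 * envelope q.2 x))).
  apply: le_Rintegral => //.
  - by apply: integrable_fun_norm; exact: integrable_atom_q.
  - by move=> q _; exact: atom_bound.
rewrite -(Rintegral_product1 Ip) -RintegralZr// le_eqVlt; apply/orP; left; apply/eqP.
by apply: eq_Rint => v /=; rewrite RintegralZl.
Qed.

Lemma Rintegral_gauss a : 0 < a -> \int[lam]_x gauss a x = Num.sqrt (pi / a) ^+ n.
Proof.
move=> a0; have [h _] := @osc_gauss R n a 0 a0.
have d0 x : dotp x 0 = 0 by rewrite /dotp big1// => i _; rewrite mxE mulr0.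
transitivity (oscc (gauss a) (0 : 'rV[R]_n)).
  by apply: eq_Rint => x; rewrite d0 cos0 mulr1.
by rewrite h /gauss_ft d0 mul0r oppr0 expR0 mulr1.
Qed.

(** If [envelope y x] is written [ycut 0 y * h y], this is [ycut 0 y * h y ^+ 2]: the integrand that
    Cauchy-Schwarz for the measure y^(-2) dy on y >= 1 leaves. *)
Definition envelope2 y x : R := ycut (m.+1 * 2) y * expR (- (dotp x x / y ^+ 2)).

Lemma measurable_envelope2 :
  measurable_fun setT (fun z : measurableTypeR R * 'rV[R]_n => envelope2 z.1 z.2).
Proof.
apply: measurable_funM; first exact: (measurableT_comp (@measurable_ycut R _)).
apply: measurableT_comp => //; apply: measurableT_comp => //; apply: measurable_funM.
  exact: measurable_dotp.
by apply: measurable_funV_real; exact: measurable_funX.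
Qed.

Lemma envelope2_ge0 y x : 0 <= envelope2 y x.
Proof. by rewrite mulr_ge0 ?ycut_ge0 ?expR_ge0. Qed.

(** Integrating the Gaussian in x costs y^n against y^(-2n); the remaining y^(-n) is integrable over
    y >= 1 since n >= 2. *)
Lemma integrable_envelope2 : integrable_fun (leb \x lam)%E (fun z => envelope2 z.1 z.2).
Proof.
apply: integrable_productP; first exact: measurable_envelope2.
  move=> y /=; rewrite /envelope2 /ycut /ind; case: ifPn => [y1|_].
    apply: integrable_funZl.
    rewrite (_ : (fun x => _) = gauss (y ^+ 2)^-1); last first.
      by apply/funext => x; rewrite /gauss mulrC.
    by apply: integrable_gauss; rewrite invr_gt0 exprn_gt0// (lt_le_trans ltr01).
  rewrite (_ : (fun x => _) = cst 0); last by apply/funext => x; rewrite !mul0r.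
  exact: integrable0.
rewrite (_ : (fun y => _) = fun y => Num.sqrt pi ^+ n * ycut m y).
  by apply: integrable_funZl; exact: integrable_ycut.
apply/funext => y /=.
rewrite (eq_Rint _ (g := fun x => ycut (m.+1 * 2) y * gauss (y ^+ 2)^-1 x)); last first.
  by move=> x; rewrite ger0_norm ?envelope2_ge0// /envelope2 /gauss [_^-1 * _]mulrC.
rewrite /ycut /ind; case: ifPn => [y1|_]; last first.
  by rewrite !mul0r mulr0 (eq_Rint _ (g := cst 0)) ?Rintegral_cst ?mul0r// => x; rewrite !mul0r.
have y0 : 0 < y := lt_le_trans ltr01 y1.
have a0 : 0 < (y ^+ 2)^-1 by rewrite invr_gt0 exprn_gt0.
rewrite RintegralZl//; last exact: integrable_gauss.
rewrite Rintegral_gauss// invrK sqrtrM ?pi_ge0// sqrtr_sqr gtr0_norm// exprMn !mul1r.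
rewrite mulrCA; congr (_ * _).
have -> : (m.+1 * 2).+2 = (m.+2 + m.+2)%N by rewrite muln2 -addnn !addSn !addnS.
by rewrite exprD -mulrA -exprMn mulVf ?gt_eqF// expr1n mulr1.
Qed.

(** Cauchy-Schwarz for the finite measure with density [ycut 0]; the added 1 makes the constant
    positive without computing the mass. *)
Lemma sqr_envelope_le x : (\int[leb]_y envelope y x) ^+ 2 <=
  (\int[leb]_y ycut 0 y + 1) * \int[leb]_y envelope2 y x.
Proof.
pose h y := y^-1 ^+ m.+1 * expR (- (dotp x x / (2 * y ^+ 2))).
have E1 y : envelope y x = ycut 0 y * h y.
  by rewrite /envelope /ycut /h (_ : m.+3 = 2 + m.+1)%N// exprD; ring.
have E2 y : envelope2 y x = ycut 0 y * h y ^+ 2.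
  rewrite /envelope2 /ycut /h exprMn -expRM_natl -exprM (_ : (m.+1 * 2).+2 = 2 + m.+1 * 2)%N//.
  rewrite exprD !mulrA; congr (_ * expR _).
  have [->|y0] := eqVneq y 0; first by rewrite expr0n/= mulr0 invr0 !mulr0 oppr0 mulr0.
  by field.
have -> : \int[leb]_y envelope y x = \int[leb]_y (ycut 0 y * h y) by exact: eq_Rint.
have -> : \int[leb]_y envelope2 y x = \int[leb]_y (ycut 0 y * h y ^+ 2) by exact: eq_Rint.
apply: sqr_Rintegral_le.
- by move=> y; exact: ycut_ge0.
- exact: integrable_ycut.
- by rewrite ltr_wpDl// Rintegral_ge0// => y _; exact: ycut_ge0.
- by rewrite lerDl.
- by rewrite -(funext E1); exact: integrable_envelope.
- rewrite -(funext E2); apply: integrable_fun_dominated; last first.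
  + exact: (@integrable_ycut R (m.+1 * 2)).
  + move=> y; rewrite ger0_norm ?envelope2_ge0// ler_piMr ?ycut_ge0//.
    by rewrite -expR0 ler_expR oppr_le0 divr_ge0 ?dotp_ge0// sqr_ge0.
  + exact: (measurableT_comp measurable_envelope2 (@measurable_pair2 _ _ (measurableTypeR R) _ x)).
Qed.

(** The L^2 bound is obtained in physical space: [pot] is controlled by the integral of [envelope],
    whose square is controlled by that of [envelope2], integrable in y and x jointly. *)
Lemma integrable_sqr_pot b0 b1 : integrable_fun lam (fun x => pot b0 b1 x ^+ 2).
Proof.
apply: integrable_fun_dominated; last first.
- exact: (integrable_funZl ((\int[leb]_v (32 / sv v)) ^+ 2 * (\int[leb]_y ycut 0 y + 1))
    (integrable_Rintegral2 integrable_envelope2)).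
- move=> x; rewrite ger0_norm ?sqr_ge0//= -(@real_normK _ (pot _ _ _)) ?num_real//.
  have := pot_le_envelope b0 b1 x; set A := \int[leb]_v _ => h.
  rewrite -mulrA (le_trans (lerXn2r _ _ _ h))// ?nnegrE// ?(le_trans _ h)//.
  by rewrite exprMn ler_wpM2l ?sqr_ge0// sqr_envelope_le.
- by apply: measurable_funX; exact: measurable_pot.
Qed.

End atom_potentials.

(** * The pressure of the vortex *)

Section multiplier_criterion.
Local Open Scope complex_scope.
Context (R : realType) (n : nat).
Local Notation lam := (@lebesgue_rV R n).
Local Notation oscc := (osc (@cos R)).
Local Notation oscs := (osc (@sin R)).

Lemma fourierE (f : 'rV[R]_n -> R) xi : integrable_fun lam f ->
  fourier f xi = oscc f xi +i* (- oscs f xi).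
Proof.
move=> If; have Is := integrable_osc (@measurable_sin R) (@sin_max R) xi If.
rewrite /fourier /cintegral; congr (_ +i* _).
  by apply: eq_Rint => x; rewrite /= mul0r subr0 cosN.
rewrite -mulN1r /osc -RintegralZl//; apply: eq_Rint => x.
by rewrite /= mul0r addr0 sinN; ring.
Qed.

(** With vanishing sine transforms the complex identity splits: the real part compares cosine
    transforms, the imaginary part says 0 = 0. The bound on [g] makes [oscs phi * g] integrable. *)
Lemma fourier_multiplier_even (mult f g : 'rV[R]_n -> R) (C : R) :
  integrable_fun lam f -> (forall xi, oscs f xi = 0) ->
  measurable_fun setT g -> (forall x, `|g x| <= C) ->
  integrable_fun lam (fun x => g x ^+ 2) ->
  (forall phi, schwartz phi ->
    \int[lam]_x (g x * oscc phi x) = \int[lam]_xi (mult xi * oscc f xi * phi xi) /\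
    \int[lam]_x (g x * oscs phi x) = 0) ->
  fourier_multiplier mult f g.
Proof.
move=> If fs mg gC Ig2 H; split; first exact/Lfun1_integrable.
  exact: Lfun2P.
move=> phi sphi; have [Hc Hs] := H _ sphi; have Iphi := schwartz_integrable sphi.
rewrite /cintegral; congr (_ +i* _).
  transitivity (\int[lam]_x (g x * oscc phi x)).
    by apply: eq_Rint => x; rewrite fourierE//= mul0r subr0.
  by rewrite Hc; apply: eq_Rint => xi; rewrite fourierE//= fs; ring.
have Ig : integrable_fun lam (fun x => oscs phi x * g x).
  exact: integrable_fun_bounded mg gC (integrable_oscs sphi).
transitivity (0 : R).
  transitivity (\int[lam]_x (-1 * (oscs phi x * g x))).
    by apply: eq_Rint => x; rewrite fourierE//= mul0r addr0; ring.
  rewrite RintegralZl// (_ : \int[lam]_x _ = 0) ?mulr0// -[RHS]Hs.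
  by apply: eq_Rint => x; rewrite mulrC.
rewrite (eq_Rint _ (g := cst 0)) ?Rintegral_cst ?mul0r// => xi.
by rewrite fourierE//= fs; ring.
Qed.

End multiplier_criterion.

Section planar_monomials.
Context (R : realType) (m : nat).
Local Notation n := m.+2.
Local Notation leb := (@lebesgue_measure R).
Local Notation lam := (@lebesgue_rV R n).
Local Notation "'i0" := (ord0 : 'I_n).
Local Notation "'i1" := (lift ord0 ord0 : 'I_n).
Implicit Types (x xi : 'rV[R]_n) (v : R).

Definition mono k0 k1 x : R :=
  x 0 'i0 ^+ k0 * x 0 'i1 ^+ k1 * (expR (- dotp x x) / enorm x).

Lemma enorm_eq0 k (x : 'rV[R]_k) : (enorm x == 0) = (x == 0).
Proof. by rewrite -dotp_eq0 -enorm_sqr sqrf_eq0. Qed.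

Lemma enorm_gt0 k (x : 'rV[R]_k) : x != 0 -> 0 < enorm x.
Proof. by move=> x0; rewrite lt_neqAle eq_sym enorm_eq0 x0 enorm_ge0. Qed.

Lemma coord_le_enorm k (x : 'rV[R]_k) i : `|x 0 i| <= enorm x.
Proof.
rewrite -ler_sqr ?nnegrE ?enorm_ge0// enorm_sqr real_normK ?num_real//.
exact: sqr_coord_le_dotp.
Qed.

(** The Gaussian integral in v is sqrt pi / |x|. At the origin [mono] divides by 0, and both sides
    are 0 because the monomial has degree 2. *)
Lemma mono_gauss_v k0 k1 x : (k0 + k1 = 2)%N ->
  integrable_fun leb (fun v => pgauss (sv v) k0 k1 x) /\
  \int[leb]_v pgauss (sv v) k0 k1 x = Num.sqrt pi * mono k0 k1 x.
Proof.
move=> k2.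
have E v : pgauss (sv v) k0 k1 x = (x 0 'i0 ^+ k0 * x 0 'i1 ^+ k1 * expR (- dotp x x)) *
    expR (- (dotp x x * v ^+ 2)).
  by rewrite /pgauss /gauss /sv mulrDl mul1r opprD expRD mulrC [v ^+ 2 * _]mulrC; ring.
have [x0|x0] := eqVneq x 0.
  have P0 : x 0 'i0 ^+ k0 * x 0 'i1 ^+ k1 = 0.
    by rewrite x0 !mxE -exprD k2 expr0n.
  rewrite /mono P0 mul0r mulr0.
  have E0 : (fun v => pgauss (sv v) k0 k1 x) = cst 0.
    by apply/funext => v; rewrite E P0 !mul0r.
  by rewrite E0 Rintegral_cst// mul0r; split => //; exact: integrable0.
have d0 : 0 < dotp x x by rewrite -enorm_sqr exprn_gt0// enorm_gt0.
have I := integrable_pow_gauss1 d0 (leq0n 2).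
have I' : integrable_fun leb (fun v => expR (- (dotp x x * v ^+ 2))).
  by have := I; under eq_fun do rewrite expr0 mul1r.
rewrite (funext E); split; first exact: integrable_funZl.
rewrite RintegralZl// integral_gauss1// sqrtrM ?pi_ge0// sqrtrV ?dotp_ge0// -/(enorm x) /mono.
by ring.
Qed.

Lemma measurable_mono k0 k1 : measurable_fun setT (mono k0 k1).
Proof.
have mc i : measurable_fun setT (fun x => x 0 (i : 'I_n)) := measurable_coord i.
have md : measurable_fun setT (fun x => dotp x x) by exact: measurable_dotp.
apply: measurable_funM; first by apply: measurable_funM; exact: measurable_funX.
apply: measurable_funM; last by apply: measurable_funV_real; exact: measurable_sqrt.
by apply: measurableT_comp => //; exact: measurableT_comp.
Qed.

(** Half of the exponent absorbs |x|^2 / |x|, as |x| <= 1 + |x|^2 / 2 <= exp (|x|^2 / 2). *)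
Lemma mono_bound k0 k1 x : (k0 + k1 = 2)%N -> `|mono k0 k1 x| <= gauss (1 / 2) x.
Proof.
move=> k2; have [x0|x0] := eqVneq x 0.
  by rewrite /mono x0 !mxE -exprD k2 expr0n/= mul0r normr0 gauss_ge0.
have r0 := enorm_gt0 x0.
rewrite /mono !normrM !normrX normfV [`|enorm x|]gtr0_norm// [`|expR _|]ger0_norm ?expR_ge0//.
apply: (@le_trans _ _ (enorm x ^+ k0 * enorm x ^+ k1 * (expR (- dotp x x) / enorm x))).
  rewrite ler_wpM2r ?divr_ge0 ?expR_ge0 ?(ltW r0)//.
  by apply: ler_pM => //; rewrite ?exprn_ge0// lerXn2r ?nnegrE ?(ltW r0)// coord_le_enorm.
rewrite -exprD k2 mulrCA [enorm x ^+ 2]expr2 mulfK ?gt_eqF//.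
have -> : gauss (1 / 2) x = expR (- dotp x x) * expR (enorm x ^+ 2 / 2).
  by rewrite /gauss -expRD enorm_sqr; congr expR; field.
rewrite ler_wpM2l ?expR_ge0// (le_trans _ (expR_ge1Dx _))//.
have := sqr_ge0 (enorm x - 1); rewrite sqrrB1; lra.
Qed.

Lemma integrable_mono k0 k1 : (k0 + k1 = 2)%N -> integrable_fun lam (mono k0 k1).
Proof.
move=> k2; apply: (integrable_fun_dominated (measurable_mono k0 k1)).
  by move=> x; exact: mono_bound.
by apply: integrable_gauss; rewrite divr_gt0.
Qed.

Lemma osc_mono (k : R -> R) k0 k1 xi : (k0 + k1 = 2)%N ->
  measurable_fun setT k -> (forall t, `|k t| <= 1) ->
  integrable_fun leb (fun v => osc k (pgauss (sv v) k0 k1) xi) /\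
  Num.sqrt pi * osc k (mono k0 k1) xi = \int[leb]_v osc k (pgauss (sv v) k0 k1) xi.
Proof.
move=> k2 mk k1'.
have Im := integrable_mono k2.
have mkx : measurable_fun setT (fun z : 'rV[R]_n * measurableTypeR R => k (dotp z.1 xi)).
  by apply: (measurableT_comp mk); exact: measurable_dotp.
have mp : measurable_fun setT (fun z : 'rV[R]_n * measurableTypeR R => pgauss (sv z.2) k0 k1 z.1).
  have mc i : measurable_fun setT (fun z : 'rV[R]_n * measurableTypeR R => z.1 0 (i : 'I_n)).
    exact: (measurableT_comp (measurable_coord i)).
  apply: measurable_funM; first by apply: measurable_funM; exact: measurable_funX.
  apply: measurableT_comp => //; apply: measurableT_comp => //; apply: measurable_funM.
    exact: (measurableT_comp (@measurable_sv R)).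
  exact: measurable_dotp.
have normE x v : `|pgauss (sv v) k0 k1 x| = `|x 0 'i0 ^+ k0 * x 0 'i1 ^+ k1| * gauss (sv v) x.
  by rewrite /pgauss normrM [X in _ * X]ger0_norm ?gauss_ge0.
have I : integrable_fun (lam \x leb)%E
    (fun z => pgauss (sv z.2) k0 k1 z.1 * k (dotp z.1 xi)).
  apply: integrable_fun_Mbounded => //.
  apply: integrable_productP => //.
    by move=> x; case: (mono_gauss_v x k2).
  rewrite (_ : (fun x => _) = fun x => Num.sqrt pi * `|mono k0 k1 x|).
    by apply: integrable_funZl; exact: integrable_fun_norm.
  apply/funext => x /=.
  have [Ip Ep] := mono_gauss_v x k2.
  (* The sign of the monomial does not depend on v, so the integral of the absolute value is that of
     [mono_gauss_v] up to sign. *)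
  have [P0|P0] := leP 0 (x 0 'i0 ^+ k0 * x 0 'i1 ^+ k1).
    transitivity (\int[leb]_v pgauss (sv v) k0 k1 x).
      by apply: eq_Rint => v; rewrite normE ger0_norm.
    by rewrite Ep ger0_norm// mulr_ge0// divr_ge0 ?expR_ge0 ?enorm_ge0.
  transitivity (\int[leb]_v (-1 * pgauss (sv v) k0 k1 x)).
    by apply: eq_Rint => v; rewrite normE ltr0_norm// /pgauss; ring.
  rewrite RintegralZl// Ep ler0_norm; first by ring.
  by rewrite mulr_le0_ge0 ?(ltW P0)// divr_ge0 ?expR_ge0 ?enorm_ge0.
split; first exact: integrable_Rintegral2 I.
rewrite /osc -RintegralZl//; last exact: integrable_osc.
rewrite -(Rintegral_swap I) /=; apply: eq_Rint => x.
have [Ip Ep] := mono_gauss_v x k2.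
by rewrite RintegralZr// Ep mulrA.
Qed.

End planar_monomials.

Section vortex.
Context (R : realType) (m : nat).
Local Notation n := m.+2.
Local Notation leb := (@lebesgue_measure R).
Local Notation lam := (@lebesgue_rV R n).
Local Notation oscc := (osc (@cos R)).
Local Notation oscs := (osc (@sin R)).
Local Notation "'i0" := (ord0 : 'I_n).
Local Notation "'i1" := (lift ord0 ord0 : 'I_n).
Implicit Types (x xi : 'rV[R]_n) (v : R) (l : 'I_n).

Definition hh x : R := expR (- (dotp x x / 2)) / Num.sqrt (enorm x).

Definition vel x : 'rV[R]_n :=
  \row_k (if k == 'i0 then - x 0 'i1 * hh x else if k == 'i1 then x 0 'i0 * hh x else 0).

Lemma hh_sqr x : hh x ^+ 2 = expR (- dotp x x) / enorm x.
Proof.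
rewrite /hh exprMn exprVn sqr_sqrtr ?enorm_ge0// -expRM_natl; congr (expR _ / _).
by field.
Qed.

Lemma vel00 x : vel x 0 'i0 * vel x 0 'i0 = mono 0 2 x.
Proof. by rewrite !mxE /mono -hh_sqr expr0 /=; ring. Qed.

Lemma vel11 x : vel x 0 'i1 * vel x 0 'i1 = mono 2 0 x.
Proof. by rewrite !mxE /mono -hh_sqr expr0 /=; ring. Qed.

Lemma vel01 x : vel x 0 'i0 * vel x 0 'i1 = - mono 1 1 x.
Proof. by rewrite !mxE /mono -hh_sqr /=; ring. Qed.

Lemma vel_eq0 x (k : 'I_n) : k != 'i0 -> k != 'i1 -> vel x 0 k = 0.
Proof. by move=> k0 k1; rewrite mxE (negbTE k0) (negbTE k1). Qed.

(** Three potentials span all entries: the numerators that occur on the Fourier side are xi_0^2,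
    xi_1^2 and xi_0^2 xi_1^2. The factor 1 / sqrt pi is that of the representation of 1 / |x|. *)
Definition comb (al be ga : R) x : R := (Num.sqrt pi)^-1 *
  (al * pot true false x + be * pot false true x + ga * pot true true x).

Lemma measurable_comb al be ga : measurable_fun setT (comb al be ga).
Proof.
apply: measurable_funM => //; apply: measurable_funD.
  by apply: measurable_funD; apply: measurable_funM => //; exact: measurable_pot.
by apply: measurable_funM => //; exact: measurable_pot.
Qed.

Let B : R := \int[(leb \x leb)%E]_q bnd q.

Lemma comb_bounded al be ga x : `|comb al be ga x| <=
  (Num.sqrt pi)^-1 * ((`|al| + `|be| + `|ga|) * B).
Proof.
rewrite normrM ger0_norm ?invr_ge0 ?sqrtr_ge0// ler_wpM2l ?invr_ge0 ?sqrtr_ge0//.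
rewrite (le_trans (ler_normD _ _))// !mulrDl lerD//.
  by rewrite (le_trans (ler_normD _ _))// lerD// normrM ler_wpM2l// pot_bounded.
by rewrite normrM ler_wpM2l// pot_bounded.
Qed.

Lemma integrable_sqr_comb al be ga : integrable_fun lam (fun x => comb al be ga x ^+ 2).
Proof.
have J b0 b1 c := integrable_funZl c (@integrable_sqr_pot R m b0 b1).
apply: integrable_fun_dominated; last first.
- exact: (integrable_funZl (3 * (Num.sqrt pi)^-1 ^+ 2) (integrable_funD (integrable_funD
    (J true false (al ^+ 2)) (J false true (be ^+ 2))) (J true true (ga ^+ 2)))).
- move=> x; rewrite ger0_norm ?sqr_ge0// /comb exprMn.
  rewrite [leRHS](_ : _ = (Num.sqrt pi)^-1 ^+ 2 * (3 * ((al * pot true false x) ^+ 2 +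
    (be * pot false true x) ^+ 2 + (ga * pot true true x) ^+ 2))); last by ring.
  apply: ler_wpM2l; first exact: sqr_ge0.
  move: (al * _) (be * _) (ga * _) => p q r.
  have := sqr_ge0 (p - q); have := sqr_ge0 (q - r); have := sqr_ge0 (p - r); nra.
- by apply: measurable_funX; exact: measurable_comb.
Qed.

Lemma comb_duality al be ga phi : schwartz phi ->
  \int[lam]_x (comb al be ga x * oscc phi x) =
  \int[lam]_xi ((Num.sqrt pi)^-1 * (al * prof true false xi + be * prof false true xi +
     ga * prof true true xi) * phi xi) /\
  \int[lam]_x (comb al be ga x * oscs phi x) = 0.
Proof.
move=> sphi.
have [I1 E1 F1] := @pot_duality R m true false phi isT sphi.
have [I2 E2 F2] := @pot_duality R m false true phi isT sphi.
have [I3 E3 F3] := @pot_duality R m true true phi isT sphi.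
have lin (f1 f2 f3 : 'rV[R]_n -> R) : integrable_fun lam f1 -> integrable_fun lam f2 ->
   integrable_fun lam f3 ->
   \int[lam]_x ((Num.sqrt pi)^-1 * (al * f1 x + be * f2 x + ga * f3 x)) =
   (Num.sqrt pi)^-1 * (al * \int[lam]_x f1 x + be * \int[lam]_x f2 x + ga * \int[lam]_x f3 x).
  move=> J1 J2 J3; have K1 := integrable_funZl al J1; have K2 := integrable_funZl be J2.
  have K3 := integrable_funZl ga J3; have K12 := integrable_funD K1 K2.
  by rewrite RintegralZl ?RintegralD ?RintegralZl//; exact: integrable_funD.
have J b0 b1 (f : 'rV[R]_n -> R) : integrable_fun lam f ->
    integrable_fun lam (fun x => pot b0 b1 x * f x).
  move=> If; have := integrable_fun_bounded (measurable_pot b0 b1) (pot_bounded b0 b1) If.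
  by under eq_fun do rewrite mulrC.
have Ic := integrable_oscc sphi; have Is := integrable_oscs sphi.
split.
  transitivity (\int[lam]_x ((Num.sqrt pi)^-1 * (al * (pot true false x * oscc phi x) +
      be * (pot false true x * oscc phi x) + ga * (pot true true x * oscc phi x)))).
    by apply: eq_Rint => x; rewrite /comb; ring.
  rewrite lin; [|exact: J..]; rewrite E1 E2 E3 -lin//.
  by apply: eq_Rint => x; ring.
transitivity (\int[lam]_x ((Num.sqrt pi)^-1 * (al * (pot true false x * oscs phi x) +
    be * (pot false true x * oscs phi x) + ga * (pot true true x * oscs phi x)))).
  by apply: eq_Rint => x; rewrite /comb; ring.
by rewrite lin; [|exact: J..]; rewrite F1 F2 F3; ring.
Qed.

Lemma fourier_multiplier_comb (mult f : 'rV[R]_n -> R) al be ga :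
  integrable_fun lam f -> (forall xi, oscs f xi = 0) ->
  (forall xi, mult xi * oscc f xi = (Num.sqrt pi)^-1 *
    (al * prof true false xi + be * prof false true xi + ga * prof true true xi)) ->
  fourier_multiplier mult f (comb al be ga).
Proof.
move=> If fs fc; apply: fourier_multiplier_even => //.
- exact: measurable_comb.
- by move=> x; exact: comb_bounded.
- exact: integrable_sqr_comb.
- move=> phi sphi; have [Ec Es] := comb_duality al be ga sphi; split => //.
  by rewrite Ec; apply: eq_Rint => xi; rewrite fc.
Qed.

Lemma prof_comb al be ga xi :
  al * prof true false xi + be * prof false true xi + ga * prof true true xi =
  \int[leb]_v (al * hprofile true false xi v + be * hprofile false true xi v +
     ga * hprofile true true xi v).
Proof.
have J b0 b1 c (b01 : b0 || b1) := integrable_funZl c (integrable_hprofile xi b01).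
have J1 := J true false al isT; have J2 := J false true be isT.
have J3 := J true true ga isT; have J12 := integrable_funD J1 J2.
by rewrite !RintegralD// !RintegralZl//; exact: integrable_hprofile.
Qed.

Let sqrtpi_neq0 : Num.sqrt (pi : R) != 0.
Proof. by rewrite gt_eqF// sqrtr_gt0 pi_gt0. Qed.

(** The constant [c] stands for the symbol at [xi]. Moved under the integral in v, it reduces the
    multiplier identities to comparing integrands with [prof_comb]. *)
Lemma osc_monoE (k0 k1 : nat) xi : (k0 + k1 = 2)%N -> oscs (mono k0 k1) xi = 0 /\
  forall c, c * oscc (mono k0 k1) xi = (Num.sqrt pi)^-1 * \int[leb]_v (c *
    ((hermc (sv v) (xi 0 'i0) k0 * hermc (sv v) (xi 0 'i1) k1 -
      herms (sv v) (xi 0 'i0) k0 * herms (sv v) (xi 0 'i1) k1) * gauss_ft (sv v) xi)).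
Proof.
move=> k2; have [Is Es] := osc_mono xi k2 (@measurable_sin R) (@sin_max R).
have [Ic Ec] := osc_mono xi k2 (@measurable_cos R) (@cos_max R).
have k02 : (k0 <= 2)%N by rewrite -k2 leq_addr.
have k12 : (k1 <= 2)%N by rewrite -k2 leq_addl.
have G v := osc_pgauss xi (sv_gt0 v) k02 k12.
split.
  apply: (mulfI sqrtpi_neq0); rewrite mulr0 Es.
  have -> : \int[leb]_v oscs (pgauss (sv v) k0 k1) xi = \int[leb]_v (0 : R).
    apply: eq_Rint => v; rewrite (G v).2.
    (* The exponents are both even or both odd, and in each case every product of a [herms] and a
       [hermc] contains a factor 0. *)
    by move: k0 k1 k2 {k02 k12 Is Es Ic Ec G} => [|[|[|?]]] [|[|[|?]]]//= _; ring.
  by rewrite Rintegral_cst// mul0r.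
move=> c.
have cE v : c * ((hermc (sv v) (xi 0 'i0) k0 * hermc (sv v) (xi 0 'i1) k1 -
      herms (sv v) (xi 0 'i0) k0 * herms (sv v) (xi 0 'i1) k1) * gauss_ft (sv v) xi)
   = c * oscc (pgauss (sv v) k0 k1) xi by rewrite (G v).1.
rewrite (_ : Rintegral _ _ _ = \int[leb]_v (c * oscc (pgauss (sv v) k0 k1) xi)); last first.
  exact: eq_Rint.
by rewrite RintegralZl// -Ec; field.
Qed.

Let riesz_symbolE l (k : 'I_n) xi : riesz_symbol l k xi = - (xi 0 l * xi 0 k) * (dotp xi xi)^-1.
Proof. by rewrite /riesz_symbol enorm_sqr. Qed.

(* Closes side conditions of [field] below. *)
Let sv_neq0 v : sv v != 0. Proof. by rewrite gt_eqF// sv_gt0. Qed.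

(** The transform of the term x_1^2 carries (1 - xi_1^2 / (2 s)) / (2 s). Times - xi_0^2 it is the
    sum of the numerators flagged (true, false) and (true, true), whence 1, 0, 1. *)
Lemma fourier_multiplier00 : fourier_multiplier (riesz_symbol 'i0 'i0)
  (fun x => vel x 0 'i0 * vel x 0 'i0) (comb 1 0 1).
Proof.
rewrite (funext vel00); apply: fourier_multiplier_comb.
- exact: integrable_mono.
- by move=> xi; have [] := @osc_monoE 0 2 xi erefl.
- move=> xi; have [_ ->] := @osc_monoE 0 2 xi erefl; rewrite prof_comb; congr (_ * _).
  apply: eq_Rint => v; rewrite /hprofile /hd riesz_symbolE /=.
  by move: (_^-1) => d; field.
Qed.

Lemma fourier_multiplier11 : fourier_multiplier (riesz_symbol 'i1 'i1)
  (fun x => vel x 0 'i1 * vel x 0 'i1) (comb 0 1 1).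
Proof.
rewrite (funext vel11); apply: fourier_multiplier_comb.
- exact: integrable_mono.
- by move=> xi; have [] := @osc_monoE 2 0 xi erefl.
- move=> xi; have [_ ->] := @osc_monoE 2 0 xi erefl; rewrite prof_comb; congr (_ * _).
  apply: eq_Rint => v; rewrite /hprofile /hd riesz_symbolE /=.
  by move: (_^-1) => d; field.
Qed.

(** With the symbol, - x_0 x_1 gives the numerator - xi_0^2 xi_1^2 / (4 s^2) alone. Keeping [mult]
    abstract serves both (0, 1) and (1, 0). *)
Lemma fourier_multiplier01 mult : (forall xi, mult xi = riesz_symbol 'i0 'i1 xi) ->
  fourier_multiplier mult (fun x => vel x 0 'i0 * vel x 0 'i1) (comb 0 0 (-1)).
Proof.
move=> multE; rewrite (funext vel01).
have I11 := @integrable_mono R m 1 1 erefl.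
have oscN (k : R -> R) xi : measurable_fun setT k -> (forall t, `|k t| <= 1) ->
    osc k (fun x => - mono 1 1 x) xi = - osc k (mono 1 1) xi.
  move=> mk k1; rewrite -mulN1r /osc -RintegralZl//; last exact: integrable_osc.
  by apply: eq_Rint => x; ring.
have [s0 cE] : _ /\ _ := conj (fun xi => (@osc_monoE 1 1 xi erefl).1)
  (fun xi => (@osc_monoE 1 1 xi erefl).2).
apply: fourier_multiplier_comb.
- rewrite (_ : (fun x => _) = fun x => -1 * mono 1 1 x); first exact: integrable_funZl.
  by apply/funext => x; rewrite mulN1r.
- by move=> xi; rewrite oscN ?s0 ?oppr0//; [exact: measurable_sin|exact: sin_max].
- move=> xi; rewrite oscN; [|exact: measurable_cos|exact: cos_max].
  rewrite mulrN -mulNr cE prof_comb; congr (_ * _).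
  apply: eq_Rint => v; rewrite /hprofile /hd multE riesz_symbolE /=.
  by move: (_^-1) => d; field.
Qed.

Lemma fourier_multiplier0 mult (f : 'rV[R]_n -> R) : (forall x, f x = 0) ->
  fourier_multiplier mult f (comb 0 0 0).
Proof.
move=> f0; have -> : f = cst 0 by apply/funext.
have o0 (k : R -> R) xi : osc k (cst 0) xi = 0.
  rewrite /osc (eq_Rint _ (g := cst 0)) ?Rintegral_cst ?mul0r// => x.
  by rewrite mul0r.
apply: fourier_multiplier_comb; first exact: integrable0.
- by move=> xi; exact: o0.
- by move=> xi; rewrite o0; ring.
Qed.

Definition press l (k : 'I_n) : 'rV[R]_n -> R :=
  if l == 'i0 then (if k == 'i0 then comb 1 0 1 else if k == 'i1 then comb 0 0 (-1)
    else comb 0 0 0)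
  else if l == 'i1 then (if k == 'i0 then comb 0 0 (-1) else if k == 'i1 then comb 0 1 1
    else comb 0 0 0)
  else comb 0 0 0.

Lemma fourier_multiplier_vel l (k : 'I_n) : fourier_multiplier (riesz_symbol l k)
  (fun x => vel x 0 l * vel x 0 k) (press l k).
Proof.
rewrite /press; have [->|l0] := eqVneq l 'i0.
  have [->|k0] := eqVneq k 'i0; first exact: fourier_multiplier00.
  have [->|k1] := eqVneq k 'i1; first exact: fourier_multiplier01.
  by apply: fourier_multiplier0 => x; rewrite [X in _ * X]vel_eq0// mulr0.
have [->|l1] := eqVneq l 'i1.
  have [->|k0] := eqVneq k 'i0.
    rewrite (_ : (fun x => _) = fun x => vel x 0 'i0 * vel x 0 'i1).
      by apply: fourier_multiplier01 => xi; rewrite /riesz_symbol [xi 0 'i1 * _]mulrC.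
    by apply/funext => x; rewrite mulrC.
  have [->|k1] := eqVneq k 'i1; first exact: fourier_multiplier11.
  by apply: fourier_multiplier0 => x; rewrite [X in _ * X]vel_eq0// mulr0.
by apply: fourier_multiplier0 => x; rewrite vel_eq0// mul0r.
Qed.

Definition pressure_vel x : R := (Num.sqrt pi)^-1 * (pot true false x + pot false true x).

(** The coefficients of [pot true true] are 1, 1, -1, -1 and cancel. *)
Lemma sum_press x : \sum_(l < n) \sum_(k < n) press l k x = pressure_vel x.
Proof.
have c0 : comb 0 0 0 x = 0 by rewrite /comb; ring.
have S0 (F : 'I_m -> R) : (forall i, F i = 0) -> \sum_(i < m) F i = 0.
  by move=> F0; rewrite big1.
rewrite !big_ord_recl /press /= !S0 //; last by move=> i; rewrite !big_ord_recl /= S0 ?c0 ?addr0.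
by rewrite /comb /pressure_vel; ring.
Qed.

Lemma pressure_velP : pressure vel pressure_vel.
Proof.
exists press; first exact: fourier_multiplier_vel.
by apply: aeW => x; rewrite sum_press.
Qed.

End vortex.

(** * Regularity of the vortex *)

Section euclidean_norm.
Context (R : realType) (k : nat).
Implicit Types (x y z : 'rV[R]_k) (c : R).

Lemma dotpDl x y z : dotp (x + y) z = dotp x z + dotp y z.
Proof. by rewrite /dotp -big_split; apply: eq_bigr => i _; rewrite mxE mulrDl. Qed.

Lemma dotpZl c x y : dotp (c *: x) y = c * dotp x y.
Proof. by rewrite /dotp mulr_sumr; apply: eq_bigr => i _; rewrite mxE mulrA. Qed.

Lemma enorm_dotp_le x y : dotp x y <= enorm x * enorm y.
Proof.
have [->|x0] := eqVneq x 0.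
  by rewrite -(scale0r 0) dotpZl mul0r mulr_ge0 ?enorm_ge0.
have [->|y0] := eqVneq y 0.
  by rewrite dotpC -(scale0r 0) dotpZl mul0r mulr_ge0 ?enorm_ge0.
have rx := enorm_gt0 x0; have ry := enorm_gt0 y0.
have : 0 <= dotp (enorm y *: x - enorm x *: y) (enorm y *: x - enorm x *: y) by exact: dotp_ge0.
rewrite -scaleNr dotpDl !dotpZl ![dotp _ (_ + _)]dotpC !dotpDl !dotpZl -!enorm_sqr.
rewrite [dotp y x]dotpC => h.
have h2 : 0 <= 2 * (enorm x * enorm y) * (enorm x * enorm y - dotp x y).
  by apply: le_trans h _; rewrite le_eqVlt; apply/orP; left; apply/eqP; ring.
by move: h2; rewrite pmulr_rge0 ?mulr_gt0// subr_ge0.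
Qed.

Lemma enorm_le_add x y : enorm (x + y) <= enorm x + enorm y.
Proof.
rewrite -ler_sqr ?nnegrE ?addr_ge0 ?enorm_ge0// enorm_sqr dotpDl ![dotp _ (_ + _)]dotpC !dotpDl.
rewrite [dotp y x]dotpC -!enorm_sqr sqrrD; have := enorm_dotp_le x y; lra.
Qed.

Lemma enormN x : enorm (- x) = enorm x.
Proof. by rewrite /enorm /dotp; congr Num.sqrt; apply: eq_bigr => i _; rewrite !mxE mulrNN. Qed.

Lemma enormZ c x : enorm (c *: x) = `|c| * enorm x.
Proof. by rewrite /enorm dotpZl dotpC dotpZl mulrA -expr2 sqrtrM ?sqr_ge0// sqrtr_sqr. Qed.

Lemma enorm_sub_le x y : enorm x - enorm y <= enorm (x - y).
Proof. by rewrite lerBlDr -[in leLHS](subrK y x) enorm_le_add. Qed.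

End euclidean_norm.

Section vortex_regularity.
Context (R : realType) (m : nat).
Local Notation n := m.+2.
Local Notation "'i0" := (ord0 : 'I_n).
Local Notation "'i1" := (lift ord0 ord0 : 'I_n).
Implicit Types (x y z : 'rV[R]_n) (r s a b : R).

Lemma sqrt_gauss_le1 r : 0 <= r -> Num.sqrt r * expR (- (r ^+ 2 / 2)) <= 1.
Proof.
move=> r0; rewrite expRN ler_pdivrMr ?expR_gt0// mul1r (le_trans _ (expR_ge1Dx _))//.
have := sqr_sqrtr r0; have := sqr_ge0 (Num.sqrt r - 1); rewrite sqrrB1.
have := sqr_ge0 (r - 1); rewrite sqrrB1; nra.
Qed.

Lemma sqrt_sub_le s r : 0 <= s -> s <= r ->
  Num.sqrt r - Num.sqrt s <= Num.sqrt (r - s).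
Proof.
move=> s0 sr; have r0 := le_trans s0 sr.
have ba : Num.sqrt s <= Num.sqrt r by rewrite ler_sqrt.
rewrite -ler_sqr ?nnegrE ?subr_ge0 ?sqrtr_ge0// sqr_sqrtr ?subr_ge0//.
have := sqr_sqrtr r0; have := sqr_sqrtr s0; have := sqrtr_ge0 s; nra.
Qed.

(** If r - s >= 1, [sqrt_gauss_le1] suffices. Otherwise r - s <= sqrt (r - s), and 1 - exp (- t) <=
    t with r + s <= 1 + 2 s gives a Lipschitz bound. The 4 comes from (1 + s) (1 + 2 s) / 2 <= 4 (1
    + s^2 / 2). *)
Lemma sqrt_gauss_diff_le s r : 0 <= s -> s <= r ->
  Num.sqrt s * (expR (- (s ^+ 2 / 2)) - expR (- (r ^+ 2 / 2))) <= 4 * Num.sqrt (r - s).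
Proof.
move=> s0 sr; have D0 : 0 <= r - s by rewrite subr_ge0.
have a0 := sqrtr_ge0 s; have e10 := expR_ge0 (- (s ^+ 2 / 2)); have e20 := expR_ge0 (- (r ^+ 2 / 2)).
have [D1|D1] := leP 1 (r - s).
  have S1 : 1 <= Num.sqrt (r - s) by rewrite -sqrtr1 ler_sqrt.
  have := sqrt_gauss_le1 s0; nra.
have -> : expR (- (s ^+ 2 / 2)) - expR (- (r ^+ 2 / 2)) =
    expR (- (s ^+ 2 / 2)) * (1 - expR (- ((r ^+ 2 - s ^+ 2) / 2))).
  by rewrite mulrBr mulr1 -expRD; congr (_ - expR _); field.
have h1 : 1 - expR (- ((r ^+ 2 - s ^+ 2) / 2)) <= (r - s) * (1 + 2 * s) / 2.
  have := expR_ge1Dx (- ((r ^+ 2 - s ^+ 2) / 2)); nra.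
have h2 : r - s <= Num.sqrt (r - s).
  rewrite -[leLHS]sqr_sqrtr// expr2 ler_piMr ?sqrtr_ge0//.
  by rewrite -sqrtr1 ler_sqrt// ltW.
have h3 : Num.sqrt s * expR (- (s ^+ 2 / 2)) * (1 + 2 * s) / 2 <= 4.
  rewrite expRN (_ : _ / 2 = Num.sqrt s * (1 + 2 * s) / 2 / expR (s ^+ 2 / 2)); last by ring.
  rewrite ler_pdivrMr ?expR_gt0//.
  apply: (@le_trans _ _ (4 * (1 + s ^+ 2 / 2))); last by rewrite ler_wpM2l// expR_ge1Dx.
  have hs : Num.sqrt s <= 1 + s.
    have := sqr_sqrtr s0; have := sqr_ge0 (Num.sqrt s - 1); rewrite sqrrB1; nra.
  apply: (@le_trans _ _ ((1 + s) * (1 + 2 * s) / 2)).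
    by rewrite ler_wpM2r// ler_wpM2r// addr_ge0// mulr_ge0.
  have := sqr_ge0 (s - 1); rewrite sqrrB1; nra.
apply: (@le_trans _ _ (Num.sqrt s * expR (- (s ^+ 2 / 2)) * (1 + 2 * s) / 2 * (r - s))).
  rewrite mulrA; apply: (le_trans (ler_wpM2l (mulr_ge0 a0 e10) h1)).
  by rewrite le_eqVlt; apply/orP; left; apply/eqP; ring.
by apply: ler_pM => //; rewrite divr_ge0// mulr_ge0 ?mulr_ge0 ?addr_ge0 ?mulr_ge0.
Qed.

Definition rot x : 'rV[R]_n :=
  \row_k (if k == 'i0 then - x 0 'i1 else if k == 'i1 then x 0 'i0 else 0).

Lemma velE x : vel x = hh x *: rot x.
Proof.
apply/rowP => k; rewrite !mxE; case: ifP => _; first by rewrite mulrC.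
by case: ifP => _; rewrite ?mulr0// mulrC.
Qed.

Lemma enorm_rot_le x : enorm (rot x) <= enorm x.
Proof.
rewrite ler_wsqrtr// /dotp !big_ord_recl !mxE /= big1 => [|i _]; last first.
  by rewrite !mxE mul0r.
rewrite mulrNN addr0 addrA [leLHS]addrC lerDl sumr_ge0// => i _.
by rewrite -expr2 sqr_ge0.
Qed.

Lemma rotB x y : rot (x - y) = rot x - rot y.
Proof.
apply/rowP => k; rewrite !mxE; case: ifP => _; first by rewrite opprD.
by case: ifP => _; rewrite ?subr0.
Qed.

Lemma hhE x : hh x = expR (- (enorm x ^+ 2 / 2)) / Num.sqrt (enorm x).
Proof. by rewrite /hh enorm_sqr. Qed.

Lemma hh_ge0 x : 0 <= hh x.
Proof. by rewrite divr_ge0 ?expR_ge0 ?sqrtr_ge0. Qed.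

Lemma enorm_mul_hh x : enorm x * hh x = Num.sqrt (enorm x) * expR (- (enorm x ^+ 2 / 2)).
Proof.
rewrite hhE; have [->|x0] := eqVneq (enorm x) 0; first by rewrite sqrtr0 !mul0r.
have s0 : Num.sqrt (enorm x) != 0.
  by rewrite gt_eqF// sqrtr_gt0 lt_neqAle eq_sym x0 enorm_ge0.
transitivity (Num.sqrt (enorm x) ^+ 2 *
  (expR (- (enorm x ^+ 2 / 2)) / Num.sqrt (enorm x))); last by field.
by rewrite sqr_sqrtr// enorm_ge0.
Qed.

Lemma enorm_vel_le1 x : enorm (vel x) <= 1.
Proof.
rewrite velE enormZ ger0_norm ?hh_ge0//.
rewrite (le_trans (ler_wpM2l (hh_ge0 x) (enorm_rot_le x)))// mulrC enorm_mul_hh.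
exact/sqrt_gauss_le1/enorm_ge0.
Qed.

(** The difference of directions is weighted by [hh] at the point farther from 0, where |x - y| <= 2
    |x| turns |x - y| / sqrt |x| into a multiple of sqrt |x - y|. The constant is 2 + 1 + 4:
    directions, square root, Gaussian. *)
Let holder_ordered x y : x != y -> enorm y <= enorm x ->
  enorm (vel x - vel y) <= 7 * Num.sqrt (enorm (x - y)).
Proof.
move=> xy yx.
have x0 : x != 0.
  apply: contra xy => /eqP x0; rewrite x0 eq_sym -enorm_eq0 eq_le enorm_ge0 andbT.
  by rewrite (le_trans yx)// x0 /enorm /dotp big1 ?sqrtr0// => i _; rewrite mxE mul0r.
have r0 := enorm_gt0 x0; have s0 := enorm_ge0 y.
set d := enorm (x - y); have d0 : 0 <= d := enorm_ge0 _.
have dr : d <= 2 * enorm x.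
  by rewrite mulr_natl mulr2n (le_trans (enorm_le_add _ _))// enormN lerD2l.
have rsd : enorm x - enorm y <= d by exact: enorm_sub_le.
have Sd : Num.sqrt (enorm x - enorm y) <= Num.sqrt d := ler_wsqrtr rsd.
have sqd := sqr_sqrtr d0; have sqx := sqr_sqrtr (ltW r0); have sqy := sqr_sqrtr s0.
set a := Num.sqrt (enorm y) in sqy *; set b := Num.sqrt (enorm x) in sqx *.
have a0 : 0 <= a := sqrtr_ge0 _; have b0 : 0 < b by rewrite sqrtr_gt0.
have ab : a <= b := ler_wsqrtr yx.
set e1 := expR (- (enorm y ^+ 2 / 2)); set e2 := expR (- (enorm x ^+ 2 / 2)).
have e12 : e2 <= e1 by rewrite ler_expR lerN2 ler_pM2r// lerXn2r ?nnegrE ?(ltW r0).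
have e11 : e1 <= 1 by rewrite -expR0 ler_expR oppr_le0 divr_ge0 ?sqr_ge0.
have e20 : 0 <= e2 := expR_ge0 _.
have -> : vel x - vel y = hh x *: rot (x - y) + (hh x - hh y) *: rot y.
  by rewrite !velE rotB scalerBr scalerBl addrA subrK.
rewrite (le_trans (enorm_le_add _ _))// !enormZ ger0_norm ?hh_ge0//.
have T1 : hh x * enorm (rot (x - y)) <= 2 * Num.sqrt d.
  rewrite (le_trans (ler_wpM2l (hh_ge0 x) (enorm_rot_le _)))// hhE -/e2 -/b -/d.
  rewrite mulrAC ler_pdivrMr//.
  have : Num.sqrt d <= 2 * b.
    rewrite -ler_sqr ?nnegrE ?sqrtr_ge0 ?mulr_ge0 ?(ltW b0)// sqd exprMn sqx; lra.
  have := sqrtr_ge0 d; nra.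
have T2 : `|hh x - hh y| * enorm y <= 5 * Num.sqrt d.
  have hy : hh y * enorm y = a * e1 by rewrite mulrC enorm_mul_hh.
  have hx : hh x * enorm y = e2 * a ^+ 2 / b by rewrite hhE -sqy mulrAC.
  have a2b : a ^+ 2 / b <= a by rewrite ler_pdivrMr// expr2 ler_wpM2l.
  have a2b0 : 0 <= a ^+ 2 / b by rewrite divr_ge0 ?sqr_ge0 ?(ltW b0).
  have P1 : a - a ^+ 2 / b <= b - a.
    have : 2 * a - b <= a ^+ 2 / b by rewrite ler_pdivlMr//; have := sqr_ge0 (a - b); nra.
    lra.
  have P2 := sqrt_sub_le s0 yx; rewrite -/a -/b in P2.
  have P3 := sqrt_gauss_diff_le s0 yx; rewrite -/a -/e1 -/e2 in P3.
  rewrite -{1}[enorm y]ger0_norm// -normrM mulrBl hx hy distrC ger0_norm; last first.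
    rewrite subr_ge0 -mulrA mulrC; apply: ler_pM => //.
  (* The first summand measures the variation of the square root, the second that of the
     Gaussian. *)
  have -> : a * e1 - e2 * a ^+ 2 / b = e1 * (a - a ^+ 2 / b) + a ^+ 2 / b * (e1 - e2) by ring.
  have Q1 : e1 * (a - a ^+ 2 / b) <= a - a ^+ 2 / b by rewrite ler_piMl// subr_ge0.
  have Q2 : a ^+ 2 / b * (e1 - e2) <= a * (e1 - e2) by rewrite ler_wpM2r// subr_ge0.
  lra.
rewrite (le_trans (lerD T1 (ler_wpM2l (normr_ge0 _) (enorm_rot_le y))))//.
by rewrite (le_trans (lerD (lexx _) T2))//; lra.
Qed.

Lemma holder_vel : holder (1 / 2) (@vel R m).
Proof.
split; first by exists 1 => x; exact: enorm_vel_le1.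
exists 7 => x y xy.
have d0 : 0 < enorm (x - y) by rewrite enorm_gt0// subr_eq0.
rewrite div1r powR12_sqrt ?(ltW d0)// ler_pdivrMr ?(sqrtr_gt0 (enorm _))//.
have [h|h] := leP (enorm y) (enorm x); first exact: holder_ordered.
rewrite -enormN opprB -[in X in _ <= X]enormN opprB.
by apply: holder_ordered; rewrite 1?eq_sym// ltW.
Qed.

Lemma measurable_hh : measurable_fun setT (@hh R m).
Proof.
have md : measurable_fun setT (fun x => dotp x x) by exact: measurable_dotp.
apply: measurable_funM.
  by apply: measurableT_comp => //; apply: measurableT_comp => //; exact: measurable_funM.
by apply: measurable_funV_real; apply: measurable_sqrt; exact: measurable_sqrt.
Qed.

Lemma measurable_vel k : measurable_fun setT (fun x => vel x 0 k).
Proof.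
have mc i : measurable_fun setT (fun x => x 0 (i : 'I_n)) := measurable_coord i.
have mh := measurable_hh.
rewrite (_ : (fun x => _) = (fun x => if k == 'i0 then - x 0 'i1 * hh x else
    if k == 'i1 then x 0 'i0 * hh x else 0)); last by apply/funext => x; rewrite mxE.
have [_|_] := eqVneq k 'i0.
  by apply: measurable_funM => //; exact: measurableT_comp.
by have [_|_] := eqVneq k 'i1 => //; exact: measurable_funM.
Qed.

Lemma square_integrable_vel : square_integrable (@vel R m).
Proof.
move=> k; apply: Lfun2P; first exact: measurable_vel.
have [->|k0] := eqVneq k 'i0.
  by rewrite (_ : (fun x => _) = mono 0 2); [exact: integrable_mono|
    apply/funext => x; rewrite expr2 vel00].
have [->|k1] := eqVneq k 'i1.
  by rewrite (_ : (fun x => _) = mono 2 0); [exact: integrable_mono|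
    apply/funext => x; rewrite expr2 vel11].
rewrite (_ : (fun x => _) = cst 0); first exact: integrable0.
by apply/funext => x; rewrite vel_eq0// expr0n.
Qed.

End vortex_regularity.

(** * The vortex is divergence free *)

Section compact_support.
Context (R : realType) (n : nat).
Implicit Types (f : 'rV[R]_n -> R) (x : 'rV[R]_n).

Lemma continuous_coord (i : 'I_n) : continuous (fun x : 'rV[R]_n => x 0 i).
Proof. exact: coord_continuous. Qed.

Lemma continuous_dotp : continuous (fun x => dotp x x).
Proof.
apply: (@continuous_big _ _ +%R 0 predT).
  by move=> z; exact: add_continuous.
by move=> i _ x; apply: continuousM; exact: continuous_coord.
Qed.

(** The support lies in a cube, where compactness bounds [f]; on the ball of radius [s] the function
    [weight] is at least (1 + s^2)^(-n). *)
Lemma compact_support_le_weight f (r : R) : continuous f ->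
  (forall x, r < enorm x -> f x = 0) -> exists C, forall x, `|f x| <= C * weight x.
Proof.
move=> cf f0.
(* The absolute value keeps the cube nonempty if [r] is negative. *)
pose s := `|r|; pose A := [set x : 'rV[R]_n | forall i : 'I_n, `[- s, s]%classic (x ord0 i)].
have cA : compact A.
  by apply: (@rV_compact R n (fun=> `[- s, s]%classic)) => i; exact: segment_compact.
have A0 : A !=set0.
  by exists 0 => i /=; rewrite mxE in_itv /= oppr_le0 normr_ge0.
have cnf : {within A, continuous (fun x => `|f x|)}.
  apply: continuous_subspaceT => x; apply: continuous_comp; first exact: cf.
  exact: norm_continuous.
have [c _ hc] := compact_EVT_max A0 cA cnf.
have W0 : 0 <= `|f c| * (1 + s ^+ 2) ^+ n.
  by rewrite mulr_ge0// exprn_ge0// addr_ge0 ?sqr_ge0.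
exists (`|f c| * (1 + s ^+ 2) ^+ n) => x.
have [xr|xr] := ltP r (enorm x).
  by rewrite (f0 _ xr) normr0 mulr_ge0// weight_ge0.
have xs : enorm x <= s by rewrite (le_trans xr)// ler_norm.
have : `|f x| <= `|f c|.
  apply: hc; rewrite inE => i /=; rewrite in_itv /= -ler_norml.
  rewrite (le_trans _ xs)// -ler_sqr ?nnegrE ?enorm_ge0// enorm_sqr real_normK ?num_real//.
  exact: sqr_coord_le_dotp.
move=> h; rewrite -ler_pdivrMr ?weight_gt0//.
apply: ler_pM => //; first by rewrite invr_ge0 weight_ge0.
rewrite (le_trans (weightV_le x))// lerXn2r ?nnegrE ?addr_ge0 ?sqr_ge0//.
by rewrite lerD2l lerXn2r ?nnegrE ?enorm_ge0 ?/s ?normr_ge0.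
Qed.

Lemma continuous_enorm : continuous (@enorm R n).
Proof.
move=> x; apply: (@continuous_comp _ _ _ (fun x => dotp x x) Num.sqrt).
  exact: continuous_dotp.
exact: sqrt_continuous.
Qed.

Lemma derive_eq0_outside f (r : R) v x : (forall x, r < enorm x -> f x = 0) ->
  r < enorm x -> 'D_v f x = 0.
Proof.
move=> f0 rx; rewrite -(derive_cst (0 : R) v x); apply: near_eq_derive => //.
have h : \forall y \near x, r < enorm y := @continuous_enorm x _ (lt_nbhsr rx).
by near=> y; apply: f0; near: y.
Unshelve. all: by end_near.
Qed.

Lemma is_derive_sqr_enorm x v : is_derive x v (fun x => dotp x x) (2 * dotp v x).
Proof.
apply/is_derive_lineP; under eq_fun do rewrite dotp_line (dotpC v) (dotpC x) !dotp_line (dotpC x v).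
by apply: is_derive_eq; rewrite /GRing.scale/=; ring.
Qed.

End compact_support.

Section divergence.
Context (R : realType) (m : nat).
Local Notation n := m.+2.
Local Notation lam := (@lebesgue_rV R n).
Local Notation "'i0" := (ord0 : 'I_n).
Local Notation "'i1" := (lift ord0 ord0 : 'I_n).
Implicit Types (x : 'rV[R]_n) (e s : R).

(* [hh x = reg 0 (dotp x x)], and [e > 0] removes the singularity at the origin. *)
Definition reg e s : R := expR (- (s / 2)) / Num.sqrt (Num.sqrt (s + e)).

Definition dreg e s : R := - (2^-1 + (4 * (s + e))^-1) * reg e s.

Lemma is_derive_reg e s : 0 < e -> 0 <= s -> is_derive s 1 (reg e) (dreg e s).
Proof.
move=> e0 s0; have se : 0 < s + e by rewrite ltr_wpDl.
(* In terms of the fourth root [w] of s + e every radical is a power, and the identity becomes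
   rational. *)
set w := Num.sqrt (Num.sqrt (s + e)).
have w2 : Num.sqrt (s + e) = w ^+ 2 by rewrite sqr_sqrtr// sqrtr_ge0.
have w4 : s + e = w ^+ 4 by rewrite (exprM _ 2 2) -w2 sqr_sqrtr// ltW.
have w0 : 0 < w by rewrite !sqrtr_gt0.
have h2 : is_derive s 1 (fun s : R => s + e) 1.
  by apply: is_derive_eq; rewrite addr0.
have h3 := @is_derive_comp1 _ _ _ _ _ _ h2 (is_derive1_sqrt se).
have h4 : is_derive (Num.sqrt (s + e)) 1 Num.sqrt (2 * w)^-1.
  by apply: is_derive1_sqrt; rewrite sqrtr_gt0.
have h5 := @is_derive_comp1 _ _ _ _ _ _ h3 h4.
have h6 := @is_deriveV _ (fun s : R => Num.sqrt (Num.sqrt (s + e))) s _ _ (lt0r_neq0 w0) h5.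
have h7 : is_derive s 1 (fun s : R => - (s / 2)) (- 2^-1).
  by apply: is_derive_eq; rewrite /GRing.scale /=; ring.
have h8 := @is_derive_comp1 _ _ _ _ _ _ h7 (is_derive_expR _).
rewrite /reg /dreg; apply: is_derive_eq; rewrite /GRing.scale /= /reg -/w w2 w4.
by field; exact: lt0r_neq0.
Qed.

Definition hreg e x := reg e (dotp x x).

Lemma continuous_reg e : 0 < e -> continuous (hreg e).
Proof.
move=> e0 x; have cd := @continuous_dotp R n x.
have se : 0 < dotp x x + e by rewrite ltr_wpDl// dotp_ge0.
apply: (@continuousM _ _ (fun x => expR (- (dotp x x / 2)))
    (fun x => (Num.sqrt (Num.sqrt (dotp x x + e)))^-1)).
  apply: (@continuous_comp _ _ _ (fun x => - (dotp x x / 2)) expR); last exact: continuous_expR.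
  apply: continuousN; apply: continuousM => //; exact: cst_continuous.
apply: (@continuousV _ _ (fun x => Num.sqrt (Num.sqrt (dotp x x + e)))).
  by rewrite lt0r_neq0// !sqrtr_gt0.
apply: (@continuous_comp _ _ _ (fun x => Num.sqrt (dotp x x + e)) Num.sqrt);
  last exact: sqrt_continuous.
apply: (@continuous_comp _ _ _ (fun x => dotp x x + e) Num.sqrt);
  last exact: sqrt_continuous.
by apply: continuousD => //; exact: cst_continuous.
Qed.

Lemma continuous_dreg e : 0 < e -> continuous (fun x => dreg e (dotp x x)).
Proof.
move=> e0 x; have cd := @continuous_dotp R n x.
have se : 0 < dotp x x + e by rewrite ltr_wpDl// dotp_ge0.
apply: (@continuousM _ _ (fun x => - (2^-1 + (4 * (dotp x x + e))^-1)) (hreg e));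
  last exact: continuous_reg.
apply: continuousN; apply: continuousD; first exact: cst_continuous.
apply: (@continuousV _ _ (fun x => 4 * (dotp x x + e))); first by rewrite lt0r_neq0// mulr_gt0.
by apply: continuousM; [exact: cst_continuous|apply: continuousD => //; exact: cst_continuous].
Qed.

Lemma is_derive_hreg e (j : 'I_n) x : 0 < e ->
  is_derive x (delta_mx 0 j) (hreg e) (dreg e (dotp x x) * (2 * x 0 j)).
Proof.
move=> e0; have := is_derive_sqr_enorm x (delta_mx 0 j); rewrite dotp_delta => h.
by apply: is_derive_rV_comp h (is_derive_reg e0 (dotp_ge0 x)).
Qed.

Variables (phi : 'rV[R]_n -> R) (r : R).
Hypotheses (sphi : smooth phi) (phi0 : forall x, r < enorm x -> phi x = 0).

Lemma continuous_partial_smooth (j : 'I_n) : continuous (partial j phi).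
Proof. by move=> x; exact/differentiable_continuous/(sphi [:: j]). Qed.

(** Integration by parts; as [k != j], the factor [x 0 k] is constant in direction [j], and the
    derivative falls on the radial factor and on [phi] only. *)
Lemma Rintegral_reg_partial e (j k : 'I_n) : 0 < e -> k != j ->
  \int[lam]_x (x 0 k * hreg e x * partial j phi x) =
  - \int[lam]_x (x 0 k * (dreg e (dotp x x) * (2 * x 0 j)) * phi x).
Proof.
move=> e0 kj; have cp : continuous phi.
  by move=> x; exact/differentiable_continuous/(sphi [::]).
have cpj := @continuous_partial_smooth j.
have ch := continuous_reg e0; have cdh := continuous_dreg e0.
have cc (i : 'I_n) : continuous (fun x : 'rV[R]_n => x 0 i) by exact: continuous_coord.
pose F x := x 0 k * hreg e x * phi x.
pose D1 x := x 0 k * hreg e x * partial j phi x.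
pose D2 x := x 0 k * (dreg e (dotp x x) * (2 * x 0 j)) * phi x.
have cM (f g : 'rV[R]_n -> R) : continuous f -> continuous g -> continuous (fun x => f x * g x).
  by move=> cf cg x; apply: continuousM; [exact: cf|exact: cg].
have cF : continuous F by apply: (cM) => //; exact: (cM).
have cD1 : continuous D1 by apply: (cM) => //; exact: (cM).
have cD2 : continuous D2.
  apply: (cM) => //; apply: (cM) => //; apply: (cM) => //.
  by apply: (cM) => // x; exact: cst_continuous.
have [CF hF] : exists C, forall x, `|F x| <= C * weight x.
  by apply: (compact_support_le_weight cF) => x /phi0 h; rewrite /F h mulr0.
have [C1 h1] : exists C, forall x, `|D1 x| <= C * weight x.
  apply: (compact_support_le_weight cD1) => x /(derive_eq0_outside _ phi0) h.
  by rewrite /D1 /partial h mulr0.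
have [C2 h2] : exists C, forall x, `|D2 x| <= C * weight x.
  by apply: (compact_support_le_weight cD2) => x /phi0 h; rewrite /D2 h mulr0.
have mc (f : 'rV[R]_n -> R) : continuous f -> measurable_fun setT f := @continuous_measurable_rV R n f.
have I (f : 'rV[R]_n -> R) C : continuous f -> (forall x, `|f x| <= C * weight x) -> integrable_fun lam f.
  move=> cf hf; apply: integrable_fun_dominated hf _; first exact: (mc f cf).
  exact: integrable_funZl (integrable_weight _ _).
have I1 := I _ _ cD1 h1; have I2 := I _ _ cD2 h2.
apply/eqP; rewrite -subr_eq0 opprK -RintegralD//; apply/eqP.
have cD : continuous (fun x => D1 x + D2 x) by move=> x; apply: continuousD; [exact: cD1|exact: cD2].
apply: (@Rintegral_partial_eq0 R n j F (fun x => D1 x + D2 x) (CF + (C1 + C2))).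
- move=> x.
  have dk : is_derive x (delta_mx 0 j) (fun x => x 0 k) 0.
    have := is_derive_dotp x (delta_mx 0 j) (delta_mx 0 k).
    rewrite dotp_delta mxE eq_sym (negbTE kj) andbF => h.
    by under eq_fun do rewrite -dotp_delta dotpC.
  have dh := is_derive_hreg j x e0.
  have dp : is_derive x (delta_mx 0 j) phi (partial j phi x).
    by apply: derivableP; apply: diff_derivable; exact: (sphi [::]).
  by apply: is_derive_eq; rewrite /GRing.scale /= /D1 /D2 /hreg; ring.
- move=> x t; apply: (@continuous_comp _ _ _ (fun t : R => t *: delta_mx 0 j + x)
    (fun x => D1 x + D2 x)); [exact: continuous_line|exact: cD].
- exact: (mc _ cD).
- move=> x; rewrite (le_trans (hF x))// ler_wpM2r ?weight_ge0// lerDl.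
  have w0 := weight_gt0 x.
  by rewrite addr_ge0// -(pmulr_lge0 _ w0) (le_trans _ (h1 x), le_trans _ (h2 x)).
- move=> x; rewrite (le_trans (ler_normD _ _))// (le_trans (lerD (h1 x) (h2 x)))//.
  rewrite -mulrDl ler_wpM2r ?weight_ge0// lerDr.
  by rewrite -(pmulr_lge0 _ (weight_gt0 x)) (le_trans _ (hF x)).
Qed.

(** By parts, both sides become minus the integral of 2 x_0 x_1 times one radial factor times [phi]:
    the symmetry in the two indices expresses tangency to spheres. *)
Lemma Rintegral_reg_rot e : 0 < e ->
  \int[lam]_x (x 0 'i1 * hreg e x * partial 'i0 phi x) =
  \int[lam]_x (x 0 'i0 * hreg e x * partial 'i1 phi x).
Proof.
move=> e0; rewrite !Rintegral_reg_partial//; congr (- _).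
by apply: eq_Rint => x; ring.
Qed.

Lemma hreg_ge0 e x : 0 <= hreg e x.
Proof. by rewrite divr_ge0 ?expR_ge0 ?sqrtr_ge0. Qed.

(** Uniform in [e], as the domination for the limit e -> 0 must be. *)
Lemma mul_hreg_le1 e x (k : 'I_n) : 0 < e -> `|x 0 k * hreg e x| <= 1.
Proof.
move=> e0; rewrite normrM (ger0_norm (hreg_ge0 _ _)).
(* By the convention on division [hh] is 0 at the origin, so the comparison of [hreg] with [hh]
   below is valid only for x != 0. *)
have [->|x0] := eqVneq x 0; first by rewrite mxE normr0 mul0r.
have d0 : 0 < enorm x by exact: enorm_gt0.
have hle : hreg e x <= hh x.
  rewrite ler_wpM2l ?expR_ge0// lef_pV2 ?posrE ?(sqrtr_gt0 (enorm _))//; last first.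
    by rewrite !sqrtr_gt0 ltr_wpDl// dotp_ge0.
  by rewrite ler_wsqrtr// ler_wsqrtr// lerDl ltW.
rewrite (le_trans (ler_pM _ (hreg_ge0 _ _) (coord_le_enorm x k) hle))//.
by rewrite enorm_mul_hh sqrt_gauss_le1// enorm_ge0.
Qed.

Lemma cvg_hreg x : x != 0 -> (fun N => hreg N.+1%:R^-1 x) @ \oo --> hh x.
Proof.
move=> x0; have d0 : 0 < enorm x by exact: enorm_gt0.
apply: cvgM; first exact: cvg_cst.
apply: cvgV; first by rewrite lt0r_neq0// (sqrtr_gt0 (enorm _)).
apply: (cvg_comp (fun N => Num.sqrt (dotp x x + N.+1%:R^-1)) Num.sqrt); last exact: sqrt_continuous.
apply: (cvg_comp (fun N => dotp x x + N.+1%:R^-1) Num.sqrt); last exact: sqrt_continuous.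
have h : (fun N => dotp x x + N.+1%:R^-1) @ \oo --> dotp x x + 0.
  by apply: cvgD; [exact: cvg_cst|exact: cvg_harmonic].
by rewrite addr0 in h.
Qed.

Lemma cvg_Rintegral_reg (j k : 'I_n) :
  (fun N => \int[lam]_x (x 0 k * hreg N.+1%:R^-1 x * partial j phi x)) @ \oo -->
  \int[lam]_x (x 0 k * hh x * partial j phi x).
Proof.
have cpj := @continuous_partial_smooth j.
have mpj : measurable_fun setT (partial j phi) by exact: continuous_measurable_rV.
have mc := @measurable_coord R n k.
have [C hC] : exists C, forall x, `|partial j phi x| <= C * weight x.
  by apply: (compact_support_le_weight cpj) => x; exact: derive_eq0_outside phi0.
apply: (@Rintegral_dominated_cvg _ _ _ _ _ _ (fun x => C * weight x)).
- move=> N; apply: measurable_funM => //; apply: measurable_funM => //.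
  by apply: continuous_measurable_rV; apply: continuous_reg; rewrite invr_gt0.
- by apply: measurable_funM => //; apply: measurable_funM => //; exact: measurable_hh.
- move=> x; apply: cvgM; last exact: cvg_cst.
  (* At the origin [hreg] blows up as e -> 0, but the factor [x 0 k] is 0. *)
  have [->|x0] := eqVneq x 0.
    by under eq_cvg do rewrite mxE mul0r; rewrite mxE mul0r; exact: cvg_cst.
  by apply: cvgM; [exact: cvg_cst|exact: cvg_hreg].
- exact: integrable_funZl (integrable_weight _ _).
- move=> N x; rewrite normrM (le_trans _ (hC x))// ler_piMl// mul_hreg_le1//.
Qed.

Lemma integrable_rot (j k : 'I_n) :
  integrable_fun lam (fun x => x 0 k * hh x * partial j phi x).
Proof.
have cpj := @continuous_partial_smooth j.
have [C hC] : exists C, forall x, `|partial j phi x| <= C * weight x.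
  by apply: (compact_support_le_weight cpj) => x; exact: derive_eq0_outside phi0.
apply: integrable_fun_dominated (integrable_funZl C (integrable_weight _ _)).
  apply: measurable_funM; last exact: continuous_measurable_rV.
  by apply: measurable_funM; [exact: measurable_coord|exact: measurable_hh].
move=> x; rewrite normrM (le_trans _ (hC x))// ler_piMl//.
rewrite normrM (ger0_norm (hh_ge0 x)).
rewrite (le_trans (ler_wpM2r (hh_ge0 x) (coord_le_enorm x k)))//.
by rewrite enorm_mul_hh sqrt_gauss_le1// enorm_ge0.
Qed.

Lemma Rintegral_rot :
  \int[lam]_x (x 0 'i1 * hh x * partial 'i0 phi x) =
  \int[lam]_x (x 0 'i0 * hh x * partial 'i1 phi x).
Proof.
apply: (cvg_unique _ (@cvg_Rintegral_reg 'i0 'i1)) => //.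
have -> : (fun N => \int[lam]_x (x 0 'i1 * hreg N.+1%:R^-1 x * partial 'i0 phi x)) =
  (fun N => \int[lam]_x (x 0 'i0 * hreg N.+1%:R^-1 x * partial 'i1 phi x)).
  by apply/funext => N; apply: Rintegral_reg_rot; rewrite invr_gt0.
exact: cvg_Rintegral_reg.
Qed.

End divergence.

Lemma divergence_free_vel (R : realType) (m : nat) : divergence_free (@vel R m).
Proof.
move=> phi [sphi [r phi0]].
have E0 : \int[@lebesgue_rV R m.+2]_x (vel x 0 ord0 * partial ord0 phi x) =
    - \int[@lebesgue_rV R m.+2]_x (x 0 (lift ord0 ord0) * hh x * partial ord0 phi x).
  rewrite -mulN1r -RintegralZl//; last exact: integrable_rot sphi phi0 _ _.
  by apply: eq_Rint => x; rewrite mxE /=; ring.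
have E1 : \int[@lebesgue_rV R m.+2]_x
      (vel x 0 (lift ord0 ord0) * partial (lift ord0 ord0) phi x) =
    \int[@lebesgue_rV R m.+2]_x (x 0 ord0 * hh x * partial (lift ord0 ord0) phi x).
  by apply: eq_Rint => x; rewrite mxE.
rewrite big_ord_recl big_ord_recl big1 => [|i _]; last first.
  transitivity (\int[@lebesgue_rV R m.+2]_x (0 : R)).
    by apply: eq_Rint => x; rewrite vel_eq0// mul0r.
  by rewrite Rintegral_cst// mul0r.
by rewrite E0 E1 (Rintegral_rot sphi phi0) [X in _ + X]addr0 addNr.
Qed.

(** * The pressure is conical at the origin *)

Section cone.
Context (R : realType) (m : nat).
Local Notation n := m.+2.
Local Notation leb := (@lebesgue_measure R).
Local Notation leb2 := (leb \x leb)%E.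
Local Notation par := (measurableTypeR R * measurableTypeR R)%type.
Local Notation "'i0" := (ord0 : 'I_n).
Local Notation "'i1" := (lift ord0 ord0 : 'I_n).
Implicit Types (x : 'rV[R]_n) (q : par).

Definition trace_atom q x : R := atom true false q x + atom false true q x.

Lemma trace_atomE q x : trace_atom q x = ycut m.+1 q.2 / sv q.1 *
  ((alpha q * (x 0 'i0 ^+ 2 + x 0 'i1 ^+ 2) - 1) * gauss (alpha q) x).
Proof.
rewrite /trace_atom /atom /base /dd /= muln0 expr0.
by field; rewrite gt_eqF ?sv_gt0.
Qed.

(** At 0 the bracket of [trace_atomE] times the Gaussian is -1. For general x its quadratic part is
    nonnegative; dropping it leaves 1 - [gauss]. *)
Lemma trace_atom_sub0 q x :
  ycut m.+1 q.2 / sv q.1 * (1 - gauss (alpha q) x) <= trace_atom q x - trace_atom q 0.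
Proof.
rewrite !trace_atomE -mulrBr ler_wpM2l//.
  by rewrite divr_ge0 ?ycut_ge0// ltW// sv_gt0.
have -> : gauss (alpha q) (0 : 'rV[R]_n) = 1.
  by rewrite /gauss /dotp big1 ?mulr0 ?oppr0 ?expR0// => i _; rewrite mxE mul0r.
have : 0 <= alpha q * (x 0 'i0 ^+ 2 + x 0 'i1 ^+ 2) * gauss (alpha q) x.
  by rewrite mulr_ge0 ?gauss_ge0// mulr_ge0 ?alpha_ge0// addr_ge0 ?sqr_ge0.
by rewrite !mxE; lra.
Qed.

(** The product of the lower bounds on [window]: 2^(-m-3) from y <= 2, one 1/5 from 1 / s >= r^2 / 5
    and one from 1 - [gauss] >= 1/5. *)
Definition slope : R := (2^-1) ^+ m.+3 / 25.

Lemma slope_gt0 : 0 < slope.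
Proof. by rewrite divr_gt0// exprn_gt0// invr_gt0. Qed.

(* Parameters for which [alpha q * enorm x ^+ 2] is bounded away from 0 when
   [enorm x = r]. *)
Definition window (r : R) : set par := `[r^-1, 2 / r]%classic `*` `[1, 2]%classic.

Lemma trace_atom_window q x : 0 < enorm x -> enorm x <= 1 -> window (enorm x) q ->
  slope * enorm x ^+ 2 <= trace_atom q x - trace_atom q 0.
Proof.
move=> r0 r1; case: q => v y [] /=; rewrite !in_itv /=.
set r := enorm x in r0 r1 *.
move=> /andP[v1 v2] /andP[y1 y2]; rewrite (le_trans _ (trace_atom_sub0 _ _))//=.
have y0 : 0 < y := lt_le_trans ltr01 y1.
have v0 : 0 < v by rewrite (lt_le_trans _ v1)// invr_gt0.
have vr1 : 1 <= v * r by rewrite -ler_pdivrMr// div1r.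
have vr2 : v * r <= 2 by rewrite -ler_pdivlMr.
(* From v <= 2 / r and r <= 1 one has s r^2 <= 5. *)
have hs : r ^+ 2 / 5 <= (sv v)^-1.
  rewrite -[leRHS]div1r ler_pdivlMr ?sv_gt0// /sv; nra.
have hy : 2^-1 ^+ m.+3 <= ycut m.+1 y.
  rewrite /ycut /ind y1 mul1r lerXn2r ?nnegrE ?invr_ge0 ?(ltW y0)//.
  by rewrite lef_pV2 ?posrE.
(* Here alpha |x|^2 >= 1/4 because v r >= 1 and y <= 2, and 1 - exp (- t) >= 1 - 1 / (1 + t), which
   is 1/5 at t = 1/4. *)
have hg : 5^-1 <= 1 - gauss (alpha (v, y)) x.
  have ha : 4^-1 <= alpha (v, y) * dotp x x.
    rewrite -enorm_sqr -/r (_ : _ * _ = sv v * r ^+ 2 / y ^+ 2); last first.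
      by rewrite /alpha /=; ring.
    rewrite ler_pdivlMr ?exprn_gt0// /sv; nra.
  have := expR_ge1Dx (alpha (v, y) * dotp x x).
  rewrite /gauss expRN => h.
  have : (expR (alpha (v, y) * dotp x x))^-1 <= (5 / 4)^-1 by rewrite lef_pV2 ?posrE ?expR_gt0//; lra.
  lra.
have p0 : 0 <= 2^-1 ^+ m.+3 :> R by rewrite exprn_ge0.
rewrite (_ : slope * r ^+ 2 = 2^-1 ^+ m.+3 * (r ^+ 2 / 5) * 5^-1); last by rewrite /slope; field.
have r5 : 0 <= r ^+ 2 / 5 by rewrite divr_ge0 ?sqr_ge0.
apply: ler_pM => //; first exact: mulr_ge0.
by apply: ler_pM.
Qed.

Lemma trace_atom_ge0 q x : 0 <= trace_atom q x - trace_atom q 0.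
Proof.
rewrite (le_trans _ (trace_atom_sub0 _ _))// mulr_ge0//.
  by rewrite divr_ge0 ?ycut_ge0// ltW// sv_gt0.
by rewrite subr_ge0 -expR0 ler_expR oppr_le0 mulr_ge0 ?alpha_ge0 ?dotp_ge0.
Qed.

Lemma pressure_velB x : pressure_vel x - pressure_vel (0 : 'rV[R]_n) =
  (Num.sqrt pi)^-1 * \int[leb2]_q (trace_atom q x - trace_atom q 0).
Proof.
have I b0 b1 z := @integrable_atom_q R m b0 b1 z.
have Is z : integrable_fun leb2 (trace_atom^~ z) by exact: integrable_funD.
rewrite RintegralB// !RintegralD//.
by rewrite /pressure_vel /pot mulrBr.
Qed.

(** The integrand is nonnegative and at least [slope] r^2 on a window of measure (2 / r - 1 / r) (2
    - 1) = 1 / r, so the gain is of order r and not r^2. The cone thus comes from large v, which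
    encode the singularity of 1 / |x|. *)
Lemma pressure_vel_cone x : enorm x <= 1 ->
  (Num.sqrt pi)^-1 * slope * enorm x <= pressure_vel x - pressure_vel (0 : 'rV[R]_n).
Proof.
move=> r1; rewrite pressure_velB -mulrA ler_wpM2l ?invr_ge0 ?sqrtr_ge0//.
have I b0 b1 z := @integrable_atom_q R m b0 b1 z.
have Is z : integrable_fun leb2 (trace_atom^~ z) by exact: integrable_funD.
have ID : integrable_fun leb2 (fun q => trace_atom q x - trace_atom q 0).
  exact: integrable_funB.
have := enorm_ge0 x; rewrite le_eqVlt => /predU1P[<-|r0].
  by rewrite mulr0; apply: Rintegral_ge0 => q _; exact: trace_atom_ge0.
set r := enorm x in r1 r0 *.
have mW : measurable (window r) by apply: measurableX; exact: measurable_itv.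
have r2 : r^-1 <= 2 / r by rewrite ler_peMl ?invr_ge0 ?ler1n ?(ltW r0).
have mitv (a b : R) : a < b -> leb `[a, b]%classic = (b - a)%:E.
  by move=> ab; rewrite lebesgue_measure_itv /= lte_fin ab.
have muW : leb2 (window r) = (r^-1)%:E.
  rewrite product_measure1E ?measurable_itv//.
  transitivity (leb `[r^-1%R, (2 / r)%R]%classic * leb `[1%R, 2%R]%classic)%E => //.
  rewrite !mitv//; last by rewrite ltr_pMl ?invr_gt0// ltr1n.
    by rewrite -EFinM; congr (_%:E); field; rewrite gt_eqF.
  by rewrite ltr1n.
have mI : measurable_fun setT (\1_(window r) : par -> R) by exact: measurable_indic.
have intW : (\int[leb2]_q (\1_(window r) q)%:E = (r^-1)%:E)%E.
  by rewrite integral_indic// setIT.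
have Iw : integrable_fun leb2 (\1_(window r) : par -> R).
  by apply: integral_ge0_lty => //; rewrite intW ltry.
have <- : \int[leb2]_q (slope * r ^+ 2 * \1_(window r) q) = slope * r.
  rewrite RintegralZl// /Rintegral intW /=; field; exact: lt0r_neq0.
apply: le_Rintegral => //; first exact: integrable_funZl.
move=> q _; rewrite indicE; have [|_] := boolP (q \in window r).
  by rewrite inE mulr1 => wq; exact: trace_atom_window.
by rewrite mulr0 trace_atom_ge0.
Qed.

Lemma continuous_atom b0 b1 q : continuous (atom b0 b1 q : 'rV[R]_n -> R).
Proof.
have cM (f g : 'rV[R]_n -> R) : continuous f -> continuous g -> continuous (fun x => f x * g x).
  by move=> cf cg x; apply: continuousM; [exact: cf|exact: cg].
have cB (f g : 'rV[R]_n -> R) : continuous f -> continuous g -> continuous (fun x => f x - g x).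
  by move=> cf cg x; apply: continuousB; [exact: cf|exact: cg].
have cc (c : R) : continuous (fun _ : 'rV[R]_n => c) by move=> x; exact: cst_continuous.
have cdd b a (i : 'I_n) : continuous (fun x : 'rV[R]_n => dd b a (x 0 i)).
  have ci := @continuous_coord R n i.
  case: b => //=; apply: (cB); first by apply: (cM) => //; apply: (cM).
  exact: cc.
apply: (cM) => //; apply: (cM); first exact: (cM).
move=> x; apply: (@continuous_comp _ _ _ (fun x => - (alpha q * dotp x x)) expR);
  last exact: continuous_expR.
by apply: continuousN; apply: (cM) => // y; exact: continuous_dotp.
Qed.

Lemma cvg_pot b0 b1 (z : nat -> 'rV[R]_n) x : z @ \oo --> x ->
  (fun k => pot b0 b1 (z k)) @ \oo --> pot b0 b1 x.
Proof.
move=> zx; apply: (@Rintegral_dominated_cvg _ _ _ _ _ _ (@bnd R)).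
- by move=> k; exact: measurable_atom_q.
- exact: measurable_atom_q.
- by move=> q; apply: (cvg_comp z (atom b0 b1 q)) zx _; exact: continuous_atom.
- exact: integrable_bnd.
- by move=> k q; exact: atom_le_bnd.
Qed.

Lemma cvg_pressure_vel (z : nat -> 'rV[R]_n) x : z @ \oo --> x ->
  (fun k => pressure_vel (z k)) @ \oo --> pressure_vel x.
Proof.
by move=> zx; apply: cvgM; [exact: cvg_cst|apply: cvgD; exact: cvg_pot].
Qed.

End cone.

(** * From the conical minimum to the absence of a C^1 representative *)

Section almost_everywhere.
Context (R : realType) (n : nat).
Local Notation lam := (@lebesgue_rV R n).

(** A nonempty open set contains a box of positive measure, which no null set can contain; a closed
    box of half-side e / 2 fits into the open ball of radius e. *)
Lemma ae_dense (P U : set 'rV[R]_n) : {ae lam, forall x, P x} ->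
  open U -> U !=set0 -> (U `&` P) !=set0.
Proof.
move=> [N [mN N0 PN]] oU [x Ux].
have /nbhs_ballP[e /= e0 xeU] : nbhs x U by apply: open_nbhs_nbhs.
pose A (i : 'I_n) : set R := `[x 0 i - e / 2, x 0 i + e / 2]%classic.
have mA i : measurable (A i) by exact: measurable_itv.
pose B := [set y : 'rV[R]_n | forall i : 'I_n, A i (y 0 i)].
have muB : lam B = _ := lebesgue_rV_box mA.
have mB : measurable B.
  rewrite (_ : B = \bigcap_(i in [set: 'I_n]) ((fun y => y 0 i) @^-1` A i)).
    apply: fin_bigcap_measurable => // i _.
    by rewrite -[X in measurable X]setTI; exact: measurable_coord.
  by apply/seteqP; split=> [y By i _|y By i]; [exact: By|exact: (By i I)].
have [//|h] := pselect ((U `&` P) !=set0).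
have BN : B `<=` N.
  move=> y By; apply: PN => Py; apply: h; exists y; split => //.
  apply: xeU; split => // i j; rewrite ord1.
  have := By j; rewrite /A /= in_itv /= /ball /= => /andP[h1 h2].
  by rewrite ltr_norml; apply/andP; split; lra.
have : (lam B <= 0)%E by rewrite -N0 le_measure ?inE.
rewrite muB leNgt => /negP; case.
have -> : (\prod_(i < n) lebesgue_measure (A i) = (e ^+ n)%:E)%E.
  transitivity (\prod_(i < n) e%:E)%E; last by rewrite prodEFin prodr_const card_ord.
  apply: eq_bigr => i _; rewrite /A lebesgue_measure_itv /= lte_fin.
  by rewrite ifT; [congr (_%:E); field|lra].
by rewrite lte_fin exprn_gt0.
Qed.

End almost_everywhere.


Lemma enorm_delta (R : realType) n (i : 'I_n) : enorm (delta_mx 0 i : 'rV[R]_n) = 1.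
Proof. by rewrite /enorm dotp_delta mxE !eqxx sqrtr1. Qed.

(** Along an axis the difference quotients at t and - t are at least c and at most - c, so they
    cannot both lie at distance less than c from one number [d]. *)
Lemma conical_not_differentiable (R : realType) (m : nat) (f : 'rV[R]_m.+1 -> R) (c : R) :
  0 < c -> (forall x, enorm x < 1 -> c * enorm x <= f x - f 0) ->
  ~ differentiable f 0.
Proof.
move=> c0 cone df; pose v : 'rV[R]_m.+1 := delta_mx 0 ord0.
have /cvg_ex[d hd] : derivable f 0 v by exact: diff_derivable.
have [e /= e0 he] := hd _ (nbhsx_ballx d c c0).
pose t := Num.min (e / 2) (1 / 2).
have t0 : 0 < t by rewrite lt_min !divr_gt0.
have te : t < e by rewrite gt_min; apply/orP; left; lra.
have t1 : t < 1 by rewrite gt_min; apply/orP; right; lra.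
have ev s : enorm (s *: v) = `|s| by rewrite enormZ enorm_delta mulr1.
have S s : `|s| = t -> `|d - s^-1 * (f (s *: v) - f 0)| < c.
  move=> st; have s0 : s != 0 by rewrite -normr_gt0 st.
  have := he s; rewrite /ball_ /= sub0r normrN st => /(_ te s0).
  by rewrite /ball /= addr0.
have C s : `|s| = t -> c * t <= f (s *: v) - f 0.
  by move=> st; have := cone (s *: v); rewrite ev st => /(_ t1).
have tt : `|t| = t by rewrite gtr0_norm.
have tN : `|- t| = t by rewrite normrN.
have := S _ tt; have := S _ tN; have := C _ tt; have := C _ tN.
rewrite invrN mulNr opprK !ltr_norml => h1 h2 /andP[_ h3] /andP[h4 _].
have k1 : c <= t^-1 * (f ((- t) *: v) - f 0) by rewrite mulrC ler_pdivlMr.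
have k2 : c <= t^-1 * (f (t *: v) - f 0) by rewrite mulrC ler_pdivlMr.
lra.
Qed.

Lemma pressure_vel_not_C1 (R : realType) (m : nat) : ~ ae_C1b (@pressure_vel R m).
Proof.
move=> [f [df _ _ _] aef].
have cf : continuous f by move=> x; exact/differentiable_continuous/df.
pose c := (Num.sqrt pi)^-1 * @slope R m.
have c0 : 0 < c by rewrite mulr_gt0 ?slope_gt0// invr_gt0 sqrtr_gt0 pi_gt0.
(* Agreement almost everywhere says nothing at the point 0 itself; continuity of both functions
   along points of agreement tending to 0 does. *)
have f0 : f 0 = pressure_vel (0 : 'rV[R]_m.+2).
  have /choice[z hz] : forall k : nat, exists z : 'rV[R]_m.+2,
      ball 0 k.+1%:R^-1 z /\ pressure_vel z = f z.
    move=> k; apply: (ae_dense aef); first exact: ball_open.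
    by exists 0; apply: ballxx; rewrite invr_gt0.
  have z0 : z @ \oo --> (0 : 'rV[R]_m.+2).
    apply/cvg_ballP => e e0; near=> k.
    have ke : k.+1%:R^-1 < e by near: k; exact: (near_infty_natSinv_lt (PosNum e0)).
    exact: le_ball (ltW ke) _ (hz k).1.
  apply: (cvg_unique _ (cvg_comp z f z0 (cf 0))) => //.
  have -> : f \o z = (fun k => pressure_vel (z k)) by apply/funext => k; rewrite /= (hz k).2.
  exact: cvg_pressure_vel.
(* If [f] violated the cone inequality at [x], it would do so on an open set, hence at a point where
   it agrees with the pressure. *)
apply: (conical_not_differentiable c0 _ (df 0)) => x x1; rewrite leNgt; apply/negP => fx.
have ch : continuous (fun x : 'rV[R]_m.+2 => f x - f 0 - c * enorm x).
  have cB (g h : 'rV[R]_m.+2 -> R) : continuous g -> continuous h -> continuous (fun x => g x - h x).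
    by move=> cg ch y; apply: continuousB; [exact: cg|exact: ch].
  apply: (cB); first by apply: (cB) => // y; exact: cst_continuous.
  have ce := @continuous_enorm R m.+2.
  have cc : continuous (fun _ : 'rV[R]_m.+2 => c) by move=> y; exact: cst_continuous.
  by move=> y; exact: (continuousM (cc y) (ce y)).
have oU : open [set y : 'rV[R]_m.+2 | f y - f 0 - c * enorm y < 0 /\ enorm y < 1].
  apply: openI; [apply: (@open_comp _ _ _ [set t : R | t < 0])|
    apply: (@open_comp _ _ _ [set t : R | t < 1])]; try exact: open_lt.
    by move=> y _; exact: ch.
  by move=> y _; exact: continuous_enorm.
have [y [[fy y1] py]] : exists y, (f y - f 0 - c * enorm y < 0 /\ enorm y < 1) /\
    pressure_vel y = f y.
  by apply: (ae_dense aef oU); exists x; split => //; rewrite subr_lt0.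
have := pressure_vel_cone (ltW y1); rewrite -/c py -f0.
by rewrite leNgt -subr_lt0 fy.
Unshelve. all: by end_near. Qed.

Theorem theorem1p5 (R : realType) (n : nat) (n_ge2 : (2 <= n)%N) :
  exists u : 'rV[R]_n -> 'rV[R]_n,
    [/\ divergence_free u, holder (1 / 2) u, square_integrable u
      & exists2 p : 'rV[R]_n -> R, pressure u p & ~ ae_C1b p].
Proof.
case: n n_ge2 => [|[|m]] // _; exists (@vel R m); split.
- exact: divergence_free_vel.
- exact: holder_vel.
- exact: square_integrable_vel.
- by exists (@pressure_vel R m); [exact: pressure_velP|exact: pressure_vel_not_C1].
Qed.
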